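(* Let $N$ be a complete $n$-dimensional Riemannian manifold with a pole and with radial sectional curvature bounded above by $K_N\leq-\kappa^2<0$, where $\kappa>0$. Let $M\subset N\times\mathbb{R}$ be a closed immersed hypersurface with constant mean curvature $H_M$. Then the extrinsic radius of $p_1(M)$ satisfies $$R_{p_1(M)}\;\geq\;\frac{1}{\kappa}\coth^{-1}\!\left(\frac{n}{(n-1)\,\kappa}\,|H_M|\right).$$ In particular, if $M_i\subset N\times\mathbb{R}$ is a sequence of closed immersed hypersurfaces with constant mean curvatures satisfying $|H_{M_i}|\to (n-1)\kappa/n$, then $R_{p_1(M_i)}\to\infty$.
   Context: Here $n\geq 2$. A pole of a complete Riemannian manifold $N$ is a point $x_o\in N$ such that $\exp_{x_o}:T_{x_o}N\to N$ is a diffeomorphism. ''Radial sectional curvature bounded above by $-\kappa^2$'' means that the sectional curvatures along the geodesics emanating from the pole (i.e. of tangent 2-planes containing the velocity vector of such a geodesic) are at most $-\kappa^2$. $N\times\mathbb{R}$ carries the product metric and $p_1:N\times\mathbb{R}\to N$ is the projection on the first factor. Closed means compact without boundary. The mean curvature is normalized: if $\alpha$ is the second fundamental form of the $n$-dimensional hypersurface $M$ and $\{e_1,\dots,e_n\}$ is an orthonormal basis of $T_qM$, then $\left|\sum_{i=1}^n\alpha(e_i,e_i)\right|=n\,|H_M|$. The extrinsic radius $R_{p_1(M)}$ of $p_1(M)\subset N$ is the smallest radius of a closed geodesic ball of $N$ centered at the pole $x_o$ containing $p_1(M)$, i.e. $R_{p_1(M)}=\max_{x\in p_1(M)}\mathrm{dist}_N(x_o,x)$.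 $\coth^{-1}:(1,\infty)\to(0,\infty)$ is the inverse of the hyperbolic cotangent, with the convention $\coth^{-1}(1)=+\infty$; $|H_M|\ge (n-1)\kappa/n$ holds for every such $M$. *)

(* Defs.v *)
From mathcomp Require Import all_boot all_order all_algebra.
From mathcomp Require Import all_classical all_reals all_analysis.

Set Implicit Arguments.
Unset Strict Implicit.
Unset Printing Implicit Defensive.

Import Order.TTheory GRing.Theory Num.Theory.
Import numFieldNormedType.Exports.

Local Open Scope classical_set_scope.
Local Open Scope ring_scope.

Section Calculus.
Context {R : realType} {n : nat}.
Implicit Types (U : set 'rV[R]_n) (F : 'rV[R]_n -> R).

Definition pder (i : 'I_n) F (x : 'rV[R]_n) : R := 'D_(delta_mx 0 i) F x.

(* Meant for U open: partial derivatives on U only depend on F on U. *)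
Fixpoint Ck (k : nat) U F : Prop :=
  if k is k'.+1 then
    forall i, (forall x, U x -> derivable F x (delta_mx 0 i)) /\
              Ck k' U (pder i F)
  else {in U, continuous F}.

Definition smooth_on U F : Prop := forall k, Ck k U F.

End Calculus.

Record chart (R : realType) (n : nat) (X : Type) := Chart {
  chart_dom : set X;
  chart_to : X -> 'rV[R]_n;
  chart_from : 'rV[R]_n -> X
}.

(* The atlas is indexed by the points of the space, chart_at p being a chart
   around p.  Every smooth manifold can be presented in this way: choose, for
   each point, one chart of its maximal atlas.  The records below only carry
   the data; the axioms are is_manifold and is_riemannian. *)
Record mfd (R : realType) (n : nat) := Mfd {
  mpoint :> topologicalType;
  chart_at : mpoint -> chart R n mpoint
}.

Section Manifolds.
Context {R : realType}.

Section Charts.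
Context {n : nat} {M : mfd R n}.
Implicit Types p : M.

Definition dom p : set M := chart_dom (chart_at p).
Definition to p : M -> 'rV[R]_n := chart_to (chart_at p).
Definition from p : 'rV[R]_n -> M := chart_from (chart_at p).

End Charts.

(* The expression of f in the charts at p and q, componentwise, and its domain. *)
Section LocalExpression.
Context {m n : nat} {M : mfd R m} {N : mfd R n}.
Variable f : M -> N.

Definition loc (p : M) (q : N) (j : 'I_n) (x : 'rV[R]_m) : R :=
  to q (f (from p x)) 0 j.

Definition loc_dom (p : M) (q : N) : set 'rV[R]_m :=
  to p @` (dom p `&` f @^-1` dom q).

Definition smooth : Prop :=
  continuous f /\
  forall p q j, smooth_on (loc_dom p q) (loc p q j).

(* Matrix of df_p in the charts at p and f p; tangent vectors are rows of
   coordinates, on which it acts on the right. *)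
Definition jac (p : M) : 'M[R]_(m, n) :=
  \matrix_(i, j) pder i (loc p (f p) j) (to p p).

Definition immersion : Prop := smooth /\ forall p, row_free (jac p).

End LocalExpression.

Definition is_manifold {n} (M : mfd R n) : Prop :=
  [/\ hausdorff_space M,
      @second_countable M,
      (forall p : M,
        [/\ open (dom p), dom p p, open (to p @` dom p) &
            {in dom p, cancel (to p) (from p)}]),
      (forall p : M, {within dom p, continuous (to p)} /\
                     {within to p @` dom p, continuous (from p)}) &
      (forall (p q : M) j, smooth_on (loc_dom (@id M) p q) (loc (@id M) p q j))].

Definition diffeomorphism {m n} {M : mfd R m} {N : mfd R n} (f : M -> N) :=
  smooth f /\ exists2 g : N -> M, cancel f g /\ cancel g f & smooth g.

Definition closed_manifold {n} (M : mfd R n) : Prop :=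
  [/\ is_manifold M, compact [set: M] & [set: M] !=set0].

End Manifolds.

(* metric p is the Gram matrix of the metric in the chart at p, as a function
   of the coordinates of the base point in that chart. *)
Record riem (R : realType) (n : nat) := Riem {
  rmfd :> mfd R n;
  metric : rmfd -> 'rV[R]_n -> 'M[R]_n
}.

Section Riemannian.
Context {R : realType}.

Definition is_riemannian {n} (N : riem R n) : Prop :=
  [/\ is_manifold N,
      (forall (p : N) i j,
        smooth_on (to p @` dom p) (fun x => metric p x i j)),
      (forall (p : N) x, (to p @` dom p) x ->
        (metric p x)^T = metric p x /\
        forall v : 'rV[R]_n, v != 0 -> 0 < (v *m metric p x *m v^T) 0 0) &
      (forall (p q : N) x, loc_dom (@id N) p q x ->
        let J := \matrix_(i, j) pder i (loc (@id N) p q j) x in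
        metric p x = J *m metric q (to q (from p x)) *m J^T)].

Section LocalGeometry.
Context {n : nat}.
Variable G : 'rV[R]_n -> 'M[R]_n.
Implicit Types (x : 'rV[R]_n) (a b c d : 'I_n).

(* christoffel x c a b is Gamma^c_{ab} at x *)
Definition christoffel x c a b : R :=
  2^-1 * \sum_d invmx (G x) c d *
    (pder a (fun y => G y b d) x + pder b (fun y => G y a d) x
     - pder d (fun y => G y a b) x).

(* R(d_a, d_b) d_c = \sum_d (riemann x d c a b) d_d, with
   R(X, Y) = [nabla_X, nabla_Y] - nabla_[X, Y] *)
Definition riemann x d c a b : R :=
  pder a (fun y => christoffel y d b c) x
  - pder b (fun y => christoffel y d a c) x
  + \sum_e (christoffel x d a e * christoffel x e b c
            - christoffel x d b e * christoffel x e a c).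

End LocalGeometry.

Section Pointwise.
Context {n : nat} {N : riem R n}.
Implicit Types (p : N) (u v w : 'rV[R]_n).

(* Tangent vectors at p are given by their coordinates in the chart at p. *)
Definition inner p u v : R := (u *m metric p (to p p) *m v^T) 0 0.

Definition curvature p u v w : 'rV[R]_n :=
  \row_d \sum_a \sum_b \sum_c
    riemann (metric p) (to p p) d c a b * u 0 a * v 0 b * w 0 c.

Definition sectional p u v : R :=
  inner p (curvature p u v v) u /
    (inner p u u * inner p v v - inner p u v ^+ 2).

End Pointwise.

(* nabla_{d_i} (df d_j) at p, in the coordinates of the chart at f p, for the
   pull-back by f of the Levi-Civita connection of N. *)
Definition cov_second {m n} {M : mfd R m} {N : riem R n} (f : M -> N) (p : M)
    (i j : 'I_m) : 'rV[R]_n :=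
  \row_c (pder i (pder j (loc f p (f p) c)) (to p p)
    + \sum_a \sum_b christoffel (metric (f p)) (to (f p) (f p)) c a b
                    * jac f p i a * jac f p j b).

Definition euclid (n : nat) : mfd R n :=
  @Mfd R n ('rV[R]_n : topologicalType) (fun=> Chart setT id id).

Definition line_mfd : mfd R 1 :=
  @Mfd R 1 (R : topologicalType)
    (fun=> Chart setT (fun t => t%:M) (fun x => x 0 0)).

Definition line : riem R 1 := @Riem R 1 line_mfd (fun _ _ => 1%:M).

Definition prod_mfd {m n} (M : mfd R m) (N : mfd R n) : mfd R (m + n) :=
  @Mfd R (m + n) ((M * N)%type : topologicalType)
    (fun p => Chart (dom p.1 `*` dom p.2)
                    (fun z => row_mx (to p.1 z.1) (to p.2 z.2))
                    (fun x => (from p.1 (lsubmx x), from p.2 (rsubmx x)))).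

Definition prod_riem {m n} (M : riem R m) (N : riem R n) : riem R (m + n) :=
  @Riem R (m + n) (prod_mfd M N)
    (fun (p : prod_mfd M N) x =>
       block_mx (metric p.1 (lsubmx x)) 0 0 (metric p.2 (rsubmx x))).

Section Geodesics.
Context {n : nat} {N : riem R n}.
Implicit Types (c : line -> N) (p x y : N).

Definition velocity c (t : R) : 'rV[R]_n := row ord0 (jac c (t : line)).

Definition geodesic c : Prop :=
  smooth c /\ forall t : line, cov_second c t ord0 ord0 = 0.

(* E is exp_p, the tangent space at p being identified with 'rV_n by the chart
   at p. *)
Definition is_exp p (E : 'rV[R]_n -> N) : Prop :=
  forall v, exists c,
    [/\ geodesic c, c (0 : R) = p, velocity c 0 = v & E v = c (1 : R)].

Definition is_pole p : Prop :=
  exists2 E : euclid n -> N, is_exp p E & diffeomorphism E.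

Definition radial_sectional_le p (b : R) : Prop :=
  forall c, geodesic c -> c (0 : R) = p ->
  forall (t : R) (w : 'rV[R]_n), 0 <= t ->
    row_free (col_mx (velocity c t) w) ->
    sectional (c t) (velocity c t) w <= b.

Definition speed c (t : R) : R :=
  Num.sqrt (inner (c t) (velocity c t) (velocity c t)).

Definition arc_length c (a b : R) : R :=
  \int[lebesgue_measure]_(t in `[a, b]) speed c t.

(* There is a piecewise smooth path of length l from x to y.  (A smooth arc on
   [a, b] is the restriction of a smooth map on the whole line.) *)
Inductive joined_by : N -> N -> R -> Prop :=
| joined_nil x : joined_by x x 0
| joined_cons c (a b : R) y l :
    smooth c -> a <= b -> joined_by (c b) y l ->
    joined_by (c a) y (arc_length c a b + l).

Definition rdist x y : R := inf [set l | joined_by x y l].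

(* For A nonempty and compact the supremum is attained. *)
Definition extrinsic_radius p (A : set N) : R := sup [set rdist p x | x in A].

End Geodesics.

(* Geodesic completeness. *)
Definition complete_riem {n} (N : riem R n) : Prop :=
  is_riemannian N /\
  forall (p : N) (v : 'rV[R]_n),
    exists c : line -> N,
      [/\ geodesic c, c (0 : R) = p & velocity c 0 = v].

Section Hypersurfaces.
Context {n : nat} {M : mfd R n} {N : riem R (n + 1)}.
Variable f : M -> N.
Implicit Types (q : M) (u v : 'rV[R]_n) (nu : 'rV[R]_(n + 1)).

Definition unit_normal q nu : Prop :=
  inner (f q) nu nu = 1 /\ forall v, inner (f q) (v *m jac f q) nu = 0.

Definition second_fundamental_form q nu u v : R :=
  \sum_i \sum_j u 0 i * v 0 j * inner (f q) (cov_second f q i j) nu.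

(* The rows of E are orthonormal for the metric induced by f. *)
Definition orthonormal_basis q (E : 'M[R]_n) : Prop :=
  forall i j, inner (f q) (row i E *m jac f q) (row j E *m jac f q)
              = (i == j)%:R.

(* H is only determined up to sign, as is the unit normal. *)
Definition mean_curvature_at q (H : R) : Prop :=
  forall nu E, unit_normal q nu -> orthonormal_basis q E ->
    `|\sum_i second_fundamental_form q nu (row i E) (row i E)| = n%:R * `|H|.

Definition closed_cmc_hypersurface (H : R) : Prop :=
  [/\ closed_manifold M, immersion f & forall q, mean_curvature_at q H].

End Hypersurfaces.

Definition coth (x : R) : R :=
  (expR x + expR (- x)) / (expR x - expR (- x)).

(* The inverse of coth : ]0, +oo[ -> ]1, +oo[, extended by +oo at 1; the value
   is arbitrary below 1. *)
Definition arccoth (x : R) : \bar R :=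
  if x == 1 then +oo%E else (xget 0 [set y : R | 0 < y /\ coth y = x])%:E.

End Riemannian.

Arguments line : clear implicits.

(* Main.v *)
(* Let r be the distance to the pole and f = (p, h) the immersion, p with values
   in N. Where r o p is maximal, say equal to r0, grad r is orthogonal to the
   image of dp, so (grad r, 0) is a unit normal. There the second derivative of
   r^2 o p / 2 in a tangent direction v, which is
     Hess(r^2/2)(dp v, dp v) + <alpha(v, v), grad(r^2/2)>,
   is nonpositive, and the Hessian comparison theorem bounds the first term from
   below by r0 kappa coth(kappa r0) |dp v|^2. For an orthonormal basis (e_i) one
   has sum |dp e_i|^2 = n - |grad h|^2 >= n - 1, so summing over the e_i gives
   n |H| >= (n - 1) kappa coth(kappa r0).

   N is studied in the global chart given by the exponential map at the pole. Its
   metric g satisfies g_x(x, w) = g_0(x, w) (Gauss), whence the distance of x to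
   the pole is sqrt(g_0(x, x)), and
     Hess(r^2/2)_x(w, w) = g_0(w, w) - g_0(x, Gamma_x(w, w)). *)
From HB Require Import structures.
Require Import Defs.
From mathcomp Require Import all_boot all_order all_algebra.
From mathcomp Require Import all_classical all_reals all_analysis.
From mathcomp Require Import ring lra.
Import Order.TTheory GRing.Theory Num.Theory.
Import numFieldNormedType.Exports.
Set Implicit Arguments.
Unset Strict Implicit.
Unset Printing Implicit Defensive.
Local Open Scope classical_set_scope.
Local Open Scope ring_scope.

(** * Germs of smooth functions *)

(* The library states the derivation rules for [f + g], [f * g], ... in the ring
   of functions, which unify badly with pointwise expressions. *)
Section PointwiseRules.
Context {R : realType} {V : normedModType R}.
Implicit Types (f g : V -> R) (x v : V).

Lemma is_derive_add f g x v df dg : is_derive x v f df -> is_derive x v g dg ->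
  is_derive x v (fun y => f y + g y) (df + dg).
Proof.
have -> : (fun y => f y + g y) = f + g by apply/funext.
exact: is_deriveD.
Qed.

Lemma is_derive_opp f x v df : is_derive x v f df ->
  is_derive x v (fun y => - f y) (- df).
Proof.
have -> : (fun y => - f y) = - f by apply/funext.
exact: is_deriveN.
Qed.

Lemma is_derive_sub f g x v df dg : is_derive x v f df -> is_derive x v g dg ->
  is_derive x v (fun y => f y - g y) (df - dg).
Proof. by move=> hf hg; apply: is_derive_add => //; exact: is_derive_opp. Qed.

Lemma is_derive_mul f g x v df dg : is_derive x v f df -> is_derive x v g dg ->
  is_derive x v (fun y => f y * g y) (df * g x + f x * dg).
Proof.
move=> hf hg; have -> : (fun y => f y * g y) = f * g by apply/funext.
have := @is_deriveM _ _ f g x v df dg hf hg.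
by rewrite -![_ *: _]/(_ * _) addrC [g x * _]mulrC.
Qed.

Lemma is_derive_inv f x v df : f x != 0 -> is_derive x v f df ->
  is_derive x v (fun y => (f y)^-1) (- (f x)^-1 ^+ 2 * df).
Proof.
move=> fx0 [hf <-].
split; first exact: (@derivableV _ _ f).
by rewrite (@deriveV _ _ f) // -exprVn.
Qed.

Lemma is_derive_big_sum (I : Type) (r : seq I) (P : pred I) (f : I -> V -> R)
    (df : I -> R) x v :
  (forall i, P i -> is_derive x v (f i) (df i)) ->
  is_derive x v (fun y => \sum_(i <- r | P i) f i y) (\sum_(i <- r | P i) df i).
Proof.
move=> hf; elim: r => [|a r IH].
  by under eq_fun do rewrite big_nil; rewrite big_nil; exact: is_derive_cst.
under eq_fun do rewrite big_cons; rewrite big_cons; case: ifPn => // Pa.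
by apply: is_derive_add => //; exact: hf.
Qed.

Lemma continuous_at_add (T : topologicalType) (f g : T -> R) (x : T) :
  {for x, continuous f} -> {for x, continuous g} ->
  {for x, continuous (fun y => f y + g y)}.
Proof. by move=> cf cg; apply: cvgD. Qed.

Lemma continuous_at_mul (T : topologicalType) (f g : T -> R) (x : T) :
  {for x, continuous f} -> {for x, continuous g} ->
  {for x, continuous (fun y => f y * g y)}.
Proof. by move=> cf cg; apply: cvgM. Qed.

Lemma continuous_at_inv (T : topologicalType) (f : T -> R) (x : T) :
  f x != 0 -> {for x, continuous f} -> {for x, continuous (fun y => (f y)^-1)}.
Proof. by move=> fx0 cf; apply: cvgV. Qed.

End PointwiseRules.

Section DirectionalDerivatives.
Context {R : realType}.

Lemma is_derive_line (V : normedModType R) (F : V -> R) (x v : V) (t : R) :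
  derivable F (x + t *: v) v ->
  is_derive t 1 (fun s : R => F (x + s *: v)) ('D_v F (x + t *: v)).
Proof.
move=> dF.
have E : (fun h : R => h^-1 *: (F (x + (h *: (1:R^o) + t) *: v) - F (x + t *: v))) =
         (fun h : R => h^-1 *: (F (h *: v + (x + t *: v)) - F (x + t *: v))).
  apply/funext => h; congr (_ *: (F _ - _)).
  by rewrite [h *: _]mulr1 scalerDl addrCA.
by split; rewrite /derivable /derive E.
Qed.

Lemma MVT01 (g dg : R -> R) :
  (forall t : R, 0 <= t <= 1 -> is_derive t 1 g (dg t)) ->
  exists2 c : R, 0 <= c <= 1 & g 1 - g 0 = dg c.
Proof.
move=> dgE.
have [||c c01 ->] := @MVT_segment R g dg 0 1 ler01.
- by move=> x; rewrite in_itv /= => /andP[x0 x1]; apply: dgE; rewrite !ltW.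
- apply: derivable_within_continuous => x; rewrite in_itv /= => x01.
  by have [] := dgE x x01.
by exists c; rewrite ?subr0 ?mulr1 //; move: c01; rewrite in_itv.
Qed.

Lemma MVT_line (V : normedModType R) (F : V -> R) (x v : V) :
  (forall t : R, 0 <= t <= 1 -> derivable F (x + t *: v) v) ->
  exists2 c : R, 0 <= c <= 1 & F (x + v) - F x = 'D_v F (x + c *: v).
Proof.
move=> dF.
have [t t01|c c01] := @MVT01 (fun s => F (x + s *: v)) (fun s => 'D_v F (x + s *: v)).
  exact/is_derive_line/dF.
by rewrite scale1r scale0r addr0 => ->; exists c.
Qed.

Lemma derive_scale (V : normedModType R) (F : V -> R) (x v : V) (k : R) :
  derivable F x v -> is_derive x (k *: v) F (k * 'D_v F x).
Proof.
move=> dF; pose g (s : R) := F (x + s *: v).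
have dg : is_derive (0 : R) 1 g ('D_v F x).
  by have := @is_derive_line _ F x v 0; rewrite scale0r addr0; exact.
have dh : is_derive (0 : R) 1 (fun s : R => g (s * k)) (k * 'D_v F x).
  have dk : is_derive (0 : R) 1 (fun s : R => s * k) k.
    have [d E] := is_derive_mul (is_derive_id (0 : R) (1 : R)) (is_derive_cst k (0 : R) (1 : R)).
    by split; [exact: d|etransitivity; [exact: E|rewrite mul1r mul0r addr0]].
  have [d1 E1] := dk.
  have d2 : derivable g (0 * k) 1 by rewrite mul0r; case: dg.
  split.
    apply/derivable1_diffP.
    apply: (@differentiable_comp _ _ _ _ (fun s : R => s * k) g); exact/derivable1_diffP.
  rewrite -derive1E (derive1_comp d1 d2) mul0r !derive1E E1 mulrC.
  by case: dg => _ ->.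
have E : (fun h : R => h^-1 *: (F (h *: (k *: v) + x) - F x)) =
   (fun h : R => h^-1 *: (g ((h *: (1:R^o) + 0) * k) - g (0 * k))).
  apply/funext => h; congr (_ *: (_ - _)).
    by rewrite /g scalerA addr0 addrC [h *: _]mulr1.
  by rewrite /g mul0r scale0r addr0.
case: dh => dh1 dh2; split; rewrite /derivable /derive E //.
Qed.

End DirectionalDerivatives.

Section Germs.
Context {R : realType}.

(* C^k on a neighbourhood of x; unlike Ck, only the germ of F matters. *)
Fixpoint Ck_at {n} (k : nat) (F : 'rV[R]_n -> R) (x : 'rV[R]_n) : Prop :=
  (\forall y \near x, {for y, continuous F}) /\
  if k is k'.+1 then
    forall i, (\forall y \near x, derivable F y (delta_mx 0 i)) /\
              Ck_at k' (pder i F) x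
  else True.

Definition smooth_at {n} (F : 'rV[R]_n -> R) x := forall k, Ck_at k F x.

Context {n : nat}.
Implicit Types (F G : 'rV[R]_n -> R) (x y : 'rV[R]_n).

Lemma Ck_at_cont k F x : Ck_at k F x -> \forall y \near x, {for y, continuous F}.
Proof. by case: k => [|k] []. Qed.

Lemma Ck_atW k F x : Ck_at k.+1 F x -> Ck_at k F x.
Proof.
elim: k F => [|k IH] F [cF dF]; split => // i; have [d1 d2] := dF i.
by split => //; apply: IH.
Qed.

Lemma Ck_at_near k F x : Ck_at k F x -> \forall y \near x, Ck_at k F y.
Proof.
elim: k F => [|k IH] F [cF dF].
  by near=> y; split => //; near: y; apply: (near_join cF).
have H i : \forall y \near x,
    (\forall z \near y, derivable F z (delta_mx 0 i)) /\ Ck_at k (pder i F) y.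
  have [d1 d2] := dF i; near=> y; split.
    by near: y; apply: (near_join d1).
  by near: y; apply: IH.
near=> y; split; first by near: y; apply: (near_join cF).
by near: y; apply: filter_forall.
Unshelve. all: by end_near. Qed.

Lemma near_pder F G x i : (\forall y \near x, F y = G y) ->
  \forall y \near x, pder i F y = pder i G y.
Proof.
move=> FG; near=> y; apply: near_eq_derive; near: y; exact: (near_join FG).
Unshelve. all: by end_near. Qed.

Lemma Ck_at_ext k F G x : (\forall y \near x, F y = G y) ->
  Ck_at k F x -> Ck_at k G x.
Proof.
have cext (F' G' : 'rV[R]_n -> R) (z : 'rV[R]_n) : (\forall y \near z, F' y = G' y) ->
    (\forall y \near z, {for y, continuous F'}) ->
    \forall y \near z, {for y, continuous G'}.
  move=> FG cF; near=> y.
  have FGy : \forall w \near y, F' w = G' w by near: y; exact: (near_join FG).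
  have cFy : {for y, continuous F'} by near: y.
  rewrite /prop_for /continuous_at -(nbhs_singleton FGy).
  exact: cvg_trans (near_eq_cvg FGy) cFy.
elim: k F G => [|k IH] F G FG [cF dF]; split; try exact: (cext F); move=> //.
move=> i; have [d1 d2] := dF i; split.
  near=> y; apply: (@near_eq_derivable _ _ _ F).
    by near: y; exact: (near_join FG).
  by near: y.
by apply: IH d2; apply: near_pder.
Unshelve. all: by end_near. Qed.

Lemma smooth_at_ext F G x : (\forall y \near x, F y = G y) ->
  smooth_at F x -> smooth_at G x.
Proof. by move=> FG sF k; apply: Ck_at_ext (sF k). Qed.

Lemma smooth_on_at (U : set 'rV[R]_n) F x : open U -> U x ->
  smooth_on U F -> smooth_at F x.
Proof.
move=> oU Ux sF k; have nU : \forall y \near x, U y by exact: open_nbhs_nbhs.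
have c0 : \forall y \near x, {for y, continuous F}.
  near=> y; apply: (sF 0%N); apply/mem_set; by near: y.
move: F sF c0; elim: k => [|k IH] F sF c0; split => // i.
split; first by near=> y; apply: (sF 1%N i).1; near: y.
have sdF : smooth_on U (pder i F) by move=> j; apply: (sF j.+1 i).2.
apply: IH => //; near=> y; apply: (sdF 0%N); apply/mem_set; by near: y.
Unshelve. all: by end_near. Qed.

End Germs.

Section Differentiability.
Context {R : realType} {n : nat}.
Implicit Types (F G : 'rV[R]_n -> R) (x y : 'rV[R]_n).

Lemma coord_le_norm (v : 'rV[R]_n) i : `|v 0 i| <= `|v|.
Proof.
rewrite [leRHS]/Num.Def.normr/= mx_normrE.
exact: (le_bigmax _ (fun ij : 'I_1 * 'I_n => `|v ij.1 ij.2|) (0, i)).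
Qed.

Lemma norm_le_coord (v : 'rV[R]_n) (e : R) : 0 <= e ->
  (forall i, `|v 0 i| <= e) -> `|v| <= e.
Proof.
move=> e0 ve; rewrite /Num.Def.normr/= mx_normrE (bigmax_le _ e0)//= => -[i j] _.
by rewrite (ord1 i); apply: ve.
Qed.

Definition trunc_row (v : 'rV[R]_n) (k : nat) : 'rV[R]_n :=
  \row_i (if (i < k)%N then v 0 i else 0).

Lemma trunc_rowS v (i : 'I_n) : trunc_row v i.+1 = trunc_row v i + v 0 i *: delta_mx 0 i.
Proof.
apply/rowP => j; rewrite !mxE eqxx /= ltnS leq_eqVlt.
have [->|ji] := eqVneq j i; first by rewrite eqxx ltnn mulr1 add0r.
by rewrite -val_eqE in ji; rewrite (negbTE ji) mulr0 addr0.
Qed.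

Lemma norm_trunc_row (v : 'rV[R]_n) (i : 'I_n) (c : R) : 0 <= c <= 1 ->
  `|trunc_row v i + c *: (v 0 i *: delta_mx 0 i)| <= `|v|.
Proof.
move=> /andP[c0 c1]; apply: norm_le_coord => // j; rewrite !mxE eqxx /=.
have [->|ji] := eqVneq j i.
  rewrite ltnn add0r mulr1 normrM (ger0_norm c0).
  by rewrite (le_trans _ (coord_le_norm v i)) // ler_piMl.
rewrite !mulr0 addr0; case: ifP => _; first exact: coord_le_norm.
by rewrite normr0.
Qed.

(* The increment of F is split into increments along the axes, to each of which
   the mean value theorem applies. *)
Lemma C1_differentiable F x :
  (forall i, \forall y \near x, derivable F y (delta_mx 0 i)) ->
  (forall i, {for x, continuous (pder i F)}) -> differentiable F x.
Proof.
move=> dF cF; pose L (h : 'rV[R]_n) : R := \sum_i h 0 i * pder i F x.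
have linL : linear L.
  move=> a u v; rewrite /L scaler_sumr -big_split /=; apply: eq_bigr => i _.
  by rewrite !mxE mulrDl -mulrA.
pose LM := GRing.isLinear.Build _ _ _ _ _ linL.
pose LL : {linear _ -> _} := HB.pack L LM.
have cL : continuous LL.
  have -> : (LL : _ -> _) = \sum_(i < n) ((fun h : 'rV[R]_n => h 0 i) \* cst (pder i F x)).
    by apply/funext => h; rewrite fct_sumE.
  move=> h; elim/big_ind: _ => [|f g cf cg|i _].
  - exact: cst_continuous.
  - exact: continuousD.
  - by apply: continuousM; [exact: coord_continuous|exact: cst_continuous].
suff H : (F \o shift x : 'rV[R]_n -> R^o) =
    cst (F x : R^o) + (LL : 'rV[R]_n -> R^o) +o_ (0 : 'rV[R]_n) id.
  by apply/diff_locallyP; rewrite (diff_unique cL H).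
apply/eqaddoP => _/posnumP[e].
pose d := e%:num / n.+1%:R.
have d0 : 0 < d by rewrite divr_gt0.
have H i : \forall y \near x,
    derivable F y (delta_mx 0 i) /\ `|pder i F x - pder i F y| <= d.
  near=> y; split; first by near: y; exact: dF.
  by near: y; move/cvgrPdist_le: (cF i); apply.
have /nbhs_ballP[r r0 rP] := @filter_forall _ _ _ _ (nbhs_filter x) H.
near=> h; have hr : `|h| < r.
  near: h; exact: (@nbhs0_lt R ('rV[R]_n : normedModType R) r r0).
have inball z : `|z| <= `|h| -> ball x r (x + z).
  by move=> zh; rewrite -ball_normE /ball_ /= opprD addrA subrr add0r normrN (le_lt_trans zh).
have key k : (k <= n)%N -> `|F (x + trunc_row h k) - F x
    - \sum_(i < n | (i < k)%N) h 0 i * pder i F x| <= k%:R * d * `|h|.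
  elim: k => [_|k IH kn].
    rewrite big_pred0 // (_ : trunc_row h 0 = 0); last by apply/rowP => i; rewrite !mxE.
    by rewrite addr0 !subrr normr0 !mul0r.
  have {IH} := IH (ltnW kn); pose i := Ordinal kn.
  have [|c c01 dE] := @MVT_line R _ F (x + trunc_row h k) (h 0 i *: delta_mx 0 i).
    move=> t t01; have dFt : derivable F
        (x + trunc_row h k + t *: (h 0 i *: delta_mx 0 i)) (delta_mx 0 i).
      rewrite -addrA; apply: (rP _ _ i).1; apply: inball; exact: (norm_trunc_row h i).
    by case: (derive_scale (h 0 i) dFt).
  set y := _ + c *: _ in dE.
  have yb : ball x r y by rewrite /y -addrA; apply: inball; exact: (norm_trunc_row h i).
  have [dy py] := rP _ yb i.
  have [_ pE] := derive_scale (h 0 i) dy; rewrite pE -/(pder i F y) in dE.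
  rewrite -addrA -(trunc_rowS h i) /= in dE.
  move=> IH.
  rewrite [X in _ - X](_ : _ = (\sum_(j < n | (j < k)%N) h 0 j * pder j F x) + h 0 i * pder i F x); last first.
    rewrite (bigD1 i) //= addrC; congr (_ + _); apply: eq_bigl => j.
    by rewrite ltnS ltn_neqAle andbC -val_eqE.
  rewrite (_ : _ - _ = (F (x + trunc_row h k) - F x -
     \sum_(j < n | (j < k)%N) h 0 j * pder j F x) - h 0 i * (pder i F x - pder i F y)); last first.
    rewrite mulrBr -dE; ring.
  rewrite (le_trans (ler_normB _ _)) // -natr1 !mulrDl mul1r lerD //.
  by rewrite normrM [leRHS]mulrC ler_pM ?coord_le_norm.
have := key n (leqnn n).
rewrite (_ : trunc_row h n = h); last by apply/rowP => i; rewrite mxE ltn_ord.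
rewrite (eq_bigl predT) /=; last by move=> i; exact: ltn_ord.
have -> : (F \o shift x - (cst (F x) + LL)) h = F (x + h) - F x - L h.
  by rewrite !fctE /= opprD addrA [h + x]addrC.
move/le_trans; apply.  rewrite ler_wpM2r //. 
rewrite /d mulrCA -[leRHS]mulr1 ler_pM2l // ler_pdivrMr // mul1r ler_nat.
exact: leqnSn.
Unshelve. all: by end_near. Qed.

End Differentiability.

Section SmoothAlgebra.
Context {R : realType} {n : nat}.
Implicit Types (F G : 'rV[R]_n -> R) (x y : 'rV[R]_n).

Lemma Ck_at_differentiable k F x : Ck_at k.+1 F x -> differentiable F x.
Proof.
case=> _ dF; apply: C1_differentiable => i; first exact: (dF i).1.
by have [_ /Ck_at_cont/nbhs_singleton] := dF i.
Qed.

Lemma Ck_at_near_differentiable k F x :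
  Ck_at k.+1 F x -> \forall y \near x, differentiable F y.
Proof.
by move=> /Ck_at_near; apply: filterS => y; exact: Ck_at_differentiable.
Qed.

Lemma smooth_differentiable F x : smooth_at F x -> differentiable F x.
Proof. by move=> /(_ 1%N); exact: Ck_at_differentiable. Qed.

Lemma smooth_near_differentiable F x :
  smooth_at F x -> \forall y \near x, differentiable F y.
Proof. by move=> /(_ 1%N); exact: Ck_at_near_differentiable. Qed.

Lemma smooth_derivable F x v : smooth_at F x -> derivable F x v.
Proof. by move=> /smooth_differentiable; exact: diff_derivable. Qed.

Lemma deriveE_pder F x v : differentiable F x ->
  'D_v F x = \sum_i v 0 i * pder i F x.
Proof.
move=> dF; rewrite deriveE // {1}(row_sum_delta v) linear_sum /=.
by apply: eq_bigr => i _; rewrite linearZ /= /pder deriveE.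
Qed.

Lemma is_derive_pder F x i : derivable F x (delta_mx 0 i) ->
  is_derive x (delta_mx 0 i) F (pder i F x).
Proof. exact: derivableP. Qed.

Lemma Ck_at_pder k i F x : Ck_at k.+1 F x -> Ck_at k (pder i F) x.
Proof. by case=> _ /(_ i)[]. Qed.

Lemma Ck_at_cst k (a : R) x : Ck_at k (fun=> a) x.
Proof.
have c (b : R) : \forall y \near x, {for y, continuous (fun=> b : R)}.
  by near=> y; exact: cst_continuous.
elim: k a => [|k IH] a; split => // i; split.
  by near=> y; exact: derivable_cst.
rewrite (_ : pder i _ = fun=> 0) //.
by apply/funext => y; rewrite /pder derive_cst.
Unshelve. all: by end_near.
Qed.

Lemma Ck_at_coord k j x : Ck_at k (fun y : 'rV[R]_n => y 0 j) x.
Proof.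
have dc y : differentiable (fun z : 'rV[R]_n => z 0 j : R) y by exact: differentiable_coord.
have c : \forall y \near x, {for y, continuous (fun z : 'rV[R]_n => z 0 j)}.
  by near=> y; apply: differentiable_continuous.
case: k => [|k]; split => // i; split.
  by near=> y; exact: diff_derivable.
rewrite (_ : pder i _ = fun=> (j == i)%:R); first exact: Ck_at_cst.
apply/funext => y; rewrite /pder deriveE //.
have lin : linear (fun z : 'rV[R]_n => z 0 j : R).
  by move=> a u v; rewrite !mxE.
pose LM := GRing.isLinear.Build _ _ _ _ _ lin.
pose LL : {linear _ -> _} := HB.pack (fun z : 'rV[R]_n => z 0 j : R) LM.
have -> : (fun z : 'rV[R]_n => z 0 j : R) = LL by [].
by rewrite diff_lin /= ?mxE ?eqxx //; exact: coord_continuous.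
Unshelve. all: by end_near.
Qed.

Lemma Ck_atD k F G x : Ck_at k F x -> Ck_at k G x -> Ck_at k (fun y => F y + G y) x.
Proof.
elim: k F G => [|k IH] F G [cF dF] [cG dG].
  by split=> //; near=> y; apply: continuous_at_add; near: y.
split; first by near=> y; apply: continuous_at_add; near: y.
move=> i; have [dF1 dF2] := dF i; have [dG1 dG2] := dG i.
have H : \forall y \near x, is_derive y (delta_mx 0 i) (fun y => F y + G y)
    (pder i F y + pder i G y).
  by apply: filterS2 dF1 dG1 => y HF HG; apply: is_derive_add; exact: is_derive_pder.
split; first by apply: filterS H => y [].
by apply: Ck_at_ext (IH _ _ dF2 dG2); apply: filterS H => y [].
Unshelve. all: by end_near. Qed.

Lemma Ck_atM k F G x : Ck_at k F x -> Ck_at k G x -> Ck_at k (fun y => F y * G y) x.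
Proof.
elim: k F G => [|k IH] F G sF sG; have [[cF dF] [cG dG]] := (sF, sG).
  by split=> //; near=> y; apply: continuous_at_mul; near: y.
split; first by near=> y; apply: continuous_at_mul; near: y.
move=> i; have [dF1 dF2] := dF i; have [dG1 dG2] := dG i.
have H : \forall y \near x, is_derive y (delta_mx 0 i) (fun y => F y * G y)
    (pder i F y * G y + F y * pder i G y).
  by apply: filterS2 dF1 dG1 => y HF HG; apply: is_derive_mul; exact: is_derive_pder.
split; first by apply: filterS H => y [].
apply: (@Ck_at_ext _ _ _ (fun y => pder i F y * G y + F y * pder i G y)).
  by apply: filterS H => y [].
by apply: Ck_atD; apply: IH => //; apply: Ck_atW.
Unshelve. all: by end_near. Qed.

Lemma Ck_at_sum k (I : Type) (r : seq I) (P : pred I) (F : I -> 'rV[R]_n -> R) x :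
  (forall i, P i -> Ck_at k (F i) x) ->
  Ck_at k (fun y => \sum_(i <- r | P i) F i y) x.
Proof.
move=> sF; elim: r => [|a r IH].
  by under eq_fun do rewrite big_nil; exact: Ck_at_cst.
under eq_fun do rewrite big_cons; case: (boolP (P a)) => Pa //.
by apply: Ck_atD => //; exact: sF.
Qed.

Lemma Ck_at_prod k (I : Type) (r : seq I) (P : pred I) (F : I -> 'rV[R]_n -> R) x :
  (forall i, P i -> Ck_at k (F i) x) ->
  Ck_at k (fun y => \prod_(i <- r | P i) F i y) x.
Proof.
move=> sF; elim: r => [|a r IH].
  by under eq_fun do rewrite big_nil; exact: Ck_at_cst.
under eq_fun do rewrite big_cons; case: (boolP (P a)) => Pa //.
by apply: Ck_atM => //; exact: sF.
Qed.

Lemma Ck_atV k F x : F x != 0 -> Ck_at k F x -> Ck_at k (fun y => (F y)^-1) x.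
Proof.
move=> Fx0 sF0.
have c (G : 'rV[R]_n -> R) : G x != 0 -> (\forall y \near x, {for y, continuous G}) ->
    \forall y \near x, G y != 0 /\ {for y, continuous (fun z => (G z)^-1)}.
  move=> Gx0 cG.
  have n0 : \forall y \near x, G y != 0.
    have /(_ [set y : R | y != 0]) := nbhs_singleton cG; apply.
    by apply: open_nbhs_nbhs; split => //; exact: open_neq.
  near=> y; have Gy0 : G y != 0 by near: y.
  by split => //; apply: continuous_at_inv => //; near: y.
elim: k F Fx0 sF0 => [|k IH] F Fx0 sF.
  by split => //; apply: filterS (c _ Fx0 (Ck_at_cont sF)) => y [].
have [cF dF] := sF; have cV := c _ Fx0 cF; split; first by apply: filterS cV => y [].
move=> i; have [dF1 dF2] := dF i.
have H : \forall y \near x, is_derive y (delta_mx 0 i) (fun y => (F y)^-1)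
    (- (F y)^-1 ^+ 2 * pder i F y).
  near=> y; have HF : derivable F y (delta_mx 0 i) by near: y; exact: dF1.
  have Fy0 : F y != 0 by near: y; apply: filterS cV => y [].
  by apply: is_derive_inv => //; exact: is_derive_pder.
split; first by apply: filterS H => y [].
apply: (@Ck_at_ext _ _ _ (fun y => (-1) * ((F y)^-1 * (F y)^-1) * pder i F y)).
  by apply: filterS H => y [_] ; rewrite mulN1r expr2.
apply: Ck_atM => //; apply: Ck_atM; first exact: Ck_at_cst.
by apply: Ck_atM; apply: IH => //; apply: Ck_atW.
Unshelve. all: by end_near. Qed.

End SmoothAlgebra.

Section Composition.
Context {R : realType}.

Lemma is_derive_comp (V U W : normedModType R) (f : V -> U) (F : U -> W) (x v : V) :
  derivable f x v -> differentiable F (f x) ->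
  is_derive x v (F \o f) ('D_('D_v f x) F (f x)).
Proof.
move=> df dF; pose a (h : R) := f (h *: v + x).
have a0 : a 0 = f x by rewrite /a scale0r add0r.
have da : differentiable a 0 by apply/derivable1_diffP; exact: (derivable1P f x v).1.
have dFa : differentiable F (a 0) by rewrite a0.
have E (X : normedModType R) (g : V -> X) : 'D_v g x = 'D_1 (fun h : R => g (h *: v + x)) 0.
  rewrite /derive; set g1 := fun _ => _; set g2 := fun _ => _.
  suff -> : g1 = g2 by [].
  by rewrite funeqE /g1 /g2 => h /=; rewrite addr0 scale0r add0r [_%:A]mulr1.
have Ea : 'D_v f x = 'D_1 a 0 by exact: E.
have EFa : 'D_v (F \o f) x = 'D_1 (F \o a) 0 by exact: E.
split.
  by apply/(derivable1P (F \o f) x v)/derivable1_diffP; exact: (differentiable_comp da dFa).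
rewrite EFa deriveE; last exact: differentiable_comp.
by rewrite diff_comp //= Ea deriveE // a0 deriveE.
Qed.

Lemma cvg_coord (T : Type) (F : set_system T) (FF : Filter F) m
    (f : T -> 'rV[R]_m) (l : 'rV[R]_m) :
  (forall j, f t 0 j @[t --> F] --> l 0 j) -> f @ F --> l.
Proof.
move=> fl; apply/cvgrPdist_le => e e0.
have H j : \forall t \near F, `|l 0 j - f t 0 j| <= e.
  by move/cvgrPdist_le: (fl j); apply.
have := @filter_forall _ _ _ _ FF H; apply: filterS => t tP.
by apply: norm_le_coord => [|j]; [exact: ltW|rewrite !mxE; exact: tP].
Qed.

Lemma derivable_coord (V : normedModType R) m (f : V -> 'rV[R]_m) x v :
  (forall j, derivable (fun y => f y 0 j) x v) -> derivable f x v.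
Proof. by move=> df; apply/derivable_mxP => i j; rewrite (ord1 i). Qed.

Lemma derive_coord (V : normedModType R) m (f : V -> 'rV[R]_m) x v j :
  derivable f x v -> ('D_v f x) 0 j = 'D_v (fun y => f y 0 j) x.
Proof. by move=> df; rewrite derive_mx // mxE. Qed.

Context {m n : nat}.

Lemma Ck_at_comp k (f : 'rV[R]_m -> 'rV[R]_n) (F : 'rV[R]_n -> R) x :
  (forall j, Ck_at k (fun y => f y 0 j) x) -> Ck_at k F (f x) ->
  Ck_at k (F \o f) x.
Proof.
have cf k' (y : 'rV[R]_m) : (forall j, Ck_at k' (fun y => f y 0 j) y) -> {for y, continuous f}.
  move=> fC; apply: (@cvg_coord _ _ (nbhs_filter y)) => j.
  by have /nbhs_singleton := Ck_at_cont (fC j).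
have nf k' : (forall j, Ck_at k' (fun y => f y 0 j) x) ->
    \forall y \near x, forall j, Ck_at k' (fun y => f y 0 j) y.
  move=> fC; have H j := Ck_at_near (fC j).
  exact: (@filter_forall _ _ _ _ (nbhs_filter x) H).
have c0 k' (G : 'rV[R]_n -> R) : (forall j, Ck_at k' (fun y => f y 0 j) x) -> Ck_at k' G (f x) ->
    \forall y \near x, {for y, continuous (G \o f)}.
  move=> fC /Ck_at_cont cG; have nfy := nf _ fC.
  have nG : \forall y \near x, {for f y, continuous G} by exact: (cf _ _ fC _ cG).
  near=> y; apply: continuous_comp; last by near: y.
  by apply: (cf k'); near: y.
elim: k F => [|k IH] F fC FC; first by split=> //; exact: c0 FC.
have fC' j := Ck_atW (fC j).
split; first exact: c0 FC.
have nfy := nf _ fC.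
have dF : \forall y \near x, differentiable F (f y).
  exact: (cf _ _ fC _ (Ck_at_near_differentiable FC)).
have df y i : (forall j, Ck_at k.+1 (fun y => f y 0 j) y) -> derivable f y (delta_mx 0 i).
  move=> fCy; apply: derivable_coord => j.
  exact/diff_derivable/Ck_at_differentiable/fCy.
move=> i; split.
  near=> y; have dFy : differentiable F (f y) by near: y.
  have fCy : forall j, Ck_at k.+1 (fun y => f y 0 j) y by near: y.
  by case: (is_derive_comp (df _ i fCy) dFy).
apply: (@Ck_at_ext _ _ _ (fun y => \sum_j pder i (fun z => f z 0 j) y * pder j F (f y))).
  near=> y; have dFy : differentiable F (f y) by near: y.
  have fCy : forall j, Ck_at k.+1 (fun y => f y 0 j) y by near: y.
  rewrite /pder; case: (is_derive_comp (df _ i fCy) dFy) => _ ->.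
  rewrite deriveE_pder //; apply: eq_bigr => j _.
  by rewrite derive_coord //; exact: df.
apply: Ck_at_sum => j _; apply: Ck_atM; first exact: Ck_at_pder.
by apply: (IH (pder j F)) => //; exact: Ck_at_pder.
Unshelve. all: by end_near. Qed.

End Composition.

Section SmoothMaps.
Context {R : realType}.

Lemma smooth_at_comp m n (f : 'rV[R]_m -> 'rV[R]_n) (F : 'rV[R]_n -> R) x :
  (forall j, smooth_at (fun y => f y 0 j) x) -> smooth_at F (f x) ->
  smooth_at (fun y => F (f y)) x.
Proof. by move=> sf sF k; apply: (@Ck_at_comp _ _ _ k f F) => [j|]; [exact: sf|exact: sF]. Qed.


Context {n : nat}.
Implicit Types (F G : 'rV[R]_n -> R) (x y u v : 'rV[R]_n).

Lemma smooth_at_cst (a : R) x : smooth_at (fun=> a) x.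
Proof. by move=> k; exact: Ck_at_cst. Qed.

Lemma smooth_at_coord j x : smooth_at (fun y : 'rV[R]_n => y 0 j) x.
Proof. by move=> k; exact: Ck_at_coord. Qed.

Lemma smooth_at_add F G x : smooth_at F x -> smooth_at G x ->
  smooth_at (fun y => F y + G y) x.
Proof. by move=> sF sG k; apply: Ck_atD; [exact: sF|exact: sG]. Qed.

Lemma smooth_at_mul F G x : smooth_at F x -> smooth_at G x ->
  smooth_at (fun y => F y * G y) x.
Proof. by move=> sF sG k; apply: Ck_atM; [exact: sF|exact: sG]. Qed.

Lemma smooth_at_opp F x : smooth_at F x -> smooth_at (fun y => - F y) x.
Proof.
move=> sF; under eq_fun do rewrite -mulN1r.
by apply: smooth_at_mul => //; exact: smooth_at_cst.
Qed.

Lemma smooth_at_sub F G x : smooth_at F x -> smooth_at G x ->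
  smooth_at (fun y => F y - G y) x.
Proof. by move=> sF sG; apply: smooth_at_add => //; exact: smooth_at_opp. Qed.

Lemma smooth_at_inv F x : F x != 0 -> smooth_at F x ->
  smooth_at (fun y => (F y)^-1) x.
Proof. by move=> Fx0 sF k; apply: Ck_atV => //; exact: sF. Qed.

Lemma smooth_at_sum (I : Type) (r : seq I) (P : pred I) (F : I -> 'rV[R]_n -> R) x :
  (forall i, P i -> smooth_at (F i) x) ->
  smooth_at (fun y => \sum_(i <- r | P i) F i y) x.
Proof. by move=> sF k; apply: Ck_at_sum => i Pi; exact: sF. Qed.

Lemma smooth_at_prod (I : Type) (r : seq I) (P : pred I) (F : I -> 'rV[R]_n -> R) x :
  (forall i, P i -> smooth_at (F i) x) ->
  smooth_at (fun y => \prod_(i <- r | P i) F i y) x.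
Proof. by move=> sF k; apply: Ck_at_prod => i Pi; exact: sF. Qed.

Lemma smooth_at_pder i F x : smooth_at F x -> smooth_at (pder i F) x.
Proof. by move=> sF k; apply: Ck_at_pder; exact: sF. Qed.

Lemma smooth_at_derive F x v : smooth_at F x -> smooth_at ('D_v F) x.
Proof.
move=> sF; apply: (@smooth_at_ext _ _ (fun y => \sum_i v 0 i * pder i F y)).
  apply: filterS (smooth_near_differentiable sF) => y dF.
  by rewrite deriveE_pder.
apply: smooth_at_sum => i _; apply: smooth_at_mul; first exact: smooth_at_cst.
exact: smooth_at_pder.
Qed.

Lemma smooth_continuous F x : smooth_at F x -> {for x, continuous F}.
Proof. by move=> /smooth_differentiable; exact: differentiable_continuous. Qed.

Lemma is_derive_translate (V : normedModType R) (F : V -> R) (x v w : V) :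
  derivable F (x + w) v -> is_derive x v (fun z => F (z + w)) ('D_v F (x + w)).
Proof.
move=> dF.
have E : (fun h : R => h^-1 *: (F (h *: v + x + w) - F (x + w))) =
         (fun h : R => h^-1 *: (F (h *: v + (x + w)) - F (x + w))).
  by apply/funext => h; rewrite addrA.
by split; rewrite /derivable /derive E.
Qed.

Lemma second_difference F x u v : smooth_at F x ->
  forall e : R, 0 < e -> \forall s \near (0 : R)^'+,
   `|F (x + s *: u + s *: v) - F (x + s *: u) - F (x + s *: v) + F x
     - s ^+ 2 * 'D_v ('D_u F) x| <= e * s ^+ 2.
Proof.
move=> sF e e0; pose K := `|u| + `|v| + 1.
have sdF : smooth_at ('D_u F) x by exact: smooth_at_derive.
have K0 : 0 < K by rewrite ltr_wpDl // addr_ge0.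
have c : {for x, continuous ('D_v ('D_u F))}.
  exact/smooth_continuous/smooth_at_derive.
have nP : \forall y \near x, [/\ differentiable F y, differentiable ('D_u F) y
   & `|'D_v ('D_u F) x - 'D_v ('D_u F) y| <= e].
  near=> y; split; near: y.
  - exact: smooth_near_differentiable.
  - exact: smooth_near_differentiable.
  - by move/cvgrPdist_le: c; apply.
have /nbhs_ballP[r r0 rP] := nP.
near=> s.
have s0 : 0 < s by [].
have sr : s * K < r.
  by rewrite -ltr_pdivlMr //; near: s; apply: nbhs_right_lt; exact: divr_gt0.
have inball (a b : R) : 0 <= a <= 1 -> 0 <= b <= 1 ->
    ball x r (x + a *: (s *: u) + b *: (s *: v)).
  move=> /andP[a0 a1] /andP[b0 b1].
  rewrite -ball_normE /ball_ /= -addrA opprD addrA subrr add0r normrN.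
  apply: le_lt_trans sr; rewrite (le_trans (ler_normD _ _)) // !normrZ.
  rewrite !(ger0_norm (ltW s0), ger0_norm a0, ger0_norm b0).
  rewrite /K !mulrDr mulr1 -[leLHS]addr0; apply: lerD; last exact: ltW.
  by apply: lerD; rewrite ler_piMl // mulr_ge0 // ltW.
have i01 : 0 <= (0 : R) <= 1 by rewrite lexx ler01.
have i11 : 0 <= (1 : R) <= 1 by rewrite lexx ler01.
pose G y := F (y + s *: v) - F y.
have dG (a : R) : 0 <= a <= 1 -> is_derive (x + a *: (s *: u)) (s *: u) G
    (s * ('D_u F (x + a *: (s *: u) + s *: v) - 'D_u F (x + a *: (s *: u)))).
  move=> ha.
  have [D1 _ _] := rP _ (inball _ _ ha i11); rewrite scale1r in D1.
  have [D0 _ _] := rP _ (inball _ _ ha i01); rewrite scale0r addr0 in D0.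
  have [S1 E1] := derive_scale s (@diff_derivable _ _ _ _ _ u D1).
  have [S0 E0] := derive_scale s (@diff_derivable _ _ _ _ _ u D0).
  rewrite mulrBr -E1 -E0.
  exact: (is_derive_sub (is_derive_translate S1) (derivableP S0)).
have [a a01] : exists2 a : R, 0 <= a <= 1 &
    G (x + s *: u) - G x = 'D_(s *: u) G (x + a *: (s *: u)).
  by apply: MVT_line => t t01; case: (dG t t01).
have [_ ->] := dG a a01.
have dDu (b : R) : 0 <= b <= 1 ->
    is_derive (x + a *: (s *: u) + b *: (s *: v)) (s *: v) ('D_u F)
    (s * 'D_v ('D_u F) (x + a *: (s *: u) + b *: (s *: v))).
  move=> hb; have [_ D1 _] := rP _ (inball _ _ a01 hb).
  exact: derive_scale (@diff_derivable _ _ _ _ _ v D1).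
have dDu' (t : R) : 0 <= t <= 1 ->
    derivable ('D_u F) (x + a *: (s *: u) + t *: (s *: v)) (s *: v).
  by move=> t01; case: (dDu t t01).
have [b b01 ->] := @MVT_line R _ ('D_u F) _ _ dDu'.
have [_ ->] := dDu b b01.
have [_ _ eP] := rP _ (inball _ _ a01 b01).
rewrite /G; set D0 := 'D_v _ x in eP *; set D1 := 'D_v _ _ in eP *.
set A := F _; set B := F _; set C := F _ => GE.
have {GE}GE : A - B - C + F x = s ^+ 2 * D1 by rewrite expr2 -mulrA -GE; ring.
rewrite GE -mulrBr -opprB mulrN.
rewrite normrN normrM ger0_norm ?sqr_ge0 // mulrC ler_wpM2r ?sqr_ge0 //.
Unshelve. all: by end_near. Qed.

(* Both mixed derivatives are limits of the same second difference. *)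
Lemma derive_schwarz F x u v : smooth_at F x ->
  'D_v ('D_u F) x = 'D_u ('D_v F) x.
Proof.
move=> sF; apply/eqP; rewrite -subr_eq0 -normr_le0; apply/ler_addgt0Pl => e e0.
rewrite addr0; have e20 : 0 < e / 2 by rewrite divr_gt0.
have N1 := @second_difference F x u v sF _ e20.
have N2 := @second_difference F x v u sF _ e20.
have N0 := @nbhs_right_gt R 0.
have [s [s0 [H1 H2]]] := filter_ex (filterI N0 (filterI N1 N2)).
have s20 : 0 < s ^+ 2 by rewrite exprn_gt0.
rewrite -(ler_pM2l s20) -[s ^+ 2 in leLHS]gtr0_norm // -normrM.
rewrite (_ : s ^+ 2 * (_ - _) = (F (x + s *: v + s *: u) - F (x + s *: v)
   - F (x + s *: u) + F x - s ^+ 2 * 'D_u ('D_v F) x) -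
   (F (x + s *: u + s *: v) - F (x + s *: u) - F (x + s *: v) + F x
     - s ^+ 2 * 'D_v ('D_u F) x)); last first.
  rewrite [x + _ + s *: u]addrAC.
  move: (F _) (F _) (F _) (F _) ('D_v _ x) ('D_u _ x) => a b c d p q; ring.
apply: le_trans (ler_normB _ _) _; apply: le_trans (lerD H2 H1) _.
by rewrite -mulrDl -splitr mulrC.
Unshelve. all: by end_near. Qed.

End SmoothMaps.

Section BilinearForms.
Context {R : realType} {n : nat}.
Implicit Types (A : 'M[R]_n) (u v w : 'rV[R]_n).

Definition bf A u v : R := (u *m A *m v^T) 0 0.

Lemma bfE A u v : bf A u v = \sum_i \sum_j A i j * u 0 i * v 0 j.
Proof.
rewrite /bf mxE exchange_big; apply: eq_bigr => j _.
rewrite !mxE mulr_suml; apply: eq_bigr => i _.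
by rewrite [u 0 i * _]mulrC.
Qed.

Lemma bfDl A u v w : bf A (u + v) w = bf A u w + bf A v w.
Proof. by rewrite /bf !mulmxDl mxE. Qed.

Lemma bfDr A u v w : bf A u (v + w) = bf A u v + bf A u w.
Proof. by rewrite /bf linearD mulmxDr mxE. Qed.

Lemma bfZl A a u v : bf A (a *: u) v = a * bf A u v.
Proof. by rewrite /bf -!scalemxAl mxE. Qed.

Lemma bfZr A a u v : bf A u (a *: v) = a * bf A u v.
Proof. by rewrite /bf linearZ -scalemxAr mxE. Qed.

Lemma bfNl A u v : bf A (- u) v = - bf A u v.
Proof. by rewrite -scaleN1r bfZl mulN1r. Qed.

Lemma bfNr A u v : bf A u (- v) = - bf A u v.
Proof. by rewrite -scaleN1r bfZr mulN1r. Qed.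

Lemma bf0l A v : bf A 0 v = 0.
Proof. by rewrite /bf !mul0mx mxE. Qed.

Lemma bf0r A v : bf A v 0 = 0.
Proof. by rewrite /bf trmx0 mulmx0 mxE. Qed.

Lemma bfC A u v : A^T = A -> bf A u v = bf A v u.
Proof.
move=> sA; rewrite /bf; set B := u *m _ *m _.
by rewrite -[B]trmxK mxE !trmx_mul trmxK sA mulmxA.
Qed.

Lemma bf_inj A u v : A \in unitmx -> (forall w, bf A u w = bf A v w) -> u = v.
Proof.
move=> uA E; rewrite -[u](mulmxK uA) -[v](mulmxK uA); congr (_ *m _).
apply/rowP => j; have := E (delta_mx 0 j).
by rewrite /bf trmx_delta -!colE !mxE.
Qed.

Lemma posdef_unit A : (forall v, v != 0 -> 0 < bf A v v) -> A \in unitmx.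
Proof.
move=> pA; rewrite -row_free_unit -kermx_eq0; apply/eqP/row_matrixP => i.
rewrite row0; apply/eqP/negPn/negP => /pA.
by rewrite /bf -row_mul mulmx_ker row0 mul0mx mxE ltxx.
Qed.

Lemma cauchy_schwarz A u v : A^T = A -> (forall w, w != 0 -> 0 < bf A w w) ->
  bf A u v ^+ 2 <= bf A u u * bf A v v.
Proof.
move=> sA pA; have [->|v0] := eqVneq v 0; first by rewrite !bf0r expr0n mulr0.
have vv := pA v v0; have pA' w : 0 <= bf A w w.
  by have [->|/pA/ltW//] := eqVneq w 0; rewrite bf0l.
have := pA' (bf A v v *: u - bf A u v *: v).
rewrite !(bfDl, bfDr, bfNl, bfNr, bfZl, bfZr) (bfC v u sA).
set a := bf A u u; set b := bf A u v; set c := bf A v v in vv *.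
rewrite (_ : _ + _ = c * (a * c - b ^+ 2)); last by ring.
by rewrite pmulr_rge0 // subr_ge0.
Qed.

End BilinearForms.

Section SmoothVectors.
Context {R : realType}.

Definition vsmooth {m n} (f : 'rV[R]_m -> 'rV[R]_n) (x : 'rV[R]_m) :=
  forall j, smooth_at (fun y => f y 0 j) x.

Definition msmooth {m p q} (A : 'rV[R]_m -> 'M[R]_(p, q)) (x : 'rV[R]_m) :=
  forall i j, smooth_at (fun y => A y i j) x.

Lemma msmooth_derivable m p q (A : 'rV[R]_m -> 'M[R]_(p, q)) x v :
  msmooth A x -> derivable A x v.
Proof.
move=> sA; apply/derivable_mxP => i j; exact: smooth_derivable.
Qed.

Lemma msmooth_derive m p q (A : 'rV[R]_m -> 'M[R]_(p, q)) x v i j :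
  msmooth A x -> ('D_v A x) i j = 'D_v (fun y => A y i j) x.
Proof. by move=> sA; rewrite derive_mx ?mxE //; exact: msmooth_derivable. Qed.

Lemma vsmooth_msmooth m n (f : 'rV[R]_m -> 'rV[R]_n) x : vsmooth f x -> msmooth f x.
Proof. by move=> sf i j; rewrite (ord1 i). Qed.

Lemma vsmooth_derivable m n (f : 'rV[R]_m -> 'rV[R]_n) x v :
  vsmooth f x -> derivable f x v.
Proof. by move=> /vsmooth_msmooth/msmooth_derivable. Qed.

Lemma vsmooth_derive m n (f : 'rV[R]_m -> 'rV[R]_n) x v j :
  vsmooth f x -> ('D_v f x) 0 j = 'D_v (fun y => f y 0 j) x.
Proof. by move=> /vsmooth_msmooth/msmooth_derive. Qed.

Lemma vsmooth_near_derivable m n (f : 'rV[R]_m -> 'rV[R]_n) x : vsmooth f x ->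
  \forall y \near x, forall v j, derivable f y v /\
     ('D_v f y) 0 j = 'D_v (fun y => f y 0 j) y.
Proof.
move=> sf; have H j := smooth_near_differentiable (sf j).
have := @filter_forall _ _ _ _ (nbhs_filter x) H; apply: filterS => y dy v j.
have dfv : derivable f y v.
  by apply: derivable_coord => k; apply: diff_derivable; exact: dy.
by split => //; rewrite derive_coord.
Qed.

Lemma vsmooth_derive_smooth m n (f : 'rV[R]_m -> 'rV[R]_n) x v :
  vsmooth f x -> vsmooth ('D_v f) x.
Proof.
move=> sf j; apply: (@smooth_at_ext _ _ ('D_v (fun y => f y 0 j))).
  apply: filterS (vsmooth_near_derivable sf) => y H.
  by have [_ ->] := H v j.
exact: smooth_at_derive.
Qed.

Lemma vsmooth_schwarz m n (f : 'rV[R]_m -> 'rV[R]_n) x u v : vsmooth f x ->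
  'D_v ('D_u f) x = 'D_u ('D_v f) x.
Proof.
move=> sf; apply/rowP => j.
have H w : \forall y \near x, ('D_w f y) 0 j = 'D_w (fun y => f y 0 j) y.
  by apply: filterS (vsmooth_near_derivable sf) => y H; have [_ ->] := H w j.
have K a b : ('D_b ('D_a f) x) 0 j = 'D_b ('D_a (fun y => f y 0 j)) x.
  etransitivity; first exact: (@vsmooth_derive m n ('D_a f) x b j (vsmooth_derive_smooth a sf)).
  exact: (near_eq_derive b (H a)).
etransitivity; first exact: K.
etransitivity; first exact: (derive_schwarz u v (sf j)).
by symmetry; exact: K.
Qed.

Lemma vsmooth_differentiable m n (f : 'rV[R]_m -> 'rV[R]_n) x :
  vsmooth f x -> differentiable f x.
Proof.
move=> sf; have -> : f = \sum_j (fun y => f y 0 j *: (delta_mx 0 j : 'rV[R]_n)).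
  by apply/funext => y; rewrite {1}(row_sum_delta (f y)) fct_sumE.
by apply: differentiable_sum => j; apply: differentiableZl; exact: smooth_differentiable.
Qed.

Lemma vsmooth_derive_linear m n (f : 'rV[R]_m -> 'rV[R]_n) x a u v : vsmooth f x ->
  'D_(a *: u + v) f x = a *: 'D_u f x + 'D_v f x.
Proof.
by move=> /vsmooth_differentiable df; rewrite !deriveE // linearP.
Qed.

Lemma vsmooth_continuous m n (f : 'rV[R]_m -> 'rV[R]_n) x : vsmooth f x ->
  {for x, continuous f}.
Proof.
move=> sf; apply: (@cvg_coord _ _ _ (nbhs_filter x)) => j.
exact: (smooth_continuous (sf j)).
Qed.

Lemma vsmooth_comp l m n (f : 'rV[R]_l -> 'rV[R]_m) (g : 'rV[R]_m -> 'rV[R]_n) x :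
  vsmooth f x -> vsmooth g (f x) -> vsmooth (fun y => g (f y)) x.
Proof. by move=> sf sg j; exact: (smooth_at_comp sf (sg j)). Qed.

Lemma msmooth_comp l m p q (f : 'rV[R]_l -> 'rV[R]_m) (g : 'rV[R]_m -> 'M[R]_(p, q)) x :
  vsmooth f x -> msmooth g (f x) -> msmooth (fun y => g (f y)) x.
Proof. by move=> sf sg i j; exact: (smooth_at_comp sf (sg i j)). Qed.

Lemma is_derive_scomp (V : normedModType R) m (f : V -> 'rV[R]_m) (F : 'rV[R]_m -> R) x v :
  derivable f x v -> smooth_at F (f x) ->
  is_derive x v (fun y => F (f y)) ('D_('D_v f x) F (f x)).
Proof. by move=> df /smooth_differentiable dF; exact: is_derive_comp. Qed.

Lemma is_derive_mcomp (V : normedModType R) m p q (f : V -> 'rV[R]_m)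
    (A : 'rV[R]_m -> 'M[R]_(p, q)) x v :
  derivable f x v -> msmooth A (f x) ->
  is_derive x v (fun y => A (f y)) ('D_('D_v f x) A (f x)).
Proof.
move=> df sA; have d i j := is_derive_scomp df (sA i j).
have dA : derivable (fun y => A (f y)) x v.
  by apply/derivable_mxP => i j; case: (d i j).
split; first exact: dA.
rewrite (derive_mx dA); apply/matrixP => i j; rewrite mxE.
have [_ ->] := d i j; symmetry.
exact: (@msmooth_derive m p q A (f x) ('D_v f x) i j sA).
Qed.

Lemma is_derive_vcomp (V : normedModType R) m n (f : V -> 'rV[R]_m)
    (g : 'rV[R]_m -> 'rV[R]_n) x v :
  derivable f x v -> vsmooth g (f x) ->
  is_derive x v (fun y => g (f y)) ('D_('D_v f x) g (f x)).
Proof. by move=> df sg; apply: is_derive_mcomp => //; exact: vsmooth_msmooth. Qed.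

Lemma vsmooth_ext m n (f g : 'rV[R]_m -> 'rV[R]_n) x : (\forall y \near x, f y = g y) ->
  vsmooth f x -> vsmooth g x.
Proof.
move=> fg sf j; apply: (@smooth_at_ext _ _ (fun y => f y 0 j)) => //.
by apply: filterS fg => y ->.
Qed.

Lemma is_derive_bf (V : normedModType R) n (A : V -> 'M[R]_n) (u w : V -> 'rV[R]_n) x v :
  derivable A x v -> derivable u x v -> derivable w x v ->
  is_derive x v (fun y => bf (A y) (u y) (w y))
    (bf ('D_v A x) (u x) (w x) + bf (A x) ('D_v u x) (w x) + bf (A x) (u x) ('D_v w x)).
Proof.
move=> dA du dw; rewrite !bfE -!big_split /=.
under eq_fun do rewrite bfE.
apply: is_derive_big_sum => i _; rewrite -!big_split /=.
apply: is_derive_big_sum => j _.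
rewrite derive_mx // !derive_coord // mxE.
have dAij := (derivable_mxP _ _ _).1 dA i j.
have dui := (derivable_mxP _ _ _).1 du 0 i.
have dwj := (derivable_mxP _ _ _).1 dw 0 j.
have := is_derive_mul (is_derive_mul (derivableP dAij) (derivableP dui)) (derivableP dwj).
by rewrite mulrDl.
Qed.

Lemma smooth_at_bf m n (A : 'rV[R]_m -> 'M[R]_n) (u v : 'rV[R]_m -> 'rV[R]_n) x :
  msmooth A x -> vsmooth u x -> vsmooth v x ->
  smooth_at (fun y => bf (A y) (u y) (v y)) x.
Proof.
move=> sA su sv; under eq_fun do rewrite bfE.
apply: smooth_at_sum => i _; apply: smooth_at_sum => j _.
by apply: smooth_at_mul => //; apply: smooth_at_mul.
Qed.

Lemma vsmooth_cst m n (a : 'rV[R]_n) (x : 'rV[R]_m) : vsmooth (fun=> a) x.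
Proof. by move=> j; exact: smooth_at_cst. Qed.

Lemma vsmooth_id m (x : 'rV[R]_m) : vsmooth id x.
Proof. by move=> j; exact: smooth_at_coord. Qed.

Lemma bf_deriveE m n (A : 'rV[R]_m -> 'M[R]_n) x u v w : msmooth A x ->
  bf ('D_u A x) v w =
  \sum_a \sum_b \sum_c pder a (fun y => A y b c) x * u 0 a * v 0 b * w 0 c.
Proof.
move=> sA; rewrite bfE [RHS]exchange_big /=; apply: eq_bigr => b _.
rewrite [RHS]exchange_big /=; apply: eq_bigr => c _.
rewrite msmooth_derive // deriveE_pder; last exact: smooth_differentiable.
rewrite !mulr_suml; apply: eq_bigr => a _; congr (_ * _ * _).
exact: mulrC.
Qed.

Lemma smooth_at_det m n (A : 'rV[R]_m -> 'M[R]_n) x : msmooth A x ->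
  smooth_at (fun y => \det (A y)) x.
Proof.
move=> sA; rewrite /determinant; apply: smooth_at_sum => s _.
apply: smooth_at_mul; first exact: smooth_at_cst.
by apply: smooth_at_prod => i _; exact: sA.
Qed.

Lemma msmooth_invmx m n (A : 'rV[R]_m -> 'M[R]_n) x : A x \in unitmx ->
  msmooth A x -> msmooth (fun y => invmx (A y)) x.
Proof.
move=> uA sA i j; have sd := smooth_at_det sA.
have d0 : \det (A x) != 0 by rewrite -unitfE -unitmxE.
have nb : nbhs (\det (A x)) [set r : R | r != 0].
  by apply: open_nbhs_nbhs; split => //; exact: open_neq.
have nu : \forall y \near x, \det (A y) != 0 by exact: (smooth_continuous sd nb).
apply: (@smooth_at_ext _ _ (fun y => (\det (A y))^-1 * \adj (A y) i j)).
  by apply: filterS nu => y; rewrite -unitfE -unitmxE /invmx => ->; rewrite [RHS]mxE.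
apply: smooth_at_mul; first exact: smooth_at_inv.
under eq_fun do rewrite mxE; rewrite /cofactor.
apply: smooth_at_mul; first exact: smooth_at_cst.
apply: (@smooth_at_det _ _ (fun y => row' j (col' i (A y)))) => k l; under eq_fun do rewrite !mxE; exact: sA.
Qed.

End SmoothVectors.

(** * Levi-Civita connection and curvature in coordinates *)

Section Connection.
Context {R : realType} {n : nat}.
Implicit Types (G : 'rV[R]_n -> 'M[R]_n) (x u v w : 'rV[R]_n).

Definition metric_at G x :=
  [/\ msmooth G x, \forall y \near x, (G y)^T = G y & G x \in unitmx].

Definition Gam G (c : 'I_n) x : 'M[R]_n := \matrix_(a, b) christoffel G x c a b.

(* Gamma(u, v), in the coordinates at x *)
Definition Chr G x u v : 'rV[R]_n := \row_c bf (Gam G c x) u v.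

Lemma ChrDl G x u v w : Chr G x (u + v) w = Chr G x u w + Chr G x v w.
Proof. by apply/rowP => j; rewrite !mxE bfDl. Qed.

Lemma ChrDr G x u v w : Chr G x w (u + v) = Chr G x w u + Chr G x w v.
Proof. by apply/rowP => j; rewrite !mxE bfDr. Qed.

Lemma ChrZl G x a u w : Chr G x (a *: u) w = a *: Chr G x u w.
Proof. by apply/rowP => j; rewrite !mxE bfZl. Qed.

Lemma ChrZr G x a u w : Chr G x w (a *: u) = a *: Chr G x w u.
Proof. by apply/rowP => j; rewrite !mxE bfZr. Qed.

Lemma Chr0r G x w : Chr G x w 0 = 0.
Proof. by apply/rowP => j; rewrite !mxE bf0r. Qed.

Lemma Chr0l G x w : Chr G x 0 w = 0.
Proof. by apply/rowP => j; rewrite !mxE bf0l. Qed.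

Lemma metric_sym G x : metric_at G x -> (G x)^T = G x.
Proof. by case=> _ /nbhs_singleton. Qed.

Lemma derive_sym G x u : metric_at G x -> ('D_u G x)^T = 'D_u G x.
Proof.
move=> [sG nG _]; apply/matrixP => i j; rewrite mxE.
etransitivity; first exact: msmooth_derive.
etransitivity; last by symmetry; exact: msmooth_derive.
apply: near_eq_derive; apply: filterS nG => y sy.
by rewrite -{1}sy mxE.
Qed.

Lemma koszul G x u v w : metric_at G x ->
  bf (G x) (Chr G x u v) w =
  2^-1 * (bf ('D_u G x) v w + bf ('D_v G x) u w - bf ('D_w G x) u v).
Proof.
move=> mG; have [sG nG uG] := mG.
pose K a b d := pder a (fun y => G y b d) x + pder b (fun y => G y a d) x
                - pder d (fun y => G y a b) x.
pose kap : 'rV[R]_n := \row_d \sum_a \sum_b K a b d * u 0 a * v 0 b.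
have E : Chr G x u v = 2^-1 *: (kap *m (invmx (G x))^T).
  apply/rowP => c; rewrite !mxE bfE.
  under eq_bigr => a _ do under eq_bigr => b _ do rewrite mxE /christoffel.
  under [in RHS]eq_bigr => d _ do rewrite !mxE.
  rewrite mulr_sumr.
  under [RHS]eq_bigr => d _ do rewrite mulr_suml mulr_sumr.
  rewrite [RHS]exchange_big /=; apply: eq_bigr => a _.
  under [RHS]eq_bigr => d _ do rewrite mulr_suml mulr_sumr.
  rewrite [RHS]exchange_big /=; apply: eq_bigr => b _.
  rewrite mulr_sumr !mulr_suml; apply: eq_bigr => d _.
  rewrite -/(K a b d); move: (K _ _ _) (invmx _ _ _) (u _ _) (v _ _) => p q r s.
  ring.
rewrite E bfZl; congr (_ * _).
have -> : bf (G x) (kap *m (invmx (G x))^T) w = (kap *m w^T) 0 0.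
  by rewrite /bf trmx_inv (metric_sym mG) mulmxKV.
rewrite (bf_deriveE u v w sG) (bf_deriveE v u w sG) (bf_deriveE w u v sG).
rewrite mxE [X in _ + X - _]exchange_big /=.
rewrite [X in _ = _ - X](_ : _ = \sum_a \sum_b \sum_c
   pder c (fun y => G y a b) x * w 0 c * u 0 a * v 0 b); last first.
  rewrite exchange_big /=; apply: eq_bigr => a _; rewrite exchange_big //.
rewrite -big_split -sumrB /=.
under eq_bigr => d _ do rewrite !mxE mulr_suml.
rewrite exchange_big /=; apply: eq_bigr => a _.
under eq_bigr => d _ do rewrite mulr_suml.
rewrite exchange_big -big_split -sumrB /=; apply: eq_bigr => b _.
rewrite -big_split -sumrB /=; apply: eq_bigr => d _.
rewrite /K; move: (pder a _ _) (pder b _ _) (pder d _ _) (u _ _) (v _ _) (w _ _) => p q r s t z.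
ring.
Qed.

Lemma Chr_sym G x u v : metric_at G x -> Chr G x u v = Chr G x v u.
Proof.
move=> mG; have [_ _ uG] := mG; apply: (bf_inj uG) => w.
have aux (a b c c' k1 k2 : R) : k1 = 2^-1 * (a + b - c) ->
    k2 = 2^-1 * (b + a - c') -> c = c' -> k1 = k2.
  by move=> -> -> ->; rewrite [b + a]addrC.
exact: aux (koszul u v w mG) (koszul v u w mG) (bfC u v (derive_sym w mG)).
Qed.

Lemma metric_compat G x u v w : metric_at G x ->
  bf ('D_u G x) v w = bf (G x) (Chr G x u v) w + bf (G x) v (Chr G x u w).
Proof.
move=> mG; have E1 := koszul u v w mG; have E2 := koszul u w v mG.
have E3 := bfC v (Chr G x u w) (metric_sym mG).
have E4 := bfC w v (derive_sym u mG).
have aux (a b c k1 k2 k3 d : R) : k1 = 2^-1 * (a + b - c) ->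
    k2 = 2^-1 * (d + c - b) -> k3 = k2 -> d = a -> a = k1 + k3.
  by clear => -> -> -> ->; lra.
exact: aux E1 E2 E3 E4.
Qed.

Lemma Gam_smooth G c x : metric_at G x -> msmooth (Gam G c) x.
Proof.
move=> [sG nG uG] a b; under eq_fun do rewrite mxE.
apply: smooth_at_mul; first exact: smooth_at_cst.
apply: smooth_at_sum => d _; apply: smooth_at_mul; first exact: msmooth_invmx.
by apply: smooth_at_sub; [apply: smooth_at_add|]; apply: smooth_at_pder.
Qed.

Lemma Chr_smooth m G (f u v : 'rV[R]_m -> 'rV[R]_n) (x : 'rV[R]_m) :
  vsmooth f x -> vsmooth u x -> vsmooth v x -> metric_at G (f x) ->
  vsmooth (fun y => Chr G (f y) (u y) (v y)) x.
Proof.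
move=> sf su sv mG c; under eq_fun do rewrite mxE.
by apply: smooth_at_bf => //; apply: msmooth_comp => //; exact: Gam_smooth.
Qed.

Lemma is_derive_Chr (V : normedModType R) G (f u v : V -> 'rV[R]_n) (x d : V) :
  derivable f x d -> derivable u x d -> derivable v x d -> metric_at G (f x) ->
  is_derive x d (fun y => Chr G (f y) (u y) (v y))
   ('D_('D_d f x) (fun z => Chr G z (u x) (v x)) (f x)
    + Chr G (f x) ('D_d u x) (v x) + Chr G (f x) (u x) ('D_d v x)).
Proof.
move=> df du dv mG.
have sG c := Gam_smooth c mG.
have sC : vsmooth (fun z => Chr G z (u x) (v x)) (f x).
  by apply: (@Chr_smooth _ G id) => //; [exact: vsmooth_id|exact: vsmooth_cst|exact: vsmooth_cst].
have H c : is_derive x d (fun y => bf (Gam G c (f y)) (u y) (v y))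
  (bf ('D_('D_d f x) (Gam G c) (f x)) (u x) (v x)
    + bf (Gam G c (f x)) ('D_d u x) (v x) + bf (Gam G c (f x)) (u x) ('D_d v x)).
  have [dG <-] := is_derive_mcomp df (sG c).
  exact: is_derive_bf.
have dC : derivable (fun y => Chr G (f y) (u y) (v y)) x d.
  apply: derivable_coord => c; under eq_fun do rewrite mxE.
  by case: (H c).
split; first exact: dC.
apply/rowP => c; rewrite (derive_coord c dC).
under eq_fun do rewrite mxE; have [_ ->] := H c; rewrite !mxE.
congr (_ + _ + _); symmetry.
etransitivity; first exact: (vsmooth_derive ('D_d f x) c sC).
under eq_fun do rewrite mxE.
have d0 : derivable (fun=> u x) (f x) ('D_d f x) by exact: derivable_cst.
have d1 : derivable (fun=> v x) (f x) ('D_d f x) by exact: derivable_cst.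
have [_ ->] := is_derive_bf (@msmooth_derivable _ _ _ _ _ _ ('D_d f x) (sG c)) d0 d1.
by rewrite !derive_cst bf0l bf0r !addr0.
Qed.

Definition Rm G x u v w : 'rV[R]_n :=
  'D_u (fun y => Chr G y v w) x - 'D_v (fun y => Chr G y u w) x
  + (Chr G x u (Chr G x v w) - Chr G x v (Chr G x u w)).

Lemma derive_ChrE G x a u v c : metric_at G x ->
  ('D_a (fun y => Chr G y u v) x) 0 c = bf ('D_a (Gam G c) x) u v.
Proof.
move=> mG; have sG := Gam_smooth c mG.
have sC : vsmooth (fun z => Chr G z u v) x.
  by apply: (@Chr_smooth _ G id) => //; [exact: vsmooth_id|exact: vsmooth_cst|exact: vsmooth_cst].
etransitivity; first exact: (vsmooth_derive a c sC).
under eq_fun do rewrite mxE.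
have d0 : derivable (fun=> u) x a by exact: derivable_cst.
have d1 : derivable (fun=> v) x a by exact: derivable_cst.
have [_ ->] := is_derive_bf (@msmooth_derivable _ _ _ _ _ _ a sG) d0 d1.
by rewrite !derive_cst bf0l bf0r !addr0.
Qed.

Lemma Chr_ChrE G x u v w d : (Chr G x u (Chr G x v w)) 0 d =
  \sum_a \sum_b \sum_c (\sum_e christoffel G x d a e * christoffel G x e b c)
    * u 0 a * v 0 b * w 0 c.
Proof.
rewrite mxE bfE; apply: eq_bigr => a _.
under eq_bigr => e _ do rewrite !mxE bfE mulr_sumr.
rewrite exchange_big /=; apply: eq_bigr => b _.
under eq_bigr => e _ do rewrite mulr_sumr.
rewrite exchange_big /=; apply: eq_bigr => c _.
rewrite !mulr_suml; apply: eq_bigr => e _; rewrite !mxE.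
move: (christoffel _ _ _ _ _) (christoffel _ _ _ _ _) (u _ _) (v _ _) (w _ _) => p q r s t.
ring.
Qed.

Lemma curvatureE G x u v w : metric_at G x ->
  \row_d \sum_a \sum_b \sum_c riemann G x d c a b * u 0 a * v 0 b * w 0 c = Rm G x u v w.
Proof.
move=> mG; apply/rowP => d; rewrite mxE.
have sG := Gam_smooth d mG.
have H1 := etrans (derive_ChrE u v w d mG) (bf_deriveE u v w sG).
have H2 := etrans (derive_ChrE v u w d mG) (bf_deriveE v u w sG).
have aux (p q r s p' q' r' s' : R) : p = p' -> q = q' -> r = r' -> s = s' ->
    p' - q' + (r' - s') = p - q + (r - s) by move=> -> -> -> ->.
have -> : (Rm G x u v w) 0 d =
  ('D_u (fun y => Chr G y v w) x) 0 d - ('D_v (fun y => Chr G y u w) x) 0 d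
  + ((Chr G x u (Chr G x v w)) 0 d - (Chr G x v (Chr G x u w)) 0 d) by rewrite !mxE.
etransitivity; last exact: (aux _ _ _ _ _ _ _ _ H1 H2 (Chr_ChrE G x u v w d) (Chr_ChrE G x v u w d)).
rewrite [X in _ - X + _]exchange_big /= [X in _ + (_ - X)]exchange_big /=.
rewrite -!sumrB -big_split /=; apply: eq_bigr => a _.
rewrite -!sumrB -big_split /=; apply: eq_bigr => b _.
rewrite -!sumrB -big_split /=; apply: eq_bigr => c _.
under [X in pder a X]eq_fun do rewrite mxE.
under [X in pder b X]eq_fun do rewrite mxE.
rewrite /riemann sumrB.
move: (pder a _ _) (pder b _ _) (\sum_e _) (\sum_e _) (u _ _) (v _ _) (w _ _) => p q r s t z k.
ring.
Qed.

End Connection.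

Section Pullback.
Context {R : realType} {n : nat}.
Implicit Types (g G : 'rV[R]_n -> 'M[R]_n) (phi : 'rV[R]_n -> 'rV[R]_n)
  (x u v w a b c : 'rV[R]_n).

Lemma is_derive_dir (F : 'rV[R]_n -> R) (beta : 'rV[R]_n -> 'rV[R]_n) x a :
  smooth_at F x -> derivable beta x a ->
  is_derive x a (fun y => 'D_(beta y) F y)
    ('D_('D_a beta x) F x + 'D_a ('D_(beta x) F) x).
Proof.
move=> sF db; have nF := smooth_near_differentiable sF.
have dpF i : is_derive x a (pder i F) ('D_a (pder i F) x).
  by split=> //; exact: (smooth_derivable (v := a) (smooth_at_pder i sF)).
have db' i : is_derive x a (fun y => beta y 0 i) (('D_a beta x) 0 i).
  rewrite (derive_coord i db).
  exact: (@derivableP _ _ _ _ x a ((derivable_mxP beta x a).1 db 0 i)).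
have E1 : 'D_a ('D_(beta x) F) x = \sum_i beta x 0 i * 'D_a (pder i F) x.
  have N : \forall y \near x, 'D_(beta x) F y = \sum_i beta x 0 i * pder i F y.
    by apply: filterS nF => y dF; exact: deriveE_pder.
  etransitivity; first exact: (near_eq_derive a N).
  have D : is_derive x a (fun y => \sum_i beta x 0 i * pder i F y)
      (\sum_i beta x 0 i * 'D_a (pder i F) x).
    have S i : is_derive x a (fun y => beta x 0 i * pder i F y)
        (beta x 0 i * 'D_a (pder i F) x).
      have := is_derive_mul (is_derive_cst (beta x 0 i : R) x a) (dpF i).
      by rewrite mul0r add0r.
    exact: (@is_derive_big_sum R _ _ (index_enum _) predT _ _ x a (fun i _ => S i)).
  by case: D.
have N : \forall y \near x, (\sum_i (beta y 0 i * pder i F y)) = 'D_(beta y) F y.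
  by apply: filterS nF => y dF; symmetry; exact: deriveE_pder.
apply: (near_eq_is_derive N).
rewrite E1 (deriveE_pder _ (smooth_differentiable sF)) -big_split /=.
exact: (@is_derive_big_sum R _ _ (index_enum _) predT _ _ x a (fun i _ => is_derive_mul (db' i) (dpF i))).
Qed.

Lemma is_derive_vdir phi (beta : 'rV[R]_n -> 'rV[R]_n) x a :
  vsmooth phi x -> derivable beta x a ->
  is_derive x a (fun y => 'D_(beta y) phi y)
    ('D_('D_a beta x) phi x + 'D_a ('D_(beta x) phi) x).
Proof.
move=> sp db; have np := vsmooth_near_derivable sp.
have H j : is_derive x a (fun y => ('D_(beta y) phi y) 0 j)
   (('D_('D_a beta x) phi x) 0 j + ('D_a ('D_(beta x) phi) x) 0 j).
  have N : \forall y \near x, 'D_(beta y) (fun z => phi z 0 j) y = ('D_(beta y) phi y) 0 j.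
    by apply: filterS np => y /(_ (beta y) j)[].
  apply: (near_eq_is_derive N); rewrite (vsmooth_derive _ j sp).
  have -> : ('D_a ('D_(beta x) phi) x) 0 j = 'D_a ('D_(beta x) (fun z => phi z 0 j)) x.
    etransitivity; first exact: (vsmooth_derive a j (vsmooth_derive_smooth (beta x) sp)).
    by apply: near_eq_derive; apply: filterS np => y /(_ (beta x) j)[].
  exact: is_derive_dir.
have D : derivable (fun y => 'D_(beta y) phi y) x a.
  by apply: derivable_coord => j; case: (H j).
split; first exact: D.
by apply/rowP => j; rewrite (derive_coord j D); have [_ ->] := H j; rewrite mxE.
Qed.

Definition pull_at phi g G x :=
  [/\ vsmooth phi x, metric_at g x, metric_at G (phi x),
     (\forall y \near x, forall u v,
        bf (g y) u v = bf (G (phi y)) ('D_u phi y) ('D_v phi y)) &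
     (forall w, exists u, 'D_u phi x = w)].

Lemma chr_law phi g G x u v : pull_at phi g G x ->
  'D_(Chr g x u v) phi x = 'D_u ('D_v phi) x + Chr G (phi x) ('D_u phi x) ('D_v phi x).
Proof.
move=> [sp mg mG pb surj]; have [sg _ _] := mg; have [sG _ uG] := mG.
have B a b c : bf ('D_a g x) b c =
    bf ('D_('D_a phi x) G (phi x)) ('D_b phi x) ('D_c phi x)
    + bf (G (phi x)) ('D_a ('D_b phi) x) ('D_c phi x)
    + bf (G (phi x)) ('D_b phi x) ('D_a ('D_c phi) x).
  have [_ E1] := is_derive_bf (msmooth_derivable (v := a) sg)
     (derivable_cst b x a) (derivable_cst c x a).
  rewrite !derive_cst bf0l bf0r !addr0 in E1.
  have [dG E3] := is_derive_mcomp (vsmooth_derivable (v := a) sp) sG.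
  have [_ E2] := is_derive_bf dG
     (vsmooth_derivable (v := a) (vsmooth_derive_smooth b sp))
     (vsmooth_derivable (v := a) (vsmooth_derive_smooth c sp)).
  rewrite E3 in E2; etransitivity; first by symmetry; exact: E1.
  etransitivity; last exact: E2.
  apply: near_eq_derive; by apply: filterS pb => y ->.
apply: (bf_inj uG) => w; have [d <-] := surj w; rewrite bfDl.
have E0 : bf (G (phi x)) ('D_(Chr g x u v) phi x) ('D_d phi x) = bf (g x) (Chr g x u v) d.
  by rewrite (nbhs_singleton pb).
have E1 := koszul u v d mg.
have E2 := koszul ('D_u phi x) ('D_v phi x) ('D_d phi x) mG.
have F1 := congr1 (fun z => bf (G (phi x)) z ('D_d phi x)) (vsmooth_schwarz u v sp).
have F2 := etrans (bfC ('D_d ('D_u phi) x) ('D_v phi x) (metric_sym mG))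
  (congr1 (bf (G (phi x)) ('D_v phi x)) (vsmooth_schwarz u d sp)).
have F3 := congr1 (bf (G (phi x)) ('D_u phi x)) (vsmooth_schwarz v d sp).
have aux (l l0 x1 x2 x3 A1 A2 A3 s s' p p' q q' k : R) : l = l0 ->
   l0 = 2^-1 * (x1 + x2 - x3) -> k = 2^-1 * (A1 + A2 - A3) ->
   x1 = A1 + s + p -> x2 = A2 + s' + q -> x3 = A3 + p' + q' ->
   s' = s -> p' = p -> q' = q -> l = s + k.
  by clear=> -> -> -> -> -> -> -> -> ->; lra.
exact: aux E0 E1 E2 (B u v d) (B v u d) (B d u v) F1 F2 F3.
Qed.

Lemma curvature_law phi g G x a b c : (\forall y \near x, pull_at phi g G y) ->
  'D_(Rm g x a b c) phi x = Rm G (phi x) ('D_a phi x) ('D_b phi x) ('D_c phi x).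
Proof.
move=> npull; have pull := nbhs_singleton npull.
have [sp mg mG _ _] := pull.
pose K a b c := 'D_a (fun y => Chr g y b c) x + Chr g x a (Chr g x b c).
have RK : Rm g x a b c = (-1) *: K b a c + K a b c.
  by rewrite /Rm /K scaleN1r opprD [RHS]addrC [RHS]addrACA.
pose D3 a b c := 'D_a ('D_b ('D_c phi)) x.
pose P a := 'D_a phi x.
pose S a b := 'D_a ('D_b phi) x.
pose K' a b c := 'D_(P a) (fun y => Chr G y (P b) (P c)) (phi x)
   + Chr G (phi x) (P a) (Chr G (phi x) (P b) (P c)).
have KE e d f : 'D_(K e d f) phi x = D3 e d f + K' e d f
    + Chr G (phi x) (S e d) (P f)
    + (Chr G (phi x) (P d) (S e f) + Chr G (phi x) (P e) (S d f)).
  have sC : vsmooth (fun y => Chr g y d f) x.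
    by apply: (@Chr_smooth _ _ _ g id) => //; [exact: vsmooth_id|exact: vsmooth_cst|exact: vsmooth_cst].
  have [_ E1] := is_derive_vdir sp (vsmooth_derivable (v := e) sC).
  have sd := vsmooth_derive_smooth d sp; have sf := vsmooth_derive_smooth f sp.
  have sdf := vsmooth_derive_smooth d sf.
  have [dCh E2] := is_derive_Chr (vsmooth_derivable (v := e) sp)
    (vsmooth_derivable (v := e) sd) (vsmooth_derivable (v := e) sf) mG.
  have N : \forall y \near x, 'D_(Chr g y d f) phi y =
      'D_d ('D_f phi) y + Chr G (phi y) ('D_d phi y) ('D_f phi y).
    by apply: filterS npull => y py; exact: chr_law.
  have E3 : 'D_e (fun y => 'D_(Chr g y d f) phi y) x =
      D3 e d f + 'D_e (fun y => Chr G (phi y) ('D_d phi y) ('D_f phi y)) x.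
    etransitivity; first exact: (near_eq_derive e N).
    exact: (deriveD (vsmooth_derivable (v := e) sdf) dCh).
  have E4 := chr_law e (Chr g x d f) pull.
  have E5 := chr_law d f pull.
  have E6 : 'D_(K e d f) phi x = 'D_('D_e (fun y => Chr g y d f) x) phi x
      + 'D_(Chr g x e (Chr g x d f)) phi x.
    have := vsmooth_derive_linear 1 ('D_e (fun y => Chr g y d f) x)
       (Chr g x e (Chr g x d f)) sp.
    by rewrite !scale1r.
  have aux (l t1 t2 t3 a0 q d3 q1 q2 q3 c0 p1 p2 : 'rV[R]_n) : l = t1 + t3 ->
     a0 = t1 + t2 -> a0 = d3 + q -> q = q1 + q2 + q3 -> t3 = t2 + c0 -> c0 = p1 + p2 ->
     l = d3 + (q1 + p2) + q2 + (q3 + p1).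
    clear=> -> -> E Eq -> ->; rewrite addrA E Eq.
    by apply/rowP => j; rewrite !mxE; ring.
  have E7 : Chr G (phi x) ('D_e phi x) ('D_(Chr g x d f) phi x) =
     Chr G (phi x) (P e) (S d f) + Chr G (phi x) (P e) (Chr G (phi x) (P d) (P f)).
    by rewrite E5 ChrDr.
  exact: aux E6 E1 E3 E2 E4 E7.
have Ssym := congr1 (fun z => Chr G (phi x) z (P c)) (vsmooth_schwarz a b sp : S b a = S a b).
have Dsym : D3 b a c = D3 a b c by exact: (vsmooth_schwarz a b (vsmooth_derive_smooth c sp)).
have aux (l0 l ka kb d d' t2 t3 r1 r2 s s' p q : 'rV[R]_n) : l0 = l ->
    l = (-1) *: kb + ka ->
    ka = d + (t2 + r1) + s + (p + q) -> kb = d' + (t3 + r2) + s' + (q + p) ->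
    s' = s -> d' = d -> l0 = t2 - t3 + (r1 - r2).
  by clear=> -> -> -> -> -> ->; apply/rowP => j; rewrite !mxE; ring.
exact: aux (congr1 (fun z => 'D_z phi x) RK)
  (vsmooth_derive_linear (-1) (K b a c) (K a b c) sp) (KE a b c) (KE b a c) Ssym Dsym.
Qed.

End Pullback.

(** * Gauss lemma and Hessian comparison in normal coordinates *)

Lemma jacobi_algebra (R : realFieldType) (t kappa r p a b q k : R) : 0 < t ->
  r <= - kappa ^+ 2 * k -> p ^+ 2 <= q * k -> 0 < k ->
  t * r = (- 2) * p - t * (a + b) ->
  t * (kappa ^+ 2 * k) * k + t * (2 * p) ^+ 2 / 4
    <= (2 * p + 2^-1 * (t * (2 * (a + b + q)))) * k.
Proof.
move=> t0 h1 h2 k0 h3.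
have -> : (2 * p + 2^-1 * (t * (2 * (a + b + q)))) * k = t * (q * k) - t * r * k.
  by rewrite h3; field.
have -> : t * (2 * p) ^+ 2 / 4 = t * p ^+ 2 by field.
have e1 : t * p ^+ 2 <= t * (q * k) by rewrite ler_pM2l.
have e2 : t * r * k <= t * (- kappa ^+ 2 * k) * k by rewrite ler_pM2r // ler_pM2l.
rewrite addrC; apply: lerD => //; rewrite -[leLHS]opprK lerN2.
by apply: le_trans e2 _; rewrite mulNr mulrN mulNr.
Qed.

Lemma sqrt_quotient_algebra (R : realFieldType) (y1 y k1 q k : R) : q != 0 ->
  k = q ^+ 2 -> y1 * q^-1 + y * (- q^-1 ^+ 2 * ((2 * q)^-1 * k1)) =
  (y1 * k - 2^-1 * y * k1) / q ^+ 3.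
Proof. by move=> q0 ->; field. Qed.

Lemma is_derive_sqrt_comp (R : realType) (p : R -> R) (dp t : R) :
  is_derive t 1 p dp -> 0 < p t ->
  is_derive t 1 (fun s => Num.sqrt (p s)) ((2 * Num.sqrt (p t))^-1 * dp).
Proof.
move=> [dk Ek] p0.
have [d1 E1] : is_derive (p t) 1 (Num.sqrt : R -> R) ((2 * Num.sqrt (p t))^-1).
  exact: is_derive1_sqrt.
have dS : differentiable (Num.sqrt : R -> R) (p t) by exact/derivable1_diffP.
have [d3 E3] := is_derive_comp dk dS; split; first exact: d3.
have [_ E4] := derive_scale dp d1.
etransitivity; first exact: E3.
rewrite Ek -E1 mulrC -E4; congr (derive _ _ _).
by rewrite -[RHS]/(dp * 1) mulr1.
Qed.

Section NormalCoordinates.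
Context {R : realType} {n : nat}.
Variable g : 'rV[R]_n -> 'M[R]_n.
Implicit Types (u v w : 'rV[R]_n) (t : R).

(* g is a metric on R^n whose geodesics through 0 are the lines. *)
Hypothesis mg : forall x : 'rV[R]_n, metric_at g x.
Hypothesis pg : forall (x : 'rV[R]_n) v, v != 0 -> 0 < bf (g x) v v.
Hypothesis lineg : forall v t, Chr g (t *: v) v v = 0.

Lemma is_derive_ray v t : is_derive t 1 (fun s : R => s *: v) v.
Proof.
have d := is_diff_scalel t v.
have df : differentiable (fun s : R => s *: v) t by exact: ex_diff.
split; first exact/derivable1_diffP.
rewrite deriveE //; have -> : 'd (fun s : R => s *: v) t = *:%R^~ v :> (R -> _).
  exact: diff_val.
by rewrite scale1r.
Qed.

Lemma is_derive_ray_bf v w z t :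
  is_derive t 1 (fun s : R => bf (g (s *: v)) w z) (bf ('D_v g (t *: v)) w z).
Proof.
have [sg _ _] := mg (t *: v); have [dr E] := is_derive_ray v t.
have [dG EG] := is_derive_mcomp dr sg.
have := is_derive_bf dG (@derivable_cst R _ _ w t 1) (@derivable_cst R _ _ z t 1).
by rewrite EG E !derive_cst bf0l bf0r !addr0.
Qed.

Lemma is_derive_0_const (f : R -> R) :
  (forall t : R, is_derive t 1 f 0) -> forall s t : R, f s = f t.
Proof. by move=> df s t; exact: is_derive_0_is_cst. Qed.

Lemma speed_const v t : bf (g (t *: v)) v v = bf (g 0) v v.
Proof.
have H (s : R) : is_derive s 1 (fun r : R => bf (g (r *: v)) v v) 0.
  have := is_derive_ray_bf v v v s.
  by rewrite (metric_compat _ _ _ (mg _)) lineg bf0l bf0r addr0.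
by rewrite (is_derive_0_const H t 0) scale0r.
Qed.

Lemma is_derive_id_bf (A : 'rV[R]_n -> 'M[R]_n) (x : 'rV[R]_n) v w : msmooth A x ->
  is_derive x w (fun y => bf (A y) y v) (bf ('D_w A x) x v + bf (A x) w v).
Proof.
move=> sA.
have := is_derive_bf (msmooth_derivable (v := w) sA) (@derivable_id R _ x w) (@derivable_cst R _ _ v x w).
by rewrite derive_id derive_cst bf0r addr0.
Qed.

Lemma is_derive_quad (A : 'rV[R]_n -> 'M[R]_n) (x : 'rV[R]_n) w : msmooth A x ->
  is_derive x w (fun y => bf (A y) y y)
    (bf ('D_w A x) x x + bf (A x) w x + bf (A x) x w).
Proof.
move=> sA.
have := is_derive_bf (msmooth_derivable (v := w) sA) (@derivable_id R _ x w) (@derivable_id R _ x w).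
by rewrite derive_id.
Qed.

Lemma msmooth_cst m p q (A : 'M[R]_(p, q)) (x : 'rV[R]_m) : msmooth (fun=> A) x.
Proof. by move=> i j; exact: smooth_at_cst. Qed.

Lemma norm_radial (x : 'rV[R]_n) : bf (g x) x x = bf (g 0) x x.
Proof. by have := speed_const x 1; rewrite scale1r. Qed.

Lemma derive_norm_radial (x : 'rV[R]_n) w :
  bf ('D_w g x) x x + 2 * bf (g x) x w = 2 * bf (g 0) x w.
Proof.
have [sg _ _] := mg x.
have [_ E1] := is_derive_quad w sg.
have [_ E2] := is_derive_quad w (@msmooth_cst n n n (g 0) x).
have E : 'D_w (fun y => bf (g y) y y) x = 'D_w (fun y => bf (g 0) y y) x.
  exact: (congr1 (fun f => 'D_w f x) (funext norm_radial)).
have S0 := bfC w x (metric_sym (mg 0)); have S1 := bfC w x (metric_sym (mg x)).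
have Z : bf ('D_w (fun=> g 0) x) x x = 0.
  by rewrite derive_cst /bf mulmx0 mul0mx mxE.
have aux (a b c a' b' c' l l' : R) : l = a + b + c -> l' = a' + b' + c' -> l = l' ->
    b' = c' -> b = c -> a' = 0 -> a + 2 * c = 2 * c'.
  by clear=> -> -> E Eb' Eb Ea; rewrite Eb Eb' Ea in E; lra.
exact: aux E1 E2 E S0 S1 Z.
Qed.

(* With a(t) = g_{tv}(v, w), the two previous lemmas give (t a(t))' = g_0(v, w). *)
Lemma gauss v w : bf (g v) v w = bf (g 0) v w.
Proof.
pose a t := bf (g (t *: v)) v w.
have da (t : R) : is_derive t 1 a (2^-1 * bf ('D_w g (t *: v)) v v).
  have := is_derive_ray_bf v v w t.
  rewrite (metric_compat v v w (mg (t *: v))) lineg bf0l add0r.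
  rewrite (metric_compat w v v (mg (t *: v))) (Chr_sym w v (mg (t *: v))).
  rewrite (bfC (Chr g (t *: v) v w) v (metric_sym (mg (t *: v)))).
  move: (bf _ _ _) => z; rewrite (_ : 2^-1 * (z + z) = z) //; lra.
have ta t : t != 0 -> t * (2^-1 * bf ('D_w g (t *: v)) v v) = bf (g 0) v w - a t.
  move=> t0; have := derive_norm_radial (t *: v) w.
  rewrite !bfZl bfZr -/(a t) => H; apply: (mulfI t0).
  have aux (p q r s : R) : s * (s * p) + 2 * (s * r) = 2 * (s * q) ->
    s * (s * (2^-1 * p)) = s * (q - r) by clear=> E; lra.
  exact: aux H.
have H (t : R) : is_derive t 1 (fun s : R => s * a s - s * bf (g 0) v w) 0.
  have D1 := is_derive_mul (is_derive_id t (1 : R)) (da t).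
  have D2 := is_derive_mul (is_derive_id t (1 : R)) (is_derive_cst (bf (g 0) v w : R) t (1 : R)).
  have D := is_derive_sub D1 D2.
  apply: is_derive_eq D _; rewrite mulr0 addr0 !mul1r /=.
  have [->|t0] := eqVneq t 0; first by rewrite mul0r addr0 /a scale0r subrr.
  by rewrite (ta t t0) [a t + _]addrC subrK subrr.
have := is_derive_0_const H 1 0; rewrite !mul0r subrr !mul1r /a scale1r.
by move/eqP; rewrite subr_eq0 => /eqP.
Qed.

Lemma derive_gauss (x : 'rV[R]_n) w z :
  bf ('D_w g x) x z = bf (g 0) w z - bf (g x) w z.
Proof.
have [sg _ _] := mg x.
have [_ E1] := is_derive_id_bf z w sg.
have [_ E2] := is_derive_id_bf z w (@msmooth_cst n n n (g 0) x).
have E : 'D_w (fun y => bf (g y) y z) x = 'D_w (fun y => bf (g 0) y z) x.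
  exact: (congr1 (fun f => 'D_w f x) (funext (fun y => gauss y z))).
have Z : bf ('D_w (fun=> g 0) x) x z = 0.
  by rewrite derive_cst /bf mulmx0 mul0mx mxE.
have aux (l l' a b c d : R) : l = a + b -> l' = c + d -> l = l' -> c = 0 -> a = d - b.
  by clear=> -> -> E Ec; rewrite Ec in E; lra.
exact: aux E1 E2 E Z.
Qed.

(* Covariant Hessian, in direction w, of half the squared distance to 0. *)
Definition hess (x : 'rV[R]_n) w : R := bf (g x) w w + 2^-1 * bf ('D_x g x) w w.

Lemma hessE (x : 'rV[R]_n) w : hess x w = bf (g 0) w w - bf (g 0) x (Chr g x w w).
Proof.
have E1 := koszul w w x (mg x).
have E2 := derive_gauss x w w.
have E3 := gauss x (Chr g x w w).
have E4 := bfC (Chr g x w w) x (metric_sym (mg x)).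
have E5 := bfC x w (derive_sym w (mg x)).
have aux (k p q q' r r' s0 s1 : R) : k = 2^-1 * (p + p - q) -> p = r -> r = s0 - s1 ->
   k = q' -> q' = r' -> s1 + 2^-1 * q = s0 - r'.
  by clear=> -> -> -> <- <-; lra.
apply: aux E1 _ E2 E4 E3; by rewrite E5.
Qed.

Section Comparison.
Variables (kappa : R) (v w : 'rV[R]_n).
Hypothesis kappa_gt0 : 0 < kappa.
Hypothesis w0 : w != 0.
Hypothesis curvg : forall t, 0 <= t ->
  bf (g (t *: v)) (Rm g (t *: v) w v v) w <= - kappa ^+ 2 * bf (g (t *: v)) w w.

Let k (t : R) : R := bf (g (t *: v)) w w.
Let N (t : R) := Chr g (t *: v) v w.
Let k1 (t : R) : R := 2 * bf (g (t *: v)) (N t) w.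
Let k2 (t : R) : R := 2 * (bf (g (t *: v)) ('D_v (fun y => Chr g y v w) (t *: v)) w
   + bf (g (t *: v)) (Chr g (t *: v) v (N t)) w + bf (g (t *: v)) (N t) (N t)).

Lemma jacobi_k_gt0 t : 0 < k t. Proof. exact: pg. Qed.

Lemma jacobi_k1 t : is_derive t 1 k (k1 t).
Proof.
have := is_derive_ray_bf v w w t.
rewrite (metric_compat v w w (mg (t *: v))).
by rewrite (bfC w _ (metric_sym (mg (t *: v)))) -mulr2n -mulr_natl.
Qed.

Lemma jacobi_k2 t : is_derive t 1 k1 (k2 t).
Proof.
have [sg _ _] := mg (t *: v); have [dr Er] := is_derive_ray v t.
have [dG EG] := is_derive_mcomp dr sg.
have [dN EN] := is_derive_Chr dr (@derivable_cst R _ _ v t 1) (@derivable_cst R _ _ w t 1) (mg (t *: v)).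
have [db Eb] := is_derive_bf dG dN (@derivable_cst R _ _ w t 1).
rewrite !derive_cst Er Chr0l Chr0r !addr0 in EN.
rewrite Er in EG.
rewrite [X in _ + _ + bf _ _ X]derive_cst bf0r addr0 in Eb.
have M := metric_compat v (N t) w (mg (t *: v)).
have dmul : is_derive t 1 (fun s : R => 2 * bf (g (s *: v)) (N s) w)
   (2 * 'D_1 (fun s : R => bf (g (s *: v)) (N s) w) t).
  have := is_derive_mul (is_derive_cst (2 : R) t (1 : R)) (derivableP db).
  by rewrite mul0r add0r.
apply: is_derive_eq dmul _; rewrite /k2; congr (_ * _).
have aux (l a b c d e f : R) : l = a + b -> a = c -> b = d -> c = e + f -> l = d + e + f.
  by clear=> -> -> -> ->; rewrite addrC addrA.
exact: aux Eb (congr1 (fun z => bf z (N t) w) EG)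
  (congr1 (fun z => bf (g (t *: v)) z w) EN) M.
Qed.

Lemma jacobi_rel t : t != 0 ->
  t *: 'D_w (fun y => Chr g y v v) (t *: v) = (- 2) *: N t.
Proof.
move=> t0; set x := t *: v.
have [_ E] := @is_derive_Chr _ _ _ g id id id x w (@derivable_id R _ x w)
  (@derivable_id R _ x w) (@derivable_id R _ x w) (mg x).
rewrite !derive_id in E.
have Z : 'D_w (fun y : 'rV[R]_n => Chr g y y y) x = 0.
  have -> : (fun y : 'rV[R]_n => Chr g y y y) = fun=> 0.
    by apply/funext => y; have := lineg y 1; rewrite scale1r.
  exact: derive_cst.
have E' : 'D_w (fun z : 'rV[R]_n => Chr g z x x) x = t ^+ 2 *: 'D_w (fun z => Chr g z v v) x.
  have -> : (fun z : 'rV[R]_n => Chr g z x x) = (fun z => t ^+ 2 *: Chr g z v v).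
    by apply/funext => z; rewrite ChrZl ChrZr scalerA expr2.
  apply: deriveZ; apply: vsmooth_derivable.
  by apply: (@Chr_smooth _ _ _ g id) => //; [exact: vsmooth_id|exact: vsmooth_cst|exact: vsmooth_cst].
have F1 : Chr g x w x = t *: N t by rewrite ChrZr (Chr_sym w v (mg x)).
have F2 : Chr g x x w = t *: N t by rewrite ChrZl.
have aux (z d d' a b p : 'rV[R]_n) : z = 0 -> z = d + a + b -> d = t ^+ 2 *: d' ->
    a = t *: p -> b = t *: p -> t *: d' = (-2) *: p.
  clear -t0 => -> E1 Ed Ea Eb; apply: (scalerI t0); rewrite Ed Ea Eb in E1.
  apply/rowP => j; move/rowP: E1 => /(_ j); rewrite !mxE => E1; lra.
exact: aux Z E E' F1 F2.
Qed.

Lemma jacobi_ineq t : 0 < t ->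
  t * (kappa ^+ 2 * k t) * k t + t * k1 t ^+ 2 / 4 <= (k1 t + 2^-1 * (t * k2 t)) * k t.
Proof.
move=> t0; have tn0 : t != 0 by rewrite gt_eqF.
have C := curvg (ltW t0); have D0 := jacobi_rel tn0.
have CS := cauchy_schwarz (N t) w (metric_sym (mg (t *: v))) (pg (t *: v)).
have kp := jacobi_k_gt0 t.
set D := 'D_w _ _ in D0.
pose Nd := 'D_v (fun y => Chr g y v w) (t *: v).
have RE : Rm g (t *: v) w v v = D - Nd - Chr g (t *: v) v (N t).
  have -> : Nd = 'D_v (fun y => Chr g y w v) (t *: v).
    exact: (congr1 (fun f => 'D_v f (t *: v)) (funext (fun y => Chr_sym v w (mg y)))).
  rewrite /Rm lineg Chr0r sub0r; congr (_ - _).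
  by congr (Chr _ _ _ _); exact: Chr_sym.
have tR : t * bf (g (t *: v)) (Rm g (t *: v) w v v) w =
   (-2) * bf (g (t *: v)) (N t) w
    - t * (bf (g (t *: v)) Nd w + bf (g (t *: v)) (Chr g (t *: v) v (N t)) w).
  rewrite RE !bfDl !bfNl -(bfZl _ (-2)) -D0 bfZl.
  set p := bf _ D w; set q := bf _ Nd w; set r := bf _ _ w; clear; ring.
rewrite -/(k t) in C CS; rewrite /k2 -/Nd.
exact: (jacobi_algebra t0 C CS kp tR).
Qed.

Let sh (t : R) : R := expR (kappa * t) - (expR (kappa * t))^-1.
Let ch (t : R) : R := expR (kappa * t) + (expR (kappa * t))^-1.

Lemma is_derive_expM t : is_derive t 1 (fun s : R => expR (kappa * s)) (kappa * expR (kappa * t)).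
Proof.
have d1 : is_derive t 1 (fun s : R => kappa * s) kappa.
  have := is_derive_mul (is_derive_cst (kappa : R) t (1 : R)) (is_derive_id t (1 : R)).
  by rewrite mul0r add0r mulr1.
have [d1' E1] := d1; have [d2 E2] := is_derive_expR (kappa * t).
have dE : differentiable (expR : R -> R) (kappa * t) by exact/derivable1_diffP.
have [d3 E3] := is_derive_comp d1' dE; split; first exact: d3.
have [_ E4] := derive_scale kappa d2.
etransitivity; first exact: E3.
rewrite E1 -E2 -E4; congr (derive _ _ _).
by rewrite -[RHS]/(kappa * 1) mulr1.
Qed.

Lemma is_derive_sh t : is_derive t 1 sh (kappa * ch t).
Proof.
have e0 : expR (kappa * t) != 0 by rewrite gt_eqF // expR_gt0.
have d1 := is_derive_expM t.
have [d E] := is_derive_sub d1 (@is_derive_inv R _ (fun s : R => expR (kappa * s)) t 1 _ e0 d1).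
split; [exact: d|etransitivity; first exact: E].
by rewrite /ch; field.
Qed.

Lemma is_derive_ch t : is_derive t 1 ch (kappa * sh t).
Proof.
have e0 : expR (kappa * t) != 0 by rewrite gt_eqF // expR_gt0.
have d1 := is_derive_expM t.
have [d E] := is_derive_add d1 (@is_derive_inv R _ (fun s : R => expR (kappa * s)) t 1 _ e0 d1).
split; [exact: d|etransitivity; first exact: E].
by rewrite /sh; field.
Qed.

Lemma sh_ge0 t : 0 <= t -> 0 <= sh t.
Proof.
move=> t0; rewrite subr_ge0 -expRN ler_expR.
have kt : 0 <= kappa * t by rewrite mulr_ge0 // ltW.
by rewrite (le_trans _ kt) // oppr_le0.
Qed.

Let Y (t : R) : R := (k t + 2^-1 * (t * k1 t)) * sh t - kappa * (t * ch t) * k t.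
Let Y1 (t : R) : R := (k1 t + 2^-1 * (k1 t + t * k2 t)) * sh t
  + (k t + 2^-1 * (t * k1 t)) * (kappa * ch t)
  - (kappa * (ch t + t * (kappa * sh t)) * k t + kappa * (t * ch t) * k1 t).

Lemma jacobi_Y1 t : is_derive t 1 Y (Y1 t).
Proof.
have dk := jacobi_k1 t; have dk1 := jacobi_k2 t.
have dsh := is_derive_sh t; have dch := is_derive_ch t.
have did := is_derive_id t (1 : R).
have c2 := is_derive_cst (2^-1 : R) t (1 : R); have ck := is_derive_cst (kappa : R) t (1 : R).
have H1 := is_derive_mul (is_derive_add dk (is_derive_mul c2 (is_derive_mul did dk1))) dsh.
have H2 := is_derive_mul (is_derive_mul ck (is_derive_mul did dch)) dk.
have [d E] := is_derive_sub H1 H2.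
split; [exact: d|etransitivity; first exact: E].
by rewrite /Y1 !mul0r !add0r !mul1r.
Qed.

Lemma jacobi_W t : is_derive t 1 (fun s => Y s * (Num.sqrt (k s))^-1)
  ((Y1 t * k t - 2^-1 * Y t * k1 t) / (Num.sqrt (k t)) ^+ 3).
Proof.
have kp := jacobi_k_gt0 t; have q0 : 0 < Num.sqrt (k t) by rewrite sqrtr_gt0.
have qn0 : Num.sqrt (k t) != 0 by rewrite gt_eqF.
have dsq := is_derive_sqrt_comp (jacobi_k1 t) kp.
have [d E] := is_derive_mul (jacobi_Y1 t) (@is_derive_inv R _ (fun s : R => Num.sqrt (k s)) t 1 _ qn0 dsq).
split; [exact: d|etransitivity; first exact: E].
by apply: sqrt_quotient_algebra => //; rewrite sqr_sqrtr // ltW.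
Qed.

Lemma jacobi_W_ge0 t : 0 < t -> 0 <= (Y1 t * k t - 2^-1 * Y t * k1 t) / (Num.sqrt (k t)) ^+ 3.
Proof.
move=> t0; apply: divr_ge0; last by rewrite exprn_ge0 // sqrtr_ge0.
have J := jacobi_ineq t0; have s0 := sh_ge0 (ltW t0).
rewrite (_ : _ - _ = sh t * ((k1 t + 2^-1 * (t * k2 t)) * k t
   - (t * (kappa ^+ 2 * k t) * k t + t * k1 t ^+ 2 / 4))); last first.
  by rewrite /Y1 /Y; field.
by rewrite mulr_ge0 // subr_ge0.
Qed.

Lemma hess_ray t : hess (t *: v) w = k t + 2^-1 * (t * k1 t).
Proof.
rewrite /hess -/(k t) /k1 (metric_compat (t *: v) w w (mg (t *: v))).
rewrite (bfC w _ (metric_sym (mg (t *: v)))) ChrZl bfZl -/(N t).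
by move: (bf _ _ _) => z; clear; congr (_ + _); ring.
Qed.

(* The field t w along the ray t v is a Jacobi field. By the curvature bound the
   quotient of the difference of the two sides by |w|_{tv} is nondecreasing in t;
   it vanishes at t = 0. *)
Lemma hess_comparison t : 0 <= t ->
  kappa * t * ch t * bf (g (t *: v)) w w <= hess (t *: v) w * sh t.
Proof.
move=> t0; rewrite hess_ray.
suff : 0 <= Y t by rewrite /Y subr_ge0 -/(k t) !mulrA.
have W0 : Y 0 = 0.
  by rewrite /Y /sh mulr0 expR0 invr1 !(subrr, mul0r, mulr0).
suff : Y 0 * (Num.sqrt (k 0))^-1 <= Y t * (Num.sqrt (k t))^-1.
  rewrite W0 mul0r pmulr_lge0 // invr_gt0 sqrtr_gt0; exact: jacobi_k_gt0.
have dW (s : R) : derivable (fun s => Y s * (Num.sqrt (k s))^-1) s 1.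
  by case: (jacobi_W s).
apply: (@ger0_derive1_ndecr R (fun s => Y s * (Num.sqrt (k s))^-1) 0 t) => //.
- move=> s; rewrite in_itv /= => /andP[s0 _].
  by rewrite derive1E; have [_ ->] := jacobi_W s; exact: jacobi_W_ge0.
- by apply: derivable_within_continuous => s _; exact: dW.
Qed.

End Comparison.
End NormalCoordinates.

Section OdeUniqueness.
Context {R : realType} {n : nat}.

Lemma bounded_on_ball (F : 'rV[R]_n -> R) (K : R) : 0 <= K -> continuous F ->
  exists2 C : R, 0 <= C & forall x : 'rV[R]_n, `|x| <= K -> `|F x| <= C.
Proof.
move=> K0 cF; pose A := [set x : 'rV[R]_n | `|x| <= K].
have A0 : A !=set0 by exists 0; rewrite /A /= normr0.
have bA : bounded_set A by exists K; split; [exact: num_real|move=> M KM x /le_trans; apply; exact: ltW].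
have clA : closed A.
  have -> : A = (fun x : 'rV[R]_n => `|x|) @^-1` [set r : R | r <= K] by [].
  by apply: closed_comp; [move=> x _; exact: norm_continuous|exact: closed_le].
have cA : compact A by exact: bounded_closed_compact.
have cnF : continuous (fun x => `|F x|).
  by move=> x; apply: (@continuous_comp _ _ _ F (fun r : R => `|r|)); [exact: cF|exact: norm_continuous].
have [|c _ cP] := @EVT_max_rV R n (fun x => `|F x|) A A0 cA.
  exact: continuous_subspaceT.
exists `|F c| => // x xK; apply: cP; exact/mem_set.
Qed.

Lemma lipschitz_on_ball (F : 'rV[R]_n -> R) (K : R) : 0 <= K ->
  (forall x, smooth_at F x) ->
  exists2 L : R, 0 <= L & forall x y : 'rV[R]_n, `|x| <= K -> `|y| <= K ->
    `|F x - F y| <= L * `|x - y|.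
Proof.
move=> K0 sF.
have B i : {C : R | 0 <= C & forall x : 'rV[R]_n, `|x| <= K -> `|pder i F x| <= C}.
  apply/cid2/bounded_on_ball => // x; apply: smooth_continuous; exact: smooth_at_pder.
exists (\sum_i s2val (B i)); first by apply: sumr_ge0 => i _; case: (B i).
move=> x y xK yK.
have d t : derivable F (y + t *: (x - y)) (x - y).
  by apply: diff_derivable; exact: smooth_differentiable.
have [c c01] := @MVT_line R _ F y (x - y) (fun t _ => d t).
rewrite [y + (x - y)]addrC subrK => ->.
have zK : `|y + c *: (x - y)| <= K.
  move: c01 => /andP[c0 c1].
  have -> : y + c *: (x - y) = (1 - c) *: y + c *: x.
    by rewrite scalerBr scalerBl scale1r addrA addrAC.
  apply: le_trans (ler_normD _ _) _; rewrite !normrZ !ger0_norm ?subr_ge0 //.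
  rewrite (_ : K = (1 - c) * K + c * K); last by ring.
  by apply: lerD; apply: ler_wpM2l; rewrite ?subr_ge0.
rewrite deriveE_pder; last exact: smooth_differentiable.
apply: le_trans (ler_norm_sum _ _ _) _; rewrite mulr_suml; apply: ler_sum => i _.
rewrite normrM mulrC; apply: ler_pM => //; last exact: coord_le_norm.
by case: (B i) => C C0 /= ->.
Qed.

Lemma vlipschitz_on_ball (F : 'rV[R]_n -> 'rV[R]_n) (K : R) : 0 <= K ->
  (forall x, vsmooth F x) ->
  exists2 L : R, 0 <= L & forall (x y : 'rV[R]_n) j, `|x| <= K -> `|y| <= K ->
    `|F x 0 j - F y 0 j| <= L * `|x - y|.
Proof.
move=> K0 sF.
have B j : {L : R | 0 <= L & forall x y : 'rV[R]_n, `|x| <= K -> `|y| <= K ->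
    `|F x 0 j - F y 0 j| <= L * `|x - y|}.
  by apply/cid2/(@lipschitz_on_ball (fun x => F x 0 j)) => // x; exact: sF.
exists (\sum_j s2val (B j)); first by apply: sumr_ge0 => i _; case: (B i).
move=> x y j xK yK; apply: (@le_trans _ _ (s2val (B j) * `|x - y|)).
  by case: (B j) => L L0 /= ->.
apply: ler_wpM2r => //; rewrite (bigD1 j) //= lerDl.
by apply: sumr_ge0 => i _; case: (B i).
Qed.

Lemma curve_bounded (z : R -> 'rV[R]_n) (T : R) : 0 <= T -> continuous z ->
  exists2 K : R, 0 <= K & forall t, 0 <= t <= T -> `|z t| <= K.
Proof.
move=> T0 cz; have cn : continuous (fun t => `|z t|).
  by move=> t; apply: (@continuous_comp _ _ _ z (fun v : 'rV[R]_n => `|v|)); [exact: cz|exact: norm_continuous].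
have [|c c01 cP] := @EVT_max R (fun t => `|z t|) 0 T T0.
  exact: continuous_subspaceT.
by exists `|z c| => // t tT; apply: cP; rewrite in_itv.
Qed.

Lemma sq_norm_le (v : 'rV[R]_n) : `|v| ^+ 2 <= \sum_j v 0 j ^+ 2.
Proof.
have S0 : 0 <= \sum_j v 0 j ^+ 2 by apply: sumr_ge0 => j _; exact: sqr_ge0.
rewrite -[leRHS]sqr_sqrtr // ler_sqr ?nnegrE ?sqrtr_ge0 //.
apply: norm_le_coord; first exact: sqrtr_ge0.
move=> i; rewrite -sqrtr_sqr ler_sqrt // (bigD1 i) //= lerDl.
by apply: sumr_ge0 => j _; exact: sqr_ge0.
Qed.

Lemma is_derive_continuous (V : normedModType R) (z dz : R -> V) :
  (forall t : R, is_derive t 1 z (dz t)) -> continuous z.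
Proof.
move=> dzE t; apply: differentiable_continuous; apply/derivable1_diffP.
by case: (dzE t).
Qed.

(* Gronwall's argument for the squared Euclidean distance of two solutions. *)
Lemma ode_unique_forward (Psi : 'rV[R]_n -> 'rV[R]_n) (z1 z2 : R -> 'rV[R]_n) :
  (forall x, vsmooth Psi x) ->
  (forall t : R, is_derive t 1 z1 (Psi (z1 t))) ->
  (forall t : R, is_derive t 1 z2 (Psi (z2 t))) ->
  z1 0 = z2 0 -> forall t : R, 0 <= t -> z1 t = z2 t.
Proof.
move=> sPsi d1 d2 z0 T T0.
have [K1 K10 K1P] := curve_bounded T0 (is_derive_continuous d1).
have [K2 K20 K2P] := curve_bounded T0 (is_derive_continuous d2).
have [L L0 LP] := vlipschitz_on_ball (addr_ge0 K10 K20) sPsi.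
pose e (t : R) j := z1 t 0 j - z2 t 0 j.
pose D (t : R) := \sum_j e t j * e t j.
pose D1 (t : R) := \sum_j 2 * e t j * (Psi (z1 t) 0 j - Psi (z2 t) 0 j).
have dD (t : R) : is_derive t 1 D (D1 t).
  have dz (z : R -> 'rV[R]_n) j : is_derive t 1 z (Psi (z t)) ->
      is_derive t 1 (fun s => z s 0 j) (Psi (z t) 0 j).
    move=> [dz <-]; rewrite (derive_coord j dz); split => //.
    exact: (derivable_mxP z t 1).1 dz 0 j.
  have S j : is_derive t 1 (fun s => e s j * e s j)
      (2 * e t j * (Psi (z1 t) 0 j - Psi (z2 t) 0 j)).
    have de := is_derive_sub (dz z1 j (d1 t)) (dz z2 j (d2 t)).
    have [dd E] := is_derive_mul de de; split; first exact: dd.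
    by etransitivity; [exact: E|rewrite -/(e t j); ring].
  exact: (@is_derive_big_sum R _ _ (index_enum _) predT _ _ t (1 : R) (fun j _ => S j)).
pose M := 2 * n%:R * L.
have D1M t : 0 <= t <= T -> D1 t <= M * D t.
  move=> tT; have N : `|z1 t - z2 t| ^+ 2 <= D t.
    have -> : D t = \sum_j (z1 t - z2 t) 0 j ^+ 2.
      by apply: eq_bigr => j _; rewrite !mxE expr2.
    exact: sq_norm_le.
  apply: (@le_trans _ _ (\sum_(j < n) 2 * (L * `|z1 t - z2 t| ^+ 2))).
    apply: ler_sum => j _; rewrite -mulrA ler_pM2l //.
    apply: le_trans (ler_norm _) _; rewrite normrM expr2 mulrCA.
    apply: ler_pM => //.
      by have := coord_le_norm (z1 t - z2 t) j; rewrite !mxE.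
    apply: LP; first by apply: le_trans (K1P t tT) _; rewrite lerDl.
    by apply: le_trans (K2P t tT) _; rewrite lerDr.
  rewrite sumr_const card_ord /M.
  have -> : (2 * (L * `|z1 t - z2 t| ^+ 2)) *+ n = 2 * n%:R * L * `|z1 t - z2 t| ^+ 2.
    by rewrite -[LHS]mulr_natl; move: (`|_|) => r; ring.
  by apply: ler_wpM2l => //; rewrite !mulr_ge0.
have dexp (t : R) : is_derive t 1 (fun s : R => expR (- M * s)) (- M * expR (- M * t)).
  have d : is_derive t 1 (fun s : R => - M * s) (- M).
    have := is_derive_mul (is_derive_cst (- M : R) t (1 : R)) (is_derive_id t (1 : R)).
    by rewrite mul0r add0r mulr1.
  have [dd E] := @is_derive1_comp R expR (fun s : R => - M * s) t _ _ (is_derive_expR _) d.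
  by split; [exact: dd|etransitivity; [exact: E|exact: mulrC]].
have dQ (t : R) : is_derive t 1 (fun s => D s * expR (- M * s))
    ((D1 t - M * D t) * expR (- M * t)).
  have [dd E] := is_derive_mul (dD t) (dexp t); split; first exact: dd.
  by etransitivity; [exact: E|ring].
have QT : D T * expR (- M * T) <= D 0 * expR (- M * 0).
  have ddQ (s : R) : derivable (fun s => D s * expR (- M * s)) s 1 by case: (dQ s).
  apply: (@ler0_derive1_le_cc R (fun s => D s * expR (- M * s)) 0 T) => //.
  - move=> s; rewrite in_itv /= => /andP[s0 sT]; rewrite derive1E.
    have [_ ->] := dQ s; apply: mulr_le0_ge0; last exact: expR_ge0.
    by rewrite subr_le0; apply: D1M; rewrite !ltW.
  - by apply: derivable_within_continuous => s _; exact: ddQ.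
  - by rewrite in_itv /= ?lexx ?T0.
  - by rewrite in_itv /= ?lexx ?T0.
have D0 : D 0 = 0 by rewrite /D big1 // => j _; rewrite /e z0 subrr mul0r.
have DT : D T = 0.
  have DT0 : 0 <= D T by apply: sumr_ge0 => j _; rewrite -expr2 sqr_ge0.
  apply/eqP; rewrite eq_le DT0 andbT.
  by move: QT; rewrite D0 mul0r pmulr_lle0 // expR_gt0.
apply/rowP => j; apply/eqP; rewrite -subr_eq0 -sqrf_eq0 expr2; apply/eqP.
by apply: (psumr_eq0P _ DT) => // i _; rewrite -expr2 sqr_ge0.
Qed.

Lemma is_derive_reverse (V : normedModType R) (z : R -> V) (dz : V) (t : R) :
  is_derive (- t) 1 z dz -> is_derive t 1 (fun s => z (- s)) (- dz).
Proof.
move=> [d E].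
have dN : derivable (-%R : R -> R) t 1 by exact: derivable_opp.
have [d2 E2] := is_derive_comp dN ((derivable1_diffP _ _).1 d).
split; first exact: d2.
etransitivity; first exact: E2.
have -> : 'D_1 (-%R : R -> R) t = - 1.
  by have [_ ->] := is_deriveNid t (1 : R).
rewrite -E !deriveE; try exact/derivable1_diffP.
by rewrite linearN.
Qed.

Lemma ode_unique (Psi : 'rV[R]_n -> 'rV[R]_n) (z1 z2 : R -> 'rV[R]_n) :
  (forall x, vsmooth Psi x) ->
  (forall t : R, is_derive t 1 z1 (Psi (z1 t))) ->
  (forall t : R, is_derive t 1 z2 (Psi (z2 t))) ->
  z1 0 = z2 0 -> forall t : R, z1 t = z2 t.
Proof.
move=> sPsi d1 d2 z0 t; have [t0|t0] := leP 0 t; first exact: ode_unique_forward d1 d2 z0 t t0.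
have sN x : vsmooth (fun y => - Psi y) x.
  move=> j; under eq_fun do rewrite mxE; apply: smooth_at_opp; exact: sPsi.
have := @ode_unique_forward (fun y => - Psi y) (fun s => z1 (- s)) (fun s => z2 (- s)) sN
  (fun s => is_derive_reverse (d1 (- s))) (fun s => is_derive_reverse (d2 (- s))).
rewrite oppr0 => /(_ z0 (- t)); rewrite opprK; apply.
by rewrite oppr_ge0 ltW.
Qed.

End OdeUniqueness.

Section Charts.
Context {R : realType}.

Definition good_charts {n} (M : mfd R n) :=
  forall p : M, [/\ open (dom p), dom p p, open (to p @` dom p),
    {in dom p, cancel (to p) (from p)} &
    {within dom p, continuous (to p)} /\ {within to p @` dom p, continuous (from p)}].

Lemma manifold_charts n (M : mfd R n) : is_manifold M -> good_charts M.
Proof. by case=> _ _ h1 h2 _ p; have [a b c d] := h1 p; split. Qed.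

Lemma euclid_charts n : good_charts (@euclid R n).
Proof.
move=> p; have -> : dom p = setT by [].
have -> : to p @` setT = setT.
  by apply/seteqP; split => // x _; exists x.
split; [exact: openT|by []|exact: openT|by []|].
by split; apply: continuous_subspaceT => x; exact: cvg_id.
Qed.

Lemma line_charts : good_charts (line R).
Proof.
move=> p; have -> : dom p = setT by [].
have -> : to p @` setT = setT.
  apply/seteqP; split => // x _; exists (x 0 0) => //.
  by rewrite [RHS]mx11_scalar.
split; [exact: openT|by []|exact: openT| |].
  by move=> x _; rewrite /to /from /= mxE eqxx.
split; apply: continuous_subspaceT => x.
  apply: (@cvg_coord _ _ _ (nbhs_filter x)) => j; rewrite (ord1 j) /to /=.
  under eq_fun do rewrite mxE eqxx mulr1n.
  by rewrite mxE eqxx mulr1n; exact: cvg_id.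
exact: coord_continuous.
Qed.

Section Smoothness.
Context {m n : nat} {M : mfd R m}.
Hypothesis gM : good_charts M.

Lemma near_chart (p a : M) : dom p a ->
  \forall y \near to p a, dom p (from p y) /\ to p (from p y) = y.
Proof.
move=> pa; have [_ _ oT cT _] := gM p.
have : nbhs (to p a) (to p @` dom p) by apply: open_nbhs_nbhs; split => //; exists a.
apply: filterS => _ [b pb <-]; rewrite (cT b) //; exact/mem_set.
Qed.

Lemma from_continuous (p a : M) : dom p a -> from p @ to p a --> a.
Proof.
move=> pa; have [_ _ oT cT [_]] := gM p.
rewrite continuous_open_subspace // => /(_ (to p a)) H.
rewrite -[X in _ --> X](cT a); last exact/mem_set.
by apply: H; apply/mem_set; exists a.
Qed.

Lemma smooth_vsmooth (N : mfd R n) (f : M -> N) (p a : M) (q : N) :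
  open (dom q) -> smooth f -> dom p a -> dom q (f a) ->
  vsmooth (fun y => to q (f (from p y))) (to p a).
Proof.
move=> oq [cf sf] pa qfa j.
have D : \forall y \near to p a, loc_dom f p q y.
  have N1 := near_chart pa.
  have N2 : \forall y \near to p a, dom q (f (from p y)).
    have c : f \o from p @ to p a --> f a.
      by apply: (cvg_comp _ _ (from_continuous pa)); exact: cf.
    by apply: c; exact: open_nbhs_nbhs.
  near=> y; have [py ty] : dom p (from p y) /\ to p (from p y) = y by near: y.
  by exists (from p y) => //; split => //; near: y.
have /nbhs_interior := D; rewrite nbhsE => -[U [oU Ua] UD].
apply: (@smooth_on_at _ _ U) => // k.
have := sf p q j k; rewrite /loc.
elim: k (fun x => to q (f (from p x)) 0 j) => [|k IH] F /=.
  by move=> cF x /set_mem Ux; apply: cF; apply/mem_set; exact: (nbhs_singleton (UD _ Ux)).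
move=> dF i; have [d1 d2] := dF i; split; last exact: IH.
by move=> x Ux; apply: d1; exact: (nbhs_singleton (UD _ Ux)).
Unshelve. all: by end_near. Qed.

End Smoothness.

Lemma is_derive_dir_comp m (V : normedModType R) (f beta : V -> 'rV[R]_m)
    (F : 'rV[R]_m -> R) (x a : V) :
  smooth_at F (f x) -> derivable f x a -> {for x, continuous f} -> derivable beta x a ->
  is_derive x a (fun y => 'D_(beta y) F (f y))
    ('D_('D_a beta x) F (f x) + 'D_('D_a f x) ('D_(beta x) F) (f x)).
Proof.
move=> sF df cf db; have nF := smooth_near_differentiable sF.
have dpF i : is_derive x a (fun y => pder i F (f y)) ('D_('D_a f x) (pder i F) (f x)).
  exact: is_derive_scomp df (smooth_at_pder i sF).
have db' i : is_derive x a (fun y => beta y 0 i) (('D_a beta x) 0 i).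
  rewrite (derive_coord i db).
  exact: (@derivableP _ _ _ _ x a ((derivable_mxP beta x a).1 db 0 i)).
have E1 : 'D_('D_a f x) ('D_(beta x) F) (f x) =
    \sum_i beta x 0 i * 'D_('D_a f x) (pder i F) (f x).
  have N : \forall y \near f x, 'D_(beta x) F y = \sum_i beta x 0 i * pder i F y.
    by apply: filterS nF => y dF; exact: deriveE_pder.
  etransitivity; first exact: (near_eq_derive ('D_a f x) N).
  have S i : is_derive (f x) ('D_a f x) (fun y => beta x 0 i * pder i F y)
      (beta x 0 i * 'D_('D_a f x) (pder i F) (f x)).
    have dp : is_derive (f x) ('D_a f x) (pder i F) ('D_('D_a f x) (pder i F) (f x)).
      by split=> //; exact: (smooth_derivable (smooth_at_pder i sF)).
    have := is_derive_mul (is_derive_cst (beta x 0 i : R) (f x) ('D_a f x)) dp.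
    by rewrite mul0r add0r.
  by case: (@is_derive_big_sum R _ _ (index_enum _) predT _ _ (f x) ('D_a f x) (fun i _ => S i)).
have N : \forall y \near x, (\sum_i (beta y 0 i * pder i F (f y))) = 'D_(beta y) F (f y).
  have nF' : \forall y \near x, differentiable F (f y) by exact: (cf _ nF).
  by apply: filterS nF' => y dF; symmetry; exact: deriveE_pder.
apply: (near_eq_is_derive N).
rewrite E1 (deriveE_pder _ (smooth_differentiable sF)) -big_split /=.
exact: (@is_derive_big_sum R _ _ (index_enum _) predT _ _ x a
  (fun i _ => is_derive_mul (db' i) (dpF i))).
Qed.

Lemma derive2_comp l m (f : 'rV[R]_l -> 'rV[R]_m) (F : 'rV[R]_m -> R) x a b :
  vsmooth f x -> smooth_at F (f x) ->
  'D_a ('D_b (fun y => F (f y))) x =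
  'D_('D_a ('D_b f) x) F (f x) + 'D_('D_a f x) ('D_('D_b f x) F) (f x).
Proof.
move=> sf sF.
have N : \forall y \near x, 'D_b (fun y => F (f y)) y = 'D_('D_b f y) F (f y).
  have nF : \forall y \near x, differentiable F (f y).
    exact: (vsmooth_continuous sf (smooth_near_differentiable sF)).
  have nd := vsmooth_near_derivable sf.
  near=> y; have dF : differentiable F (f y) by near: y; exact: nF.
  have dfy : derivable f y b.
    have H : forall v j, derivable f y v /\ ('D_v f y) 0 j = 'D_v (fun y => f y 0 j) y.
      by near: y; exact: nd.
    apply: derivable_coord => j; have [dd _] := H b j.
    exact: (derivable_mxP f y b).1 dd 0 j.
  by case: (is_derive_comp dfy dF).
etransitivity; first exact: (near_eq_derive a N).
have sb := vsmooth_derive_smooth b sf.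
have := @is_derive_dir_comp _ _ f ('D_b f) F x a sF (vsmooth_derivable sf)
  (vsmooth_continuous sf) (vsmooth_derivable sb).
by case.
Unshelve. all: by end_near. Qed.

End Charts.

(** * The exponential chart at the pole *)

Section GlobalChart.
Context {R : realType} {n : nat} {N : riem R n}.
Hypothesis rN : is_riemannian N.
Variables (E : @euclid R n -> N) (Ei : N -> @euclid R n).
Hypotheses (sE : smooth E) (sEi : smooth Ei) (EK : cancel E Ei) (EiK : cancel Ei E).
Implicit Types (p q a : N) (x u v w : 'rV[R]_n).

Definition phi q : 'rV[R]_n -> 'rV[R]_n := fun x => to q (E x).
Definition psi q : 'rV[R]_n -> 'rV[R]_n := fun y => Ei (from q y).

Lemma gN : good_charts N.
Proof. by case: rN => /manifold_charts. Qed.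

Lemma dom_open q : open (dom q). Proof. by have [] := gN q. Qed.
Lemma dom_base q : dom q q. Proof. by have [] := gN q. Qed.
Lemma toK q a : dom q a -> from q (to q a) = a.
Proof. by move=> qa; have [_ _ _ K _] := gN q; apply: K; exact/mem_set. Qed.

Lemma E_continuous : continuous (E : 'rV[R]_n -> N). Proof. by case: sE. Qed.

Lemma near_dom q x : dom q (E x) -> \forall y \near x, dom q (E y).
Proof.
move=> qx; have nb : nbhs (E x) (dom q).
  by apply: open_nbhs_nbhs; split; [exact: dom_open|exact: qx].
exact: (E_continuous nb).
Qed.

Lemma phi_smooth q x : dom q (E x) -> vsmooth (phi q) x.
Proof.
move=> qx; have := @smooth_vsmooth R n n (@euclid R n) (@euclid_charts R n) N E x x q.
by apply => //; exact: dom_open.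
Qed.

Lemma psi_smooth q a : dom q a -> vsmooth (psi q) (to q a).
Proof.
move=> qa; have := @smooth_vsmooth R n n N gN (@euclid R n) Ei q a (0 : 'rV[R]_n).
by apply => //; exact: openT.
Qed.

Lemma near_psiK q a : dom q a -> \forall y \near to q a, phi q (psi q y) = y.
Proof.
move=> qa; apply: filterS (near_chart gN qa) => y [qy ty].
by rewrite /phi /psi EiK.
Qed.

Lemma near_phiK q x : dom q (E x) -> \forall y \near x, psi q (phi q y) = y.
Proof.
move=> qx; apply: filterS (near_dom qx) => y qy.
by rewrite /phi /psi toK.
Qed.

Lemma near_id_derive m (f : 'rV[R]_m -> 'rV[R]_m) (x v : 'rV[R]_m) :
  (\forall y \near x, f y = y) -> 'D_v f x = v.
Proof. by move=> H; rewrite (near_eq_derive v H) derive_id. Qed.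

Lemma Dpsi_phi q x v : dom q (E x) -> 'D_('D_v (phi q) x) (psi q) (phi q x) = v.
Proof.
move=> qx; have := @near_id_derive n _ x v (near_phiK qx).
have [_ <-] := is_derive_vcomp (vsmooth_derivable (v := v) (phi_smooth qx)) (psi_smooth qx).
by [].
Qed.

Lemma Dphi_psi q x w : dom q (E x) -> 'D_('D_w (psi q) (phi q x)) (phi q) x = w.
Proof.
move=> qx; have := @near_id_derive n _ (phi q x) w (near_psiK qx).
have pE : psi q (phi q x) = x by rewrite /psi /phi toK.
have sp : vsmooth (phi q) (psi q (phi q x)) by rewrite pE; exact: phi_smooth.
have [_] := is_derive_vcomp (vsmooth_derivable (v := w) (psi_smooth qx)) sp.
by rewrite pE => <-.
Qed.

Lemma Dphi_inj q x u v : dom q (E x) -> 'D_u (phi q) x = 'D_v (phi q) x -> u = v.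
Proof. by move=> qx e; rewrite -(Dpsi_phi u qx) e Dpsi_phi. Qed.

Lemma Dphi_linear q x k u v : dom q (E x) ->
  'D_(k *: u + v) (phi q) x = k *: 'D_u (phi q) x + 'D_v (phi q) x.
Proof. by move=> qx; rewrite vsmooth_derive_linear //; exact: phi_smooth. Qed.

Lemma Dphi0 q x : dom q (E x) -> 'D_0 (phi q) x = 0.
Proof. by rewrite derive0. Qed.

Lemma chart_change_smooth p q a : dom p a -> dom q a ->
  vsmooth (fun y => to q (from p y)) (to p a).
Proof.
move=> pa qa; have [_ _ _ _ tr] : is_manifold N by case: rN.
have sid : smooth (@id N) by split=> // x; exact: cvg_id.
exact: (@smooth_vsmooth R n n N gN N id p a q (dom_open q) sid pa qa).
Qed.

Lemma metric_change p q a u v : dom p a -> dom q a ->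
  bf (metric p (to p a)) u v =
  bf (metric q (to q a)) ('D_u (fun y => to q (from p y)) (to p a))
                         ('D_v (fun y => to q (from p y)) (to p a)).
Proof.
move=> pa qa; have [_ _ _ chg] := rN.
have sm := chart_change_smooth pa qa.
have inl : loc_dom (@id N) p q (to p a) by exists a.
have := chg p q (to p a) inl; rewrite (toK pa) => ->.
set J := \matrix_(i, j) _.
have DJ z : 'D_z (fun y => to q (from p y)) (to p a) = z *m J.
  apply/rowP => j; rewrite (vsmooth_derive z j sm).
  rewrite (deriveE_pder _ (smooth_differentiable (sm j))) mxE.
  by apply: eq_bigr => i _; rewrite mxE.
by rewrite !DJ /bf trmx_mul !mulmxA.
Qed.

Definition gE (x : 'rV[R]_n) : 'M[R]_n :=
  jacobian (phi (E x)) x *m metric (E x) (phi (E x) x) *m (jacobian (phi (E x)) x)^T.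

Lemma bf_gE q x u v : dom q (E x) ->
  bf (gE x) u v = bf (metric q (phi q x)) ('D_u (phi q) x) ('D_v (phi q) x).
Proof.
move=> qx; have bx := dom_base (E x); have sp := phi_smooth bx.
have -> : bf (gE x) u v =
    bf (metric (E x) (phi (E x) x)) ('D_u (phi (E x)) x) ('D_v (phi (E x)) x).
  rewrite !deriveEjacobian; try exact: vsmooth_differentiable.
  by rewrite /bf /gE trmx_mul !mulmxA.
rewrite (metric_change _ _ bx qx).
have D z : 'D_('D_z (phi (E x)) x) (fun y => to q (from (E x) y)) (to (E x) (E x))
     = 'D_z (phi q) x.
  have [_ <-] := is_derive_vcomp (vsmooth_derivable (v := z) sp) (chart_change_smooth bx qx).
  apply: near_eq_derive; apply: filterS (near_dom bx) => y bY.
  by rewrite /phi (toK bY).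
by rewrite !D.
Qed.

Lemma metric_atN q a : dom q a -> metric_at (metric q) (to q a).
Proof.
move=> qa; have [_ smet pos _] := rN.
have [_ _ oT _ _] := gN q.
have inT : (to q @` dom q) (to q a) by exists a.
split.
- by move=> i j; exact: (smooth_on_at oT inT (smet q i j)).
- have : nbhs (to q a) (to q @` dom q) by exact: open_nbhs_nbhs.
  by apply: filterS => y /(pos q)[].
- by apply: posdef_unit => v v0; have [_] := pos q _ inT; apply.
Qed.

Lemma metric_posN q a v : dom q a -> v != 0 -> 0 < bf (metric q (to q a)) v v.
Proof.
move=> qa v0; have [_ _ pos _] := rN.
have inT : (to q @` dom q) (to q a) by exists a.
by have [_] := pos q _ inT; apply.
Qed.

Lemma gE_pos x v : v != 0 -> 0 < bf (gE x) v v.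
Proof.
move=> v0; rewrite (bf_gE v v (dom_base (E x))); apply: metric_posN; first exact: dom_base.
apply/negP => /eqP e; move/eqP: v0; apply.
apply: (Dphi_inj (dom_base (E x))); rewrite e; symmetry; exact: Dphi0 (dom_base (E x)).
Qed.

Lemma bf_delta (A : 'M[R]_n) i j : bf A (delta_mx 0 i) (delta_mx 0 j) = A i j.
Proof. by rewrite /bf trmx_delta -rowE -colE !mxE. Qed.

Lemma gE_metric x : metric_at gE x.
Proof.
have bx := dom_base (E x); have sp := phi_smooth bx.
have sy y : (gE y)^T = gE y.
  apply/matrixP => i j; rewrite mxE -!bf_delta !(bf_gE _ _ (dom_base (E y))).
  apply: bfC; exact: (metric_sym (metric_atN (dom_base (E y)))).
split.
- move=> i j; set e := delta_mx 0 i : 'rV[R]_n; set f := delta_mx 0 j : 'rV[R]_n.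
  apply: (@smooth_at_ext _ _ (fun y => bf (metric (E x) (phi (E x) y))
      ('D_e (phi (E x)) y) ('D_f (phi (E x)) y))).
    by apply: filterS (near_dom bx) => y bY; rewrite -(bf_gE _ _ bY) bf_delta.
  apply: smooth_at_bf; try exact: vsmooth_derive_smooth.
  by apply: msmooth_comp => //; have [] := metric_atN bx.
- by near=> y; exact: sy.
- by apply: posdef_unit => v; exact: gE_pos.
Unshelve. all: by end_near. Qed.

Lemma phi_pull q x : dom q (E x) -> pull_at (phi q) gE (metric q) x.
Proof.
move=> qx; split.
- exact: phi_smooth.
- exact: gE_metric.
- exact: metric_atN.
- by apply: filterS (near_dom qx) => y qy u v; exact: bf_gE.
- by move=> w; exists ('D_w (psi q) (phi q x)); exact: Dphi_psi.
Qed.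

Lemma near_phi_pull q x : dom q (E x) -> \forall y \near x, pull_at (phi q) gE (metric q) y.
Proof. by move=> qx; apply: filterS (near_dom qx) => y; exact: phi_pull. Qed.

Section SecondDerivative.
Context {m : nat} {M : mfd R m}.
Hypothesis gM : good_charts M.
Variable f : M -> N.
Hypothesis sf : smooth f.
Variable a : M.

Let X (y : 'rV[R]_m) : 'rV[R]_n := Ei (f (from a y)).
Let x0 := to a a.
Let q := f a.

Lemma chart_baseM : dom a a. Proof. by have [] := gM a. Qed.

Lemma fromK_base : from a x0 = a.
Proof. by have [_ ba _ K _] := gM a; apply: K; exact/mem_set. Qed.

Lemma EX : E (X x0) = q. Proof. by rewrite /X EiK fromK_base. Qed.

Lemma X_smooth : vsmooth X x0.
Proof.
have ba := chart_baseM.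
have s1 := smooth_vsmooth gM (dom_open q) sf ba (dom_base q).
have s2 := psi_smooth (dom_base q).
have s12 := @vsmooth_comp _ _ _ _ (fun y => to q (f (from a y))) (psi q) x0 s1.
apply: (@vsmooth_ext _ _ _ (fun y => psi q (to q (f (from a y))))); last first.
  by apply: s12; rewrite fromK_base.
have c : f \o from a @ x0 --> f a.
  by apply: (cvg_comp _ _ (from_continuous gM ba)); have [cf _] := sf; exact: cf.
have nq : \forall y \near x0, dom q (f (from a y)).
  by apply: c; apply: open_nbhs_nbhs; split; [exact: dom_open|exact: dom_base].
by apply: filterS nq => y qy; rewrite /psi /X (toK qy).
Qed.

Lemma locE j : loc f a q j = (fun y => phi q (X y) 0 j).
Proof. by apply/funext => y; rewrite /phi /X EiK. Qed.

Lemma dom_X : dom q (E (X x0)). Proof. by rewrite EX; exact: dom_base. Qed.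

Lemma row_jac i : row i (jac f a) = 'D_('D_(delta_mx 0 i) X x0) (phi q) (X x0).
Proof.
apply/rowP => j; rewrite !mxE -/q locE /pder.
have sp := phi_smooth dom_X.
rewrite (vsmooth_derive _ _ sp).
by case: (is_derive_scomp (vsmooth_derivable (v := delta_mx 0 i) X_smooth) (sp j)).
Qed.

Lemma cov_secondE i j : cov_second f a i j =
  'D_('D_(delta_mx 0 i) ('D_(delta_mx 0 j) X) x0
      + Chr gE (X x0) ('D_(delta_mx 0 i) X x0) ('D_(delta_mx 0 j) X x0)) (phi q) (X x0).
Proof.
have sp := phi_smooth dom_X; have sX := X_smooth.
have L := vsmooth_derive_linear 1 ('D_(delta_mx 0 i) ('D_(delta_mx 0 j) X) x0)
  (Chr gE (X x0) ('D_(delta_mx 0 i) X x0) ('D_(delta_mx 0 j) X x0)) sp.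
rewrite !scale1r in L; etransitivity; last by symmetry; exact: L.
have C := chr_law ('D_(delta_mx 0 i) X x0) ('D_(delta_mx 0 j) X x0) (phi_pull dom_X).
apply/rowP => c; rewrite mxE -/q -/x0.
have D2 := derive2_comp (delta_mx 0 i) (delta_mx 0 j) sX (sp c).
have E1 : pder i (pder j (loc f a q c)) x0 =
   'D_(delta_mx 0 i) ('D_(delta_mx 0 j) (fun y => phi q (X y) 0 c)) x0 by rewrite locE.
have E2 : \sum_a0 \sum_b christoffel (metric q) (to q q) c a0 b * jac f a i a0 * jac f a j b
   = (Chr (metric q) (phi q (X x0)) ('D_('D_(delta_mx 0 i) X x0) (phi q) (X x0))
         ('D_('D_(delta_mx 0 j) X x0) (phi q) (X x0))) 0 c.
  rewrite mxE bfE -!row_jac /phi EX; apply: eq_bigr => k _; apply: eq_bigr => l _.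
  by rewrite !mxE.
have F1 := vsmooth_derive ('D_(delta_mx 0 i) ('D_(delta_mx 0 j) X) x0) c sp.
have F2 : ('D_('D_(delta_mx 0 i) X x0) ('D_('D_(delta_mx 0 j) X x0) (phi q)) (X x0)) 0 c =
   'D_('D_(delta_mx 0 i) X x0) ('D_('D_(delta_mx 0 j) X x0) (fun z => phi q z 0 c)) (X x0).
  etransitivity; first exact: (vsmooth_derive _ c (vsmooth_derive_smooth _ sp)).
  apply: near_eq_derive; apply: filterS (vsmooth_near_derivable sp) => y.
  by move=> /(_ ('D_(delta_mx 0 j) X x0) c)[].
have aux (s t d p1 p2 e1 e2 l : R) : s = d -> d = e1 + e2 -> t = l -> p1 = e1 -> p2 = e2 ->
  s + t = p1 + (p2 + l) by clear=> -> -> -> -> ->; rewrite addrA.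
have C' := congr1 (fun z : 'rV[R]_n => z 0 c) C; rewrite [RHS]mxE in C'.
rewrite [RHS]mxE C'; exact: aux E1 D2 E2 F1 F2.
Qed.

End SecondDerivative.

End GlobalChart.

Section RowMx.
Context {R : realType}.

Lemma is_derive_row_mx (V : normedModType R) m n (f : V -> 'rV[R]_m) (g : V -> 'rV[R]_n)
    (x v : V) df dg : is_derive x v f df -> is_derive x v g dg ->
  is_derive x v (fun y => row_mx (f y) (g y)) (row_mx df dg).
Proof.
move=> [hf <-] [hg <-].
have H j : is_derive x v (fun y => (row_mx (f y) (g y)) 0 j)
    ((row_mx ('D_v f x) ('D_v g x)) 0 j).
  rewrite mxE; under eq_fun do rewrite mxE.
  case: (fintype.split j) => k.
    rewrite (derive_coord k hf).
    exact: (@derivableP _ _ _ _ x v ((derivable_mxP f x v).1 hf 0 k)).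
  rewrite (derive_coord k hg).
  exact: (@derivableP _ _ _ _ x v ((derivable_mxP g x v).1 hg 0 k)).
have D : derivable (fun y => row_mx (f y) (g y)) x v.
  by apply: derivable_coord => j; case: (H j).
split; first exact: D.
by apply/rowP => j; rewrite (derive_coord j D); case: (H j).
Qed.

Lemma vsmooth_row_mx l m n (f : 'rV[R]_l -> 'rV[R]_m) (g : 'rV[R]_l -> 'rV[R]_n) x :
  vsmooth f x -> vsmooth g x -> vsmooth (fun y => row_mx (f y) (g y)) x.
Proof.
move=> sf sg j; under eq_fun do rewrite mxE.
by case: (fintype.split j) => k; [exact: sf|exact: sg].
Qed.

Lemma vsmooth_lsubmx m n (x : 'rV[R]_(m + n)) :
  vsmooth (fun y : 'rV[R]_(m + n) => lsubmx y : 'rV[R]_m) x.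
Proof. by move=> j; under eq_fun do rewrite mxE; exact: smooth_at_coord. Qed.

Lemma vsmooth_rsubmx m n (x : 'rV[R]_(m + n)) :
  vsmooth (fun y : 'rV[R]_(m + n) => rsubmx y : 'rV[R]_n) x.
Proof. by move=> j; under eq_fun do rewrite mxE; exact: smooth_at_coord. Qed.

Lemma is_derive_scaling (V : normedModType R) (z : R -> V) (dz : V) (k t : R) :
  is_derive (t * k) 1 z dz -> is_derive t 1 (fun s => z (s * k)) (k *: dz).
Proof.
move=> [d E].
have dl : is_derive t 1 (fun s : R => s * k) k.
  have := is_derive_mul (is_derive_id t (1 : R)) (is_derive_cst (k : R) t (1 : R)).
  by rewrite mulr0 addr0 mul1r.
have [dl' El] := dl; have dd := (derivable1_diffP _ _).1 d.
have [d2 E2] := is_derive_comp dl' dd.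
split; first exact: d2.
etransitivity; first exact: E2.
etransitivity; first exact: (congr1 (fun w => 'D_w z (t * k)) El).
etransitivity; last exact: (congr1 (fun w => k *: w) E).
have D1 : 'D_1 z (t * k) = 'd z (t * k) 1 by exact: deriveE.
have Dk : 'D_k z (t * k) = 'd z (t * k) k by exact: deriveE.
have L : 'd z (t * k) (k *: (1 : R)) = k *: 'd z (t * k) 1 by rewrite linearZ.
rewrite D1 Dk -L; congr ('d _ _ _).
by symmetry; exact: mulr1.
Qed.

Lemma is_derive_scalev (V W : normedModType R) (f : V -> W) (k : R) (x v : V) df :
  is_derive x v f df -> is_derive x v (fun y => k *: f y) (k *: df).
Proof.
have -> : (fun y => k *: f y) = k *: f by apply/funext.
exact: is_deriveZ.
Qed.

End RowMx.

Section Curves.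
Context {R : realType} {n : nat} {N : riem R n}.
Hypothesis rN : is_riemannian N.
Variables (E : @euclid R n -> N) (Ei : N -> @euclid R n).
Hypotheses (sE : smooth E) (sEi : smooth Ei) (EK : cancel E Ei) (EiK : cancel Ei E).

Local Notation g := (gE E).
Local Notation e1 := (delta_mx 0 0 : 'rV[R]_1).

Section Curve.
Variable c : line R -> N.
Hypothesis sc : smooth c.

Definition crv (t : R) : 'rV[R]_n := Ei (c t).
Let Xh (y : 'rV[R]_1) : 'rV[R]_n := Ei (c (y 0 0)).
Definition crv1 (t : R) : 'rV[R]_n := 'D_e1 Xh (t *: e1).
Definition crv2 (t : R) : 'rV[R]_n := 'D_e1 ('D_e1 Xh) (t *: e1).

Lemma to_line (t : R) : to (M := line R) t t = t *: e1.
Proof. by apply/matrixP => i j; rewrite !mxE (ord1 i) (ord1 j) eqxx mulr1. Qed.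

Lemma Xh_smooth (t : R) : vsmooth Xh (t *: e1).
Proof.
have := X_smooth rN sEi (@line_charts R) sc t.
by rewrite to_line.
Qed.

Lemma is_derive_crv (t : R) : is_derive t 1 crv (crv1 t).
Proof.
have [d Ed] := is_derive_ray e1 t.
have := is_derive_vcomp d (Xh_smooth t); rewrite Ed.
rewrite (_ : (fun y : R => Xh (y *: e1)) = crv) //.
by apply/funext => s; rewrite /Xh /crv !mxE eqxx mulr1.
Qed.

Lemma is_derive_crv1 (t : R) : is_derive t 1 crv1 (crv2 t).
Proof.
have [d Ed] := is_derive_ray e1 t.
have := is_derive_vcomp d (vsmooth_derive_smooth e1 (Xh_smooth t)).
by rewrite Ed.
Qed.

Lemma dom_crv (t : R) : dom (c t) (E (crv t)).
Proof. by rewrite /crv EiK; exact: dom_base. Qed.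

Lemma velocityE (t : R) : velocity c t = 'D_(crv1 t) (phi E (c t)) (crv t).
Proof.
have := row_jac rN sE sEi EiK (@line_charts R) sc t 0.
rewrite to_line /velocity => ->.
have -> : Ei (c (from (M := line R) t (t *: e1))) = crv t.
  by rewrite /crv /from /= !mxE eqxx mulr1.
by [].
Qed.

Lemma inner_velocity (t : R) :
  inner (c t) (velocity c t) (velocity c t) = bf (g (crv t)) (crv1 t) (crv1 t).
Proof.
rewrite (bf_gE rN sE (crv1 t) (crv1 t) (dom_crv t)) -velocityE.
by rewrite /inner /phi /crv EiK.
Qed.

Lemma geodesic_crv2 (t : R) : cov_second c t ord0 ord0 = 0 ->
  crv2 t = - Chr g (crv t) (crv1 t) (crv1 t).
Proof.
rewrite (cov_secondE rN sE sEi EK EiK (@line_charts R) sc t) to_line.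
have -> : Ei (c (from (M := line R) t (t *: e1))) = crv t.
  by rewrite /crv /from /= !mxE eqxx mulr1.
move=> H; apply/eqP; rewrite -subr_eq0 opprK; apply/eqP.
apply: (Dphi_inj rN sE sEi EK (dom_crv t)).
by etransitivity; [exact: H|symmetry; exact: (Dphi0 (dom_crv t))].
Qed.

End Curve.

Definition geodesic_field (z : 'rV[R]_(n + n)) : 'rV[R]_(n + n) :=
  row_mx (rsubmx z) (- Chr g (lsubmx z) (rsubmx z) (rsubmx z)).

Lemma geodesic_field_smooth z : vsmooth geodesic_field z.
Proof.
apply: vsmooth_row_mx; first exact: vsmooth_rsubmx.
move=> j; under eq_fun do rewrite mxE; apply: smooth_at_opp.
apply: (@Chr_smooth _ _ _ g (fun y => lsubmx y) (fun y => rsubmx y) (fun y => rsubmx y)).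
- exact: vsmooth_lsubmx.
- exact: vsmooth_rsubmx.
- exact: vsmooth_rsubmx.
- exact: (gE_metric rN sE sEi EK).
Qed.

Lemma geodesic_ode (c : line R -> N) : geodesic c -> forall t : R,
  is_derive t 1 (fun s => row_mx (crv c s) (crv1 c s))
    (geodesic_field (row_mx (crv c t) (crv1 c t))).
Proof.
move=> [sc gc] t; rewrite /geodesic_field row_mxKl row_mxKr -(geodesic_crv2 sc (gc t)).
by apply: is_derive_row_mx; [exact: is_derive_crv|exact: is_derive_crv1].
Qed.

Section Exponential.
Variable xo : N.
Hypothesis expE : is_exp xo (E : 'rV[R]_n -> N).

Lemma crv1_at0 (c : line R -> N) v : smooth c -> c (0 : R) = xo -> velocity c 0 = v ->
  crv1 c 0 = 'D_v (psi Ei xo) (to xo xo).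
Proof.
move=> sc c0 vE; have dx := dom_crv c 0; have vE' := velocityE sc 0.
have xE : phi E (c 0) (crv c 0) = to (c 0) (c 0) by rewrite /phi /crv EiK.
have D := Dpsi_phi rN sE sEi EK (crv1 c 0) dx.
rewrite -vE' vE xE in D; symmetry; move: D; by rewrite c0.
Qed.

(* t |-> c_v(k t) and c_(k v) solve the same initial value problem. *)
Lemma exp_ray v : exists c : line R -> N, [/\ geodesic c, c (0 : R) = xo, velocity c 0 = v &
  forall t : R, crv c t = t *: v].
Proof.
have [c [gc c0 vc Ec]] := expE v; exists c; split => // k.
have [d [gd d0 vd Ed]] := expE (k *: v).
have crd : crv d 1 = k *: v by rewrite /crv -Ed EK.
rewrite -crd.
pose z (s : R) := row_mx (crv c (s * k)) (k *: crv1 c (s * k)).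
have dz (t : R) : is_derive t 1 z (geodesic_field (z t)).
  rewrite /geodesic_field row_mxKl row_mxKr; have [sc gc2] := gc.
  apply: is_derive_row_mx; first exact: is_derive_scaling (is_derive_crv sc _).
  have D := is_derive_scalev k (is_derive_scaling (is_derive_crv1 sc (t * k))).
  have G := geodesic_crv2 sc (gc2 (t * k)).
  apply: is_derive_eq D _.
  by rewrite ChrZl ChrZr -!scalerN -G.
have z0 : z 0 = row_mx (crv d 0) (crv1 d 0).
  rewrite /z mul0r /crv c0 d0; congr (row_mx _ _).
  have [sc _] := gc; have [sd _] := gd.
  rewrite (crv1_at0 sc c0 vc) (crv1_at0 sd d0 vd).
  have sp := psi_smooth rN sEi (dom_base rN xo).
  have := vsmooth_derive_linear k v 0 sp.
  by rewrite derive0 !addr0.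
have := ode_unique geodesic_field_smooth dz (geodesic_ode gd) z0 1.
by rewrite /z mul1r => /eq_row_mx[].
Qed.

Lemma exp_ray_crv1 (c : line R -> N) v : smooth c -> (forall t : R, crv c t = t *: v) ->
  (forall t, crv1 c t = v) /\ (forall t, crv2 c t = 0).
Proof.
move=> sc cE.
have c1 (t : R) : crv1 c t = v.
  have [_ A] := is_derive_crv sc t; have [_ B] := is_derive_ray v t.
  rewrite -A; etransitivity; last exact: B.
  exact: (congr1 (fun f : R -> 'rV[R]_n => 'D_1 f t) (funext cE)).
split=> // t; have [_ <-] := is_derive_crv1 sc t.
have -> : crv1 c = fun=> v by apply/funext.
exact: derive_cst.
Qed.

Lemma gE_line v (t : R) : Chr g (t *: v) v v = 0.
Proof.
have [c [gc c0 vc cE]] := exp_ray v; have [sc gc2] := gc.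
have [c1 c2] := exp_ray_crv1 sc cE.
have := geodesic_crv2 sc (gc2 t); rewrite c2 c1 cE.
by move/eqP; rewrite eq_sym oppr_eq0 => /eqP.
Qed.

Lemma exp0 : Ei xo = 0.
Proof.
have [c [_ c0 _ /(_ 0)]] := exp_ray 0.
by rewrite /crv c0 scale0r.
Qed.

End Exponential.
End Curves.

Section CurvatureSymmetry.
Context {R : realType} {n : nat}.
Implicit Types (G : 'rV[R]_n -> 'M[R]_n) (x a b c d : 'rV[R]_n).

Lemma Chr_field_smooth G x b c : metric_at G x -> vsmooth (fun y => Chr G y b c) x.
Proof.
move=> mG.
by apply: (@Chr_smooth _ _ _ G id) => //; [exact: vsmooth_id|exact: vsmooth_cst|exact: vsmooth_cst].
Qed.

(* Second derivatives of y |-> G_y(c, c) commute. *)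
Lemma Rm_skew0 G x a b c : (\forall y \near x, metric_at G y) ->
  bf (G x) (Rm G x a b c) c = 0.
Proof.
move=> nG; have mG := nbhs_singleton nG; have [sG _ _] := mG.
pose k (y : 'rV[R]_n) := bf (G y) c c.
have sk : smooth_at k x.
  by apply: smooth_at_bf => //; exact: vsmooth_cst.
have D e f : 'D_e ('D_f k) x = 2 * (bf (G x) (Chr G x e (Chr G x f c)) c
   + bf (G x) (Chr G x f c) (Chr G x e c)
   + bf (G x) ('D_e (fun y => Chr G y f c) x) c).
  have N1 : \forall y \near x, 'D_f k y = 2 * bf (G y) (Chr G y f c) c.
    apply: filterS nG => y my; have [sy _ _] := my.
    have [_ E1] := is_derive_bf (msmooth_derivable (v := f) sy)
      (@derivable_cst R _ _ c y f) (@derivable_cst R _ _ c y f).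
    rewrite !derive_cst bf0l bf0r !addr0 in E1.
    have C := metric_compat f c c my; have S := bfC c (Chr G y f c) (metric_sym my).
    have aux (p q r s : R) : p = q -> q = r + s -> s = r -> p = 2 * r.
      by clear=> -> -> ->; ring.
    exact: aux E1 C S.
  have dC := Chr_field_smooth f c mG.
  have dB := is_derive_bf (msmooth_derivable (v := e) sG)
      (vsmooth_derivable (v := e) dC) (@derivable_cst R _ _ c x e).
  rewrite derive_cst bf0r addr0 in dB.
  have dB2 := is_derive_mul (is_derive_cst (2 : R) x e) dB.
  have [_ E2] := dB2.
  have C := metric_compat e (Chr G x f c) c mG.
  have E0 := near_eq_derive e N1.
  etransitivity; first exact: E0.
  etransitivity; first exact: E2.
  by rewrite mul0r add0r C.
have S := derive_schwarz a b sk.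
have Da := D a b; have Db := D b a.
have C1 := bfC (Chr G x a c) (Chr G x b c) (metric_sym mG).
have RE : bf (G x) (Rm G x a b c) c =
   bf (G x) ('D_a (fun y => Chr G y b c) x) c - bf (G x) ('D_b (fun y => Chr G y a c) x) c
   + (bf (G x) (Chr G x a (Chr G x b c)) c - bf (G x) (Chr G x b (Chr G x a c)) c).
  have sub4 (p q r s : 'rV[R]_n) : bf (G x) (p - q + (r - s)) c =
      bf (G x) p c - bf (G x) q c + (bf (G x) r c - bf (G x) s c).
    by rewrite !(bfDl, bfNl).
  exact: sub4.
have aux (l p1 p2 q1 q2 r1 r2 m1 m2 : R) : l = p1 - p2 + (q1 - q2) ->
   m1 = 2 * (q1 + r1 + p1) -> m2 = 2 * (q2 + r2 + p2) -> m2 = m1 -> r2 = r1 -> l = 0.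
  by clear=> -> -> -> H E; rewrite E in H; lra.
exact: aux RE Da Db S C1.
Qed.

Lemma Rm_addr G x a b c d : metric_at G x ->
  Rm G x a b (c + d) = Rm G x a b c + Rm G x a b d.
Proof.
move=> mG; rewrite -!(curvatureE _ _ _ mG); apply/rowP => j; rewrite !mxE -big_split /=.
apply: eq_bigr => p _; rewrite -big_split /=; apply: eq_bigr => q _.
by rewrite -big_split /=; apply: eq_bigr => r _; rewrite !mxE mulrDr.
Qed.

Lemma Rm_opp G x a b c : Rm G x a b c = - Rm G x b a c.
Proof. by rewrite /Rm opprD !opprB. Qed.

Lemma Rm_skew G x a b c d : (\forall y \near x, metric_at G y) ->
  bf (G x) (Rm G x a b c) d = - bf (G x) (Rm G x a b d) c.
Proof.
move=> nG; have mG := nbhs_singleton nG.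
have E0 := Rm_skew0 a b (c + d) nG.
have Ec := Rm_skew0 a b c nG; have Ed := Rm_skew0 a b d nG.
have bf4 (p q r s : 'rV[R]_n) : bf (G x) (p + q) (r + s) =
    bf (G x) p r + bf (G x) p s + (bf (G x) q r + bf (G x) q s).
  by rewrite bfDl !bfDr.
have RA := congr1 (fun z => bf (G x) z (c + d)) (Rm_addr a b c d mG).
have aux (z y p q r s : R) : z = 0 -> z = y -> y = p + q + (r + s) -> p = 0 -> s = 0 ->
    q = - r.
  by clear=> -> <- E Ep Es; rewrite Ep Es in E; lra.
exact: aux E0 RA (bf4 _ _ _ _) Ec Ed.
Qed.

Lemma Rm_pair G x v w : (\forall y \near x, metric_at G y) ->
  bf (G x) (Rm G x w v v) w = bf (G x) (Rm G x v w w) v.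
Proof.
move=> nG; etransitivity; first exact: Rm_skew.
have E := congr1 (fun z => bf (G x) z v) (Rm_opp G x w v w).
etransitivity; first exact: (congr1 -%R E).
by rewrite bfNl opprK.
Qed.

End CurvatureSymmetry.

Section IntegralIncrement.
Context {R : realType}.

Lemma increment_le_integral (F f s : R -> R) (a b : R) : a <= b ->
  (forall t : R, is_derive t 1 F (f t)) -> continuous f -> continuous s ->
  (forall t, f t <= s t) ->
  F b - F a <= \int[lebesgue_measure]_(t in `[a, b]) s t.
Proof.
move=> ab dF cf cs fs.
have [ab'|ab'] := eqVneq a b.
  by rewrite -ab' subrr set_itv1 Rintegral_set1.
have altb : a < b by rewrite lt_neqAle ab' ab.
have dd (t : R) : derivable F t 1 by case: (dF t).
have cF : continuous F.
  by move=> t; apply: differentiable_continuous; exact/derivable1_diffP.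
have -> : F b - F a = \int[lebesgue_measure]_(t in `[a, b]) f t.
  rewrite /Rintegral (@continuous_FTC2 R f F a b altb) //.
  - exact: continuous_subspaceT.
  - split.
    + by move=> x _; exact: dd.
    + by apply: cvg_at_right_filter; exact: cF.
    + by apply: cvg_at_left_filter; exact: cF.
  - by move=> x _; rewrite derive1E; case: (dF x).
apply: le_Rintegral => //.
- by apply: continuous_compact_integrable; [exact: segment_compact|exact: continuous_subspaceT].
- by apply: continuous_compact_integrable; [exact: segment_compact|exact: continuous_subspaceT].
Qed.

End IntegralIncrement.

(** * The distance to the pole *)

Lemma sqrt_add_sqr (R : realType) (x e : R) : 0 <= x -> 0 <= e ->
  Num.sqrt (x + e ^+ 2) <= Num.sqrt x + e.
Proof.
move=> x0 e0; have s0 : 0 <= Num.sqrt x by exact: sqrtr_ge0.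
have se0 : 0 <= Num.sqrt x + e by rewrite addr_ge0.
rewrite -[leRHS](ger0_norm se0) -sqrtr_sqr ler_wsqrtr // sqrrD sqr_sqrtr //.
by rewrite addrAC lerDl mulrn_wge0 // mulr_ge0.
Qed.

Section Pole.
Context {R : realType} {n : nat} {N : riem R n}.
Hypothesis rN : is_riemannian N.
Variables (E : @euclid R n -> N) (Ei : N -> @euclid R n).
Hypotheses (sE : smooth E) (sEi : smooth Ei) (EK : cancel E Ei) (EiK : cancel Ei E).
Variable xo : N.
Hypothesis expE : is_exp xo (E : 'rV[R]_n -> N).

Local Notation g := (gE E).
Let mg := gE_metric rN sE sEi EK.
Let pg := gE_pos rN sE sEi EK.
Let lineg := gE_line rN sE sEi EK EiK expE.

Lemma gE_psd (x v : 'rV[R]_n) : 0 <= bf (g x) v v.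
Proof. by have [->|/(pg x)/ltW//] := eqVneq v 0; rewrite bf0l. Qed.

Definition radius (m : N) : R := Num.sqrt (bf (g 0) (Ei m) (Ei m)).

(* The regularized distance sqrt(P + e^2), P = radius^2, is smooth along the
   path and, by the Gauss lemma, its derivative is at most the speed. *)
Lemma radius_path (c : line R -> N) (a b : R) : smooth c -> a <= b ->
  radius (c b) - radius (c a) <= arc_length c a b.
Proof.
move=> sc ab; rewrite lerBlDr.
apply/ler_addgt0Pr => e e0.
pose P (t : R) := bf (g 0) (crv Ei c t) (crv Ei c t) + e ^+ 2.
pose S (t : R) := bf (g 0) (crv Ei c t) (crv1 Ei c t).
have g0sym := metric_sym (mg 0).
have dX (t : R) := is_derive_crv rN sEi sc t.
have dV (t : R) := is_derive_crv1 rN sEi sc t.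
have dP (t : R) : is_derive t 1 P (2 * S t).
  have [dx Ex] := dX t.
  have := is_derive_bf (@derivable_cst R _ _ (g 0) t 1) dx dx.
  rewrite derive_cst Ex (_ : bf 0 _ _ = 0); last by rewrite /bf mulmx0 mul0mx mxE.
  rewrite add0r (bfC (crv1 Ei c t) _ g0sym) -mulr2n => H.
  have [d EP] := is_derive_add H (is_derive_cst (e ^+ 2 : R) t (1 : R)).
  split; [exact: d|etransitivity; first exact: EP].
  by rewrite addr0 -[LHS]mulr_natl.
have P0 (t : R) : 0 < P t.
  by rewrite /P ltr_wpDl ?exprn_gt0 //; exact: gE_psd.
have dF (t : R) := is_derive_sqrt_comp (dP t) (P0 t).
have cP : continuous P by exact: is_derive_continuous dP.
have cS : continuous S.
  have dS (t : R) : derivable S t 1.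
    have [dx _] := dX t; have [dv _] := dV t.
    by case: (is_derive_bf (@derivable_cst R _ _ (g 0) t 1) dx dv).
  by move=> t; apply: differentiable_continuous; exact/derivable1_diffP.
have csp : continuous (speed c).
  have dQ (t : R) : derivable (fun s => bf (g (crv Ei c s)) (crv1 Ei c s) (crv1 Ei c s)) t 1.
    have [dx _] := dX t; have [dv _] := dV t; have [sg _ _] := mg (crv Ei c t).
    have [dG _] := is_derive_mcomp dx sg.
    by case: (is_derive_bf dG dv dv).
  have -> : speed c = fun t => Num.sqrt (bf (g (crv Ei c t)) (crv1 Ei c t) (crv1 Ei c t)).
    by apply/funext => t; rewrite /speed (inner_velocity rN sE sEi EiK sc t).
  move=> t; apply: (@continuous_comp _ _ _
    (fun s => bf (g (crv Ei c s)) (crv1 Ei c s) (crv1 Ei c s)) (@Num.sqrt R));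
    last exact: sqrt_continuous.
  by apply: differentiable_continuous; exact/derivable1_diffP.
have cF (t : R) : {for t, continuous (fun s => Num.sqrt (P s))}.
  by apply: (@continuous_comp _ _ _ P (@Num.sqrt R)); [exact: cP|exact: sqrt_continuous].
have F0 (t : R) : 0 < Num.sqrt (P t) by rewrite sqrtr_gt0.
have cf : continuous (fun t => (2 * Num.sqrt (P t))^-1 * (2 * S t)).
  move=> t.
  have c1 : {for t, continuous (fun s => 2 * Num.sqrt (P s))}.
    exact: (@continuous_at_mul R _ (fun=> 2) (fun s => Num.sqrt (P s)) t
      (@cst_continuous _ _ (2 : R) t) (cF t)).
  have c2 : {for t, continuous (fun s => 2 * S s)}.
    exact: (@continuous_at_mul R _ (fun=> 2) S t (@cst_continuous _ _ (2 : R) t) (cS t)).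
  have n0 : 2 * Num.sqrt (P t) != 0 by rewrite mulf_neq0 // gt_eqF.
  have c3 := @continuous_at_inv R _ (fun s => 2 * Num.sqrt (P s)) t n0 c1.
  exact: (@continuous_at_mul R _ (fun s => (2 * Num.sqrt (P s))^-1) (fun s => 2 * S s) t c3 c2).
have fs (t : R) : (2 * Num.sqrt (P t))^-1 * (2 * S t) <= speed c t.
  have hq (p q : R) : q != 0 -> (2 * q)^-1 * (2 * p) = p / q.
    by move=> q0; rewrite invfM mulrAC mulrA mulVf // mul1r mulrC.
  rewrite hq ?gt_eqF //.
  rewrite ler_pdivrMr //; apply: le_trans (ler_norm _) _.
  have SE : S t = bf (g (crv Ei c t)) (crv Ei c t) (crv1 Ei c t).
    by symmetry; exact: gauss mg lineg _ _.
  have CS := cauchy_schwarz (crv Ei c t) (crv1 Ei c t) (metric_sym (mg (crv Ei c t))) (pg (crv Ei c t)).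
  rewrite -sqrtr_sqr SE /speed (inner_velocity rN sE sEi EiK sc t).
  rewrite -sqrtrM; last exact: gE_psd.
  apply: ler_wsqrtr; apply: le_trans CS _; rewrite mulrC; apply: ler_wpM2l; first exact: gE_psd.
  by rewrite (norm_radial mg lineg) /P lerDl sqr_ge0.
have H := increment_le_integral ab dF cf csp fs.
have A1 : radius (c b) <= Num.sqrt (P b).
  by apply: ler_wsqrtr; rewrite lerDl sqr_ge0.
have A2 : Num.sqrt (P a) <= radius (c a) + e.
  by apply: sqrt_add_sqr; [exact: gE_psd|exact: ltW].
rewrite lerBlDr in H; apply: le_trans A1 _; apply: le_trans H _.
by rewrite -addrA lerD2l.
Qed.

Lemma radius_joined (x y : N) (l : R) : joined_by x y l -> radius y - radius x <= l.
Proof.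
elim=> [z|c a b z k sc ab _ IH]; first by rewrite subrr.
have H := lerD (radius_path sc ab) IH; apply: le_trans H.
by rewrite [leRHS]addrC subrKA.
Qed.

Lemma radius_pole : radius xo = 0.
Proof. by rewrite /radius (exp0 rN sE sEi EK EiK expE) bf0l sqrtr0. Qed.

Lemma radial_path (m : N) : joined_by xo m (radius m + 0).
Proof.
have [c [[sc gc] c0 vc cE]] := exp_ray rN sE sEi EK EiK expE (Ei m).
have [c1 _] := exp_ray_crv1 rN sEi sc cE.
have cm : c (1 : R) = m.
  by have := cE 1; rewrite /crv scale1r => /(can_inj EiK).
have -> : radius m = arc_length c 0 1.
  rewrite /arc_length.
  have -> : speed c = fun=> radius m.
    apply/funext => t; rewrite /speed (inner_velocity rN sE sEi EiK sc t).
    by rewrite c1 cE (speed_const mg lineg).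
  have M : (@lebesgue_measure R) `[(0 : R), 1]%classic = 1%:E.
    by rewrite lebesgue_measure_itv /= lte_fin ltr01 oppr0 adde0.
  by rewrite Rintegral_cst // (congr1 fine M) mulr1.
rewrite -{1}c0; apply: joined_cons => //.
by rewrite cm; exact: joined_nil.
Qed.

Lemma rdist_radius (m : N) : rdist xo m = radius m.
Proof.
have lb : lbound [set l | joined_by xo m l] (radius m).
  by move=> l /radius_joined; rewrite radius_pole subr0.
have ne : [set l | joined_by xo m l] (radius m + 0) by exact: radial_path.
apply/eqP; rewrite eq_le; apply/andP; split.
  rewrite -[leRHS]addr0; apply: ge_inf => //; by exists (radius m).
by apply: lb_le_inf => //; exists (radius m + 0).
Qed.

Section Comparison.
Variable kappa : R.
Hypothesis kappa_gt0 : 0 < kappa.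
Hypothesis Ncurv : radial_sectional_le xo (- kappa ^+ 2).

Lemma gE_near_metric (x : 'rV[R]_n) : \forall y \near x, metric_at g y.
Proof. by near=> y; exact: mg. Unshelve. all: by end_near. Qed.

Lemma gE_curv (v w : 'rV[R]_n) (t : R) : 0 <= t -> v != 0 -> w != 0 ->
  bf (g (t *: v)) v w = 0 ->
  bf (g (t *: v)) (Rm g (t *: v) w v v) w
    <= - kappa ^+ 2 * (bf (g (t *: v)) v v * bf (g (t *: v)) w w).
Proof.
move=> t0 v0 w0 vw.
have [c [gc c0 vc cE]] := exp_ray rN sE sEi EK EiK expE v.
have [sc _] := gc; have [c1 _] := exp_ray_crv1 rN sEi sc cE.
have dx := dom_crv rN EiK c t; have vE := velocityE rN sE sEi EiK sc t.
rewrite c1 cE in vE; rewrite cE in dx.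
set x := t *: v in vE dx vw *; set q := c t in vE dx *.
have xE : phi E q x = to q q by rewrite /phi /x -cE /crv EiK.
pose w' := 'D_w (phi E q) x; pose v' := 'D_v (phi E q) x.
have rf : row_free (col_mx (velocity c t) w').
  rewrite vE -kermx_eq0; apply/rowV0P => u /sub_kermxP.
  rewrite -[u]hsubmxK mul_row_col.
  have su (k : 'M[R]_1) (z : 'rV[R]_n) : k *m z = k 0 0 *: z.
    by rewrite {1}[k]mx11_scalar mul_scalar_mx.
  rewrite !su; set al := lsubmx u 0 0; set be := rsubmx u 0 0 => H.
  have L := Dphi_linear rN sE al v (be *: w) dx.
  have L2 := Dphi_linear rN sE be w 0 dx.
  rewrite !addr0 (Dphi0 dx) addr0 in L2.
  rewrite L2 in L.
  have z0 : al *: v + be *: w = 0.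
    apply: (Dphi_inj rN sE sEi EK dx); etransitivity; first exact: L.
    by etransitivity; [exact: H|symmetry; exact: (Dphi0 dx)].
  have be0 : be = 0.
    have := congr1 (fun z => bf (g x) z w) z0.
    rewrite bfDl !bfZl vw mulr0 add0r bf0l => /eqP.
    by rewrite mulf_eq0 (gt_eqF (pg x w0)) orbF => /eqP.
  have al0 : al = 0.
    move: z0; rewrite be0 scale0r addr0 => /eqP.
    by rewrite scaler_eq0 (negbTE v0) orbF => /eqP.
  rewrite [lsubmx u]mx11_scalar [rsubmx u]mx11_scalar -/al -/be al0 be0.
  by rewrite !raddf0 row_mx0.
have := Ncurv gc c0 t0 rf.
have cur : curvature q (velocity c t) w' w' = 'D_(Rm g x v w w) (phi E q) x.
  etransitivity; first exact: (curvatureE _ _ _ (metric_atN rN (dom_base rN q))).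
  rewrite vE -xE; symmetry.
  exact: (curvature_law _ _ _ (near_phi_pull rN sE sEi EK EiK dx)).
have inE (a b : 'rV[R]_n) : inner q ('D_a (phi E q) x) ('D_b (phi E q) x) = bf (g x) a b.
  by rewrite (bf_gE rN sE a b dx) xE.
have numE : inner q (curvature q (velocity c t) w' w') (velocity c t)
    = bf (g x) (Rm g x w v v) w.
  rewrite cur vE; etransitivity; first exact: inE.
  by symmetry; exact: (Rm_pair v w (gE_near_metric x)).
have uu : inner q (velocity c t) (velocity c t) = bf (g x) v v by rewrite vE; exact: inE.
have ww : inner q w' w' = bf (g x) w w by exact: inE.
have uw : inner q (velocity c t) w' = 0 by rewrite vE -vw; exact: inE.
rewrite /sectional numE uu ww uw expr0n subr0.
by rewrite ler_pdivrMr // mulr_gt0 // pg.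
Qed.

Lemma hess_lower (x w : 'rV[R]_n) (r : R) : 0 < r -> bf (g 0) x x = r ^+ 2 ->
  bf (g x) x w = 0 ->
  kappa * r * (expR (kappa * r) + (expR (kappa * r))^-1) * bf (g x) w w
    <= hess g x w * (expR (kappa * r) - (expR (kappa * r))^-1).
Proof.
move=> r0 rE xw.
have [->|w0] := eqVneq w 0; first by rewrite /hess !bf0l !(mulr0, addr0, mul0r).
have rn0 : r != 0 by rewrite gt_eqF.
have x0 : x != 0.
  by apply/negP => /eqP x0; move/eqP: rE; rewrite x0 bf0l eq_sym expf_eq0 (negbTE rn0) andbF.
pose v := r^-1 *: x.
have rv : r *: v = x by rewrite scalerA divff // scale1r.
have v0 : v != 0 by rewrite scaler_eq0 invr_eq0 negb_or rn0.
have vv : bf (g 0) v v = 1.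
  by rewrite bfZl bfZr rE expr2 mulKf // mulVf.
have vw0 : bf (g 0) v w = 0.
  by rewrite bfZl -(gauss mg lineg) xw mulr0.
have vw t : bf (g (t *: v)) v w = 0.
  have [->|t0] := eqVneq t 0; first by rewrite scale0r.
  have G := gauss mg lineg (t *: v) w.
  have Z : bf (g 0) (t *: v) w = 0 by rewrite bfZl vw0 mulr0.
  have := etrans (esym (bfZl (g (t *: v)) t v w)) (etrans G Z).
  by move=> /eqP; rewrite mulf_eq0 (negbTE t0) => /eqP.
have cv t : 0 <= t -> bf (g (t *: v)) (Rm g (t *: v) w v v) w
    <= - kappa ^+ 2 * bf (g (t *: v)) w w.
  move=> t0; have C := gE_curv t0 v0 w0 (vw t).
  have S := etrans (speed_const mg lineg v t) vv.
  have aux (l k p q : R) : l <= k * (p * q) -> p = 1 -> l <= k * q.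
    by move=> + p1; rewrite p1 mul1r.
  exact: aux C S.
have H := hess_comparison mg pg lineg kappa_gt0 w0 cv (ltW r0).
by rewrite rv in H.
Qed.

End Comparison.
End Pole.

Section Orthonormal.
Context {R : realType}.

Lemma orthonormal_rows n (A : 'M[R]_n) k : A^T = A ->
  (forall v : 'rV[R]_n, v != 0 -> 0 < bf A v v) -> (k <= n)%N ->
  exists Q : 'M[R]_(k, n), Q *m A *m Q^T = 1%:M.
Proof.
move=> sA pA; elim: k => [|k IH] kn.
  by exists 0; rewrite [LHS]flatmx0 [RHS]flatmx0.
have [Q QA] := IH (ltnW kn).
have [v v0 vQ] : exists2 v : 'rV[R]_n, v != 0 & v *m (A *m Q^T) = 0.
  have : kermx (A *m Q^T) != 0.
    rewrite -mxrank_eq0 mxrank_ker subn_eq0 -ltnNge.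
    by apply: leq_ltn_trans kn; exact: rank_leq_col.
  by case/rowV0Pn => v /sub_kermxP vQ v0; exists v.
have q0 := pA v v0; have s0 : 0 < Num.sqrt (bf A v v) by rewrite sqrtr_gt0.
pose u := (Num.sqrt (bf A v v))^-1 *: v.
have uQ : u *m A *m Q^T = 0 by rewrite -!scalemxAl -mulmxA vQ scaler0.
have uu : u *m A *m u^T = 1%:M.
  rewrite [LHS]mx11_scalar -/(bf A u u) /u bfZl bfZr.
  rewrite -{3}[bf A v v]sqr_sqrtr ?ltW // expr2 mulKf ?gt_eqF // mulVf ?gt_eqF //.
have Qu : Q *m A *m u^T = 0.
  by apply: trmx_inj; rewrite !trmx_mul trmxK sA trmx0 mulmxA.
have H : col_mx u Q *m A *m (col_mx u Q)^T = 1%:M.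
  by rewrite tr_col_mx mul_col_mx mul_col_row uu uQ Qu QA -scalar_mx_block.
by exists (col_mx u Q).
Qed.

End Orthonormal.

Section MaximumTest.
Context {R : realType} {n : nat}.

Lemma derive_at_max (F : 'rV[R]_n -> R) (x v : 'rV[R]_n) : smooth_at F x ->
  (forall y, F y <= F x) -> 'D_v F x = 0.
Proof.
move=> sF mx; have nD := smooth_near_differentiable sF.
have cl : (fun s : R => x + s *: v) @ (0 : R) --> x + (0 : R) *: v.
  by apply: cvgD; [exact: cvg_cst|exact: scalel_continuous].
have H : nbhs (x + (0 : R) *: v) [set y | differentiable F y].
  by rewrite scale0r addr0; exact: nD.
have /nbhs_ballP[r /= r0 rP] : nbhs (0 : R) [set s | differentiable F (x + s *: v)].
  exact: (cl _ H).
have dl (s : R) : s \in `]- r, r[%R -> derivable (fun s : R => F (x + s *: v)) s 1.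
  rewrite in_itv /= => /andP[s1 s2].
  have d : differentiable F (x + s *: v).
    by apply: rP; rewrite /ball /= sub0r normrN ltr_norml s1.
  by case: (is_derive_line (@diff_derivable _ _ _ _ _ v d)).
have d0 : derivable F (x + 0 *: v) v.
  by rewrite scale0r addr0; exact: (smooth_derivable sF).
have [_ E1] := is_derive_line d0.
have [_ E2] : is_derive (0 : R) 1 (fun s : R => F (x + s *: v)) 0.
  apply: (@derive1_at_max R _ (- r) r 0) => //.
  - by rewrite ge0_cp // ltW.
  - by rewrite in_itv /= oppr_lt0 r0.
  - by move=> s _; rewrite scale0r addr0.
by rewrite E2 scale0r addr0 in E1.
Qed.

Lemma derive2_at_max (F : 'rV[R]_n -> R) (x v : 'rV[R]_n) : smooth_at F x ->
  (forall y, F y <= F x) -> 'D_v ('D_v F) x <= 0.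
Proof.
move=> sF mx; apply/ler_addgt0Pr => e e0; rewrite add0r.
have N1 := @second_difference R n F x (- v) v sF e e0.
have N0 := @nbhs_right_gt R 0.
have [s [s0 H]] := filter_ex (filterI N0 N1).
have s2 : 0 < s ^+ 2 by rewrite exprn_gt0.
have DE : 'D_v ('D_(- v) F) x = - 'D_v ('D_v F) x.
  have nD := smooth_near_differentiable sF.
  have N : \forall y \near x, 'D_(- v) F y = - 'D_v F y.
    by apply: filterS nD => y dy; rewrite !deriveE // linearN.
  etransitivity; first exact: (near_eq_derive v N).
  apply: deriveN; exact: (smooth_derivable (smooth_at_derive v sF)).
rewrite DE in H.
have E : x + s *: - v + s *: v = x by rewrite scalerN subrK.
rewrite E in H.
have := mx (x + s *: - v); have := mx (x + s *: v).
move: H; move: (F _) (F _) (F _) ('D_v _ x) => a b c d.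
rewrite ler_norml => /andP[_ H] h1 h2.
rewrite -(ler_pM2l s2); rewrite mulrN opprK mulrC in H.
rewrite mulrC [leRHS]mulrC; apply: le_trans H.
by rewrite lerDr -addrA [- _ + _]addrC addr_ge0 // subr_ge0.
Qed.

End MaximumTest.

Section BlockMetric.
Context {R : realType} {m n : nat}.
Variable G : 'rV[R]_m -> 'M[R]_m.
Let B (x : 'rV[R]_(m + n)) : 'M[R]_(m + n) := block_mx (G (lsubmx x)) 0 0 1%:M.

Lemma bf_block (A : 'M[R]_m) (u v : 'rV[R]_(m + n)) :
  bf (block_mx A 0 0 1%:M) u v = bf A (lsubmx u) (lsubmx v) + bf 1%:M (rsubmx u) (rsubmx v).
Proof.
rewrite /bf -{1}[u]hsubmxK -{1}[v]hsubmxK tr_row_mx mul_row_block !mulmx0 addr0 add0r.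
by rewrite mul_row_col mxE.
Qed.

Lemma bf1_psd (u : 'rV[R]_n) : u != 0 -> 0 < bf 1%:M u u.
Proof.
move=> u0; rewrite /bf mulmx1 mxE lt_neqAle sumr_ge0 ?andbT; last first.
  by move=> i _; rewrite mxE -expr2 sqr_ge0.
apply: contra u0; rewrite eq_sym psumr_eq0; last by move=> i _; rewrite mxE -expr2 sqr_ge0.
move=> /allP H; apply/eqP/rowP => i; rewrite mxE.
have := H i (mem_index_enum _); rewrite /= mxE -expr2 sqrf_eq0 => /eqP.
by [].
Qed.

Lemma block_posdef (A : 'M[R]_m) : (forall v, v != 0 -> 0 < bf A v v) ->
  forall v : 'rV[R]_(m + n), v != 0 -> 0 < bf (block_mx A 0 0 1%:M) v v.
Proof.
move=> pA v v0; rewrite bf_block.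
have [l0|l0] := eqVneq (lsubmx v) 0; last first.
  apply: ltr_pwDl; first exact: pA.
  by have [->|/bf1_psd/ltW//] := eqVneq (rsubmx v) 0; rewrite bf0l.
rewrite l0 bf0l add0r; apply: bf1_psd; apply: contra v0 => /eqP r0.
by rewrite -[v]hsubmxK l0 r0 row_mx0.
Qed.

Lemma block_metric (z : 'rV[R]_(m + n)) : metric_at G (lsubmx z) ->
  (forall v, v != 0 -> 0 < bf (G (lsubmx z)) v v) -> metric_at B z.
Proof.
move=> [sG nG _] pG; split.
- move=> i j; rewrite /B; under eq_fun do rewrite mxE.
  case: (fintype.split i) => k; under eq_fun do rewrite mxE;
    case: (fintype.split j) => l.
  + exact: (smooth_at_comp (@vsmooth_lsubmx R m n z) (sG k l)).
  + by under eq_fun do rewrite mxE; exact: smooth_at_cst.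
  + by under eq_fun do rewrite mxE; exact: smooth_at_cst.
  + exact: smooth_at_cst.
- have N : \forall y \near z, (G (lsubmx y))^T = G (lsubmx y).
    exact: (vsmooth_continuous (@vsmooth_lsubmx R m n z) nG).
  by apply: filterS N => y sy; rewrite /B tr_block_mx sy !trmx0 trmx1.
- by apply: posdef_unit; exact: block_posdef.
Qed.

Lemma Chr_block (z u v : 'rV[R]_(m + n)) : metric_at G (lsubmx z) ->
  (forall v, v != 0 -> 0 < bf (G (lsubmx z)) v v) ->
  Chr B z u v = row_mx (Chr G (lsubmx z) (lsubmx u) (lsubmx v)) 0.
Proof.
move=> mG pG; have mB := block_metric mG pG; have [sB _ uB] := mB.
have [sG _ _] := mG.
have D a b c : bf ('D_a B z) b c =
    bf ('D_(lsubmx a) G (lsubmx z)) (lsubmx b) (lsubmx c).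
  have [_ E1] := is_derive_bf (msmooth_derivable (v := a) sB)
    (@derivable_cst R _ _ b z a) (@derivable_cst R _ _ c z a).
  rewrite !derive_cst bf0l bf0r !addr0 in E1.
  have sl := @vsmooth_lsubmx R m n z.
  have El : 'D_a (fun y : 'rV[R]_(m + n) => lsubmx y : 'rV[R]_m) z = lsubmx a.
    apply/rowP => j; rewrite (vsmooth_derive a j sl) mxE.
    under eq_fun do rewrite mxE.
    rewrite -(derive_coord (lshift n j) (@derivable_id R _ z a)).
    by rewrite derive_id.
  have [dG EG] := is_derive_mcomp (vsmooth_derivable (v := a) sl) sG.
  rewrite El in EG.
  have [_ E2] := is_derive_bf dG (@derivable_cst R _ _ (lsubmx b : 'rV[R]_m) z a)
     (@derivable_cst R _ _ (lsubmx c : 'rV[R]_m) z a).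
  rewrite !derive_cst bf0l bf0r !addr0 EG in E2.
  rewrite -E2; etransitivity; first by symmetry; exact: E1.
  have -> : (fun y => bf (B y) (cst b y) (cst c y)) =
     (fun y => bf (G (lsubmx y)) (lsubmx b) (lsubmx c) + bf 1%:M (rsubmx b) (rsubmx c)).
    by apply/funext => y; exact: bf_block.
  have d3 := is_derive_bf dG (@derivable_cst R _ _ (lsubmx b : 'rV[R]_m) z a)
     (@derivable_cst R _ _ (lsubmx c : 'rV[R]_m) z a).
  have [_ E3] := is_derive_add d3 (is_derive_cst (bf 1%:M (rsubmx b) (rsubmx c) : R) z a).
  have [_ E4] := d3; rewrite addr0 -E4 in E3; exact: E3.
apply: (bf_inj uB) => w.
rewrite (koszul u v w mB) [RHS]bf_block row_mxKl row_mxKr bf0l addr0.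
rewrite (koszul (lsubmx u) (lsubmx v) (lsubmx w) mG).
have D1 := D u v w; have D2 := D v u w; have D3 := D w u v.
have aux (p q r p' q' r' : R) : p = p' -> q = q' -> r = r' ->
  2^-1 * (p + q - r) = 2^-1 * (p' + q' - r') by move=> -> -> ->.
exact: aux D1 D2 D3.
Qed.

End BlockMetric.

(** * Hypersurfaces of the product with a line *)

Section ProductMap.
Context {R : realType} {n : nat} {N : riem R n} {M : mfd R n}.
Hypothesis rN : is_riemannian N.
Variable f : M -> prod_riem N (line R).
Hypothesis sf : smooth f.

Definition proj1 (m : M) : N := (f m).1.
Definition proj2 (m : M) : line R := (f m).2.

Lemma loc_proj1 p (q : prod_riem N (line R)) j : loc f p q (lshift 1 j) = loc proj1 p q.1 j.
Proof. by apply/funext => x; rewrite /loc /to /= row_mxEl. Qed.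

Lemma proj1_smooth : smooth proj1.
Proof.
have [cf s] := sf; split.
  by move=> x; apply: (@continuous_comp _ _ _ f fst); [exact: cf|exact: cvg_fst].
move=> p q j; have := s p (q, 0 : R) (lshift 1 j).
rewrite loc_proj1.
have -> : loc_dom f p (q, 0 : R) = loc_dom proj1 p q.
  apply/seteqP; split => x [y [py qy] <-]; exists y => //; split => //.
    by case: qy.
by [].
Qed.

Lemma jac_prod a : jac f a = row_mx (jac proj1 a) (jac proj2 a).
Proof.
apply/matrixP => i j; rewrite [LHS]mxE [RHS]mxE; case: splitP => k jk.
  have -> : j = lshift 1 k by apply: val_inj.
  by rewrite loc_proj1 [RHS]mxE.
have -> : j = rshift n k by apply: val_inj.
rewrite [RHS]mxE; congr (pder i _ _); apply/funext => x.
by rewrite /loc /to /= row_mxEr.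
Qed.

Lemma inner_prod (p : prod_riem N (line R)) u v :
  inner p u v = bf (metric p.1 (to p.1 p.1)) (lsubmx u) (lsubmx v)
    + bf 1%:M (rsubmx u) (rsubmx v).
Proof.
rewrite -bf_block; congr (bf _ _ _).
by rewrite /metric /= row_mxKl.
Qed.

Lemma cov_second_proj1 a i j : lsubmx (cov_second f a i j) = cov_second proj1 a i j.
Proof.
set q := f a; pose z : 'rV[R]_(n + 1) := to q q.
pose q1 : N := proj1 a.
have zl : lsubmx z = to q1 q1 by rewrite /z /to /= row_mxKl.
have mG : metric_at (metric q1) (lsubmx z).
  by rewrite zl; exact: (metric_atN rN (dom_base rN q1)).
have pG v : v != 0 -> 0 < bf (metric q1 (lsubmx z)) v v.
  by rewrite zl; exact: (metric_posN rN (dom_base rN q1)).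
have C := @Chr_block R n 1 (metric q1) z (row i (jac f a)) (row j (jac f a)) mG pG.
apply/rowP => c; rewrite [LHS]mxE [LHS]mxE [RHS]mxE -/q loc_proj1; congr (_ + _).
have E1 : \sum_a0 \sum_b christoffel (metric q) z (lshift 1 c) a0 b * jac f a i a0 * jac f a j b
   = (Chr (metric q) z (row i (jac f a)) (row j (jac f a))) 0 (lshift 1 c).
  rewrite mxE bfE; apply: eq_bigr => k _; apply: eq_bigr => l _.
  by rewrite !mxE.
have E2 : \sum_a0 \sum_b christoffel (metric q1) (to q1 q1) c a0 b
     * jac proj1 a i a0 * jac proj1 a j b
   = (Chr (metric q1) (to q1 q1) (row i (jac proj1 a)) (row j (jac proj1 a))) 0 c.
  rewrite mxE bfE; apply: eq_bigr => k _; apply: eq_bigr => l _.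
  by rewrite !mxE.
have jl k : lsubmx (row k (jac f a)) = row k (jac proj1 a).
  by rewrite jac_prod row_row_mx row_mxKl.
etransitivity; first exact: E1.
etransitivity; last by symmetry; exact: E2.
rewrite !jl zl in C.
etransitivity; first exact: (congr1 (fun w : 'rV[R]_(n + 1) => w 0 (lshift 1 c)) C).
by rewrite row_mxEl.
Qed.

End ProductMap.

Lemma linear_sum_basis (R : realType) m n (L : 'rV[R]_m -> 'rV[R]_n) :
  (forall k u v, L (k *: u + v) = k *: L u + L v) ->
  forall v, L v = \sum_i v 0 i *: L (delta_mx 0 i).
Proof.
move=> linL v.
pose LM := GRing.isLinear.Build _ _ _ _ _ linL.
pose LL : {linear _ -> _} := HB.pack L LM.
rewrite {1}(row_sum_delta v) -[L _]/(LL _) linear_sum; apply: eq_bigr => i _.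
by rewrite linearZ.
Qed.

Lemma bf_suml (R : realType) n (A : 'M[R]_n) (I : Type) (r : seq I) (P : pred I)
  (F : I -> 'rV[R]_n) v : bf A (\sum_(i <- r | P i) F i) v = \sum_(i <- r | P i) bf A (F i) v.
Proof.
elim/big_rec2: _ => [|i y1 y2 _ <-]; first by rewrite bf0l.
by rewrite bfDl.
Qed.

Lemma bf_sumr (R : realType) n (A : 'M[R]_n) (I : Type) (r : seq I) (P : pred I)
  (F : I -> 'rV[R]_n) v : bf A v (\sum_(i <- r | P i) F i) = \sum_(i <- r | P i) bf A v (F i).
Proof.
elim/big_rec2: _ => [|i y1 y2 _ <-]; first by rewrite bf0r.
by rewrite bfDr.
Qed.

Lemma orthonormal_trace (R : realType) n (G : 'M[R]_n) (k : nat)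
  (w : 'I_k -> 'rV[R]_n) (t : 'I_k -> R) :
  (forall v, 0 <= bf G v v) ->
  (forall i j, bf G (w i) (w j) + t i * t j = (i == j)%:R) ->
  k%:R - 1 <= \sum_i bf G (w i) (w i).
Proof.
move=> pG wt.
have wE i j : bf G (w i) (w j) = (i == j)%:R - t i * t j by rewrite -(wt i j) addrK.
pose T := \sum_i t i ^+ 2.
have S i : \sum_j t j * ((i == j)%:R - t i * t j) = t i * (1 - T).
  under eq_bigr do rewrite mulrBr.
  rewrite sumrB (bigD1 i) //= eqxx mulr1 big1 ?addr0; last first.
    by move=> j ji; rewrite eq_sym (negbTE ji) mulr0.
  rewrite mulrBr mulr1 /T mulr_sumr; congr (_ - _); apply: eq_bigr => j _.
  by rewrite mulrCA -expr2.
have TT : 0 <= T * (1 - T).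
  have := pG (\sum_i t i *: w i).
  rewrite bf_suml (_ : \sum_i _ = T * (1 - T)) // mulr_suml; apply: eq_bigr => i _.
  rewrite bfZl bf_sumr expr2 -mulrA -S; congr (_ * _); apply: eq_bigr => j _.
  by rewrite bfZr wE.
have T1 : T <= 1 by move: TT; clear; nra.
under eq_bigr do rewrite wE eqxx -expr2.
by rewrite sumrB sumr_const card_ord lerD2l lerN2.
Qed.

Lemma hessian_algebra (R : realType) (p s w d a h : R) :
  p = d + s -> h = w - s -> a = 2 * (w + d) -> a <= 0 -> p <= - h.
Proof. by move=> -> -> ->; lra. Qed.

Lemma bf_row (R : realType) n k (B : 'M[R]_n) (Q : 'M[R]_(k, n)) i j :
  bf B (row i Q) (row j Q) = (Q *m B *m Q^T) i j.
Proof.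
by rewrite /bf -row_mul mxE [RHS]mxE; apply: eq_bigr => l _; rewrite !mxE.
Qed.

Section Hypersurface.
Context {R : realType} {n : nat} {N : riem R n} {M : mfd R n}.
Hypothesis hn : (2 <= n)%N.
Hypothesis rN : is_riemannian N.
Variables (E : @euclid R n -> N) (Ei : N -> @euclid R n).
Hypotheses (sE : smooth E) (sEi : smooth Ei) (EK : cancel E Ei) (EiK : cancel Ei E).
Variable xo : N.
Hypothesis expE : is_exp xo (E : 'rV[R]_n -> N).
Variable kappa : R.
Hypothesis kappa_gt0 : 0 < kappa.
Hypothesis Ncurv : radial_sectional_le xo (- kappa ^+ 2).
Hypothesis gM : good_charts M.
Variable f : M -> prod_riem N (line R).
Hypothesis sf : smooth f.
Variables (H : R) (a : M).
Hypothesis immf : row_free (jac f a).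
Hypothesis Hf : mean_curvature_at f a H.
Hypothesis amax : forall m, radius E Ei (proj1 f m) <= radius E Ei (proj1 f a).

Local Notation g := (gE E).
Let mg := gE_metric rN sE sEi EK.
Let pg := gE_pos rN sE sEi EK.
Let lineg := gE_line rN sE sEi EK EiK expE.
Let sf1 := proj1_smooth sf.
Let X (y : 'rV[R]_n) : 'rV[R]_n := Ei (proj1 f (from a y)).
Let x0 := to a a.
Let q := proj1 f a.
Let sX : vsmooth X x0 := X_smooth rN sEi gM sf1 a.
Let r := radius E Ei q.

Lemma X_base : X x0 = Ei q.
Proof. by rewrite /X /x0 fromK_base. Qed.

Lemma dom_Xq : dom q (E (X x0)).
Proof. by rewrite X_base EiK; exact: dom_base. Qed.

Let U (y : 'rV[R]_n) : R := bf (g 0) (X y) (X y).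

Lemma U_max y : U y <= U x0.
Proof.
have := amax (from a y); rewrite /radius ler_sqrt; last exact: (gE_psd rN sE sEi EK).
by rewrite -X_base.
Qed.

Lemma U_smooth : smooth_at U x0.
Proof. by apply: smooth_at_bf => //; exact: msmooth_cst. Qed.

Let W v := 'D_v X x0.
Let A u v := 'D_u ('D_v X) x0 + Chr g (X x0) (W u) (W v).

Lemma derive_U v y : derivable X y v -> 'D_v U y = 2 * bf (g 0) (X y) ('D_v X y).
Proof.
move=> dX.
have [_ ->] := is_derive_bf (@derivable_cst R _ _ (g 0) y v) dX dX.
rewrite derive_cst (_ : bf 0 _ _ = 0); last by rewrite /bf mulmx0 mul0mx mxE.
by rewrite add0r (bfC ('D_v X y) _ (metric_sym (mg 0))) -mulr2n -[LHS]mulr_natl.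
Qed.

Lemma max_orthogonal v : bf (g (X x0)) (X x0) (W v) = 0.
Proof.
have D := derive_at_max v U_smooth U_max.
have DU := derive_U (vsmooth_derivable (v := v) sX).
have Ga := gauss mg lineg (X x0) (W v).
etransitivity; first exact: Ga.
have aux (s t : R) : s = 0 -> s = 2 * t -> t = 0.
  by move=> -> /eqP; rewrite eq_sym mulf_eq0 pnatr_eq0 => /eqP.
exact: aux D DU.
Qed.

Lemma max_hessian v : bf (g (X x0)) (A v v) (X x0) <= - hess g (X x0) (W v).
Proof.
have D2 := derive2_at_max v U_smooth U_max.
have NU : \forall y \near x0, 'D_v U y = 2 * bf (g 0) (X y) ('D_v X y).
  apply: filterS (vsmooth_near_derivable sX) => y dy; apply: derive_U.
  by apply: derivable_coord => j; have [dd _] := dy v j; exact: (derivable_mxP X y v).1 dd 0 j.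
have sV := vsmooth_derive_smooth v sX.
have [d3 E3] := is_derive_bf (@derivable_cst R _ _ (g 0) x0 v)
  (vsmooth_derivable (v := v) sX) (vsmooth_derivable (v := v) sV).
have Z : bf ('D_v (cst (g 0)) x0) (X x0) ('D_v X x0) = 0.
  by rewrite derive_cst /bf mulmx0 mul0mx mxE.
have [_ E4] := is_derive_mul (is_derive_cst (2 : R) x0 v) (derivableP d3).
have E5 := etrans (near_eq_derive v NU) E4.
have He := hessE mg lineg (X x0) (W v).
have Ga := gauss mg lineg (X x0) (A v v).
have Gs := bfC (A v v) (X x0) (metric_sym (mg (X x0))).
have Ad : bf (g 0) (X x0) (A v v) = bf (g 0) (X x0) ('D_v ('D_v X) x0)
   + bf (g 0) (X x0) (Chr g (X x0) (W v) (W v)) by exact: bfDr.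
have S : 'D_v ('D_v U) x0 = 2 * (bf (g 0) (W v) (W v) + bf (g 0) (X x0) ('D_v ('D_v X) x0)).
  etransitivity; first exact: E5.
  by rewrite mul0r add0r; congr (_ * _); etransitivity; [exact: E3|rewrite Z add0r].
exact: hessian_algebra (etrans Gs (etrans Ga Ad)) He S D2.
Qed.


Local Notation x := (X x0).
Let J1 := jac (proj1 f) a.
Let J2 := jac (proj2 f) a.
Let T (v : 'rV[R]_n) : R := (v *m J2) 0 0.
Let D (u : 'rV[R]_n) : 'rV[R]_n := 'D_u (phi E q) x.

Lemma phi_base : phi E q x = to q q.
Proof. by rewrite /phi X_base EiK. Qed.

Lemma W_linear k u v : W (k *: u + v) = k *: W u + W v.
Proof. exact: vsmooth_derive_linear. Qed.

Lemma D_linear k u v : D (k *: u + v) = k *: D u + D v.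
Proof. exact: (Dphi_linear rN sE k u v dom_Xq). Qed.

Lemma row_J1 (v : 'rV[R]_n) : v *m J1 = D (W v).
Proof.
have L := @linear_sum_basis R n n (fun v => D (W v)).
have LDW k u w : D (W (k *: u + w)) = k *: D (W u) + D (W w).
  by rewrite W_linear D_linear.
rewrite (L LDW) mulmx_sum_row; apply: eq_bigr => i _; congr (_ *: _).
exact: (row_jac rN sE sEi EiK gM sf1 a i).
Qed.

Lemma bf_D u v : bf (metric q (to q q)) (D u) (D v) = bf (g x) u v.
Proof. by rewrite -phi_base; symmetry; exact: (bf_gE rN sE u v dom_Xq). Qed.

Lemma lsubmx_jac v : lsubmx (v *m jac f a) = D (W v).
Proof. by rewrite jac_prod mul_mx_row row_mxKl; exact: row_J1. Qed.

Lemma inner_jac u v :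
  inner (f a) (u *m jac f a) (v *m jac f a) = bf (g x) (W u) (W v) + T u * T v.
Proof.
rewrite inner_prod !lsubmx_jac bf_D; congr (_ + _).
by rewrite jac_prod !mul_mx_row !row_mxKr bfE !big_ord1 [1%:M _ _]mxE eqxx mul1r.
Qed.

Lemma A_linear k u v w : A (k *: u + v) w = k *: A u w + A v w.
Proof.
have E1 := vsmooth_derive_linear k u v (vsmooth_derive_smooth w sX).
have E2 : Chr g x (W (k *: u + v)) (W w) = k *: Chr g x (W u) (W w) + Chr g x (W v) (W w).
  by rewrite W_linear ChrDl ChrZl.
have aux (y1 y2 z1 z2 z3 z4 : 'rV[R]_n) : y1 = k *: z1 + z2 -> y2 = k *: z3 + z4 ->
    y1 + y2 = k *: (z1 + z3) + (z2 + z4) by move=> -> ->; rewrite scalerDr addrACA.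
exact: aux E1 E2.
Qed.

Lemma A_sym u v : A u v = A v u.
Proof.
have E1 := vsmooth_schwarz v u sX.
have E2 := Chr_sym (W u) (W v) (mg x).
exact: (congr2 (fun y z : 'rV[R]_n => y + z) E1 E2).
Qed.

Lemma A_sum v : A v v = \sum_i \sum_j (v 0 i * v 0 j) *: A (delta_mx 0 i) (delta_mx 0 j).
Proof.
have L w := @linear_sum_basis R n n (fun u => A u w) (fun k u v => A_linear k u v w).
rewrite L; apply: eq_bigr => i _.
rewrite A_sym L scaler_sumr; apply: eq_bigr => j _.
by rewrite scalerA A_sym.
Qed.

Let nu : 'rV[R]_(n + 1) := row_mx (D (r^-1 *: x)) 0.

Lemma inner_nu u : inner (f a) u nu = bf (metric q (to q q)) (lsubmx u) (D (r^-1 *: x)).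
Proof. by rewrite inner_prod /nu row_mxKl row_mxKr bf0r addr0. Qed.

Lemma sff_nu v : second_fundamental_form f a nu v v = r^-1 * bf (g x) (A v v) x.
Proof.
rewrite -bfZr A_sum bf_suml; apply: eq_bigr => i _.
rewrite bf_suml; apply: eq_bigr => j _.
rewrite bfZl inner_nu (cov_second_proj1 rN f); congr (_ * _).
rewrite (cov_secondE rN sE sEi EK EiK gM sf1 a i j).
exact: bf_D.
Qed.

Lemma bf0_x : bf (g 0) x x = r ^+ 2.
Proof. by rewrite /r /radius sqr_sqrtr ?X_base //; exact: (gE_psd rN sE sEi EK). Qed.

Lemma nu_normal : r != 0 -> unit_normal f a nu.
Proof.
move=> r0; split.
  have E1 := etrans (norm_radial mg lineg x) bf0_x.
  have aux (s : R) : s = r ^+ 2 -> r^-1 * (r^-1 * s) = 1.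
    by move=> ->; rewrite expr2 mulKf // mulVf.
  have E2 : bf (g x) (r^-1 *: x) (r^-1 *: x) = r^-1 * (r^-1 * bf (g x) x x).
    by rewrite bfZl bfZr.
  have E3 : inner (f a) nu nu = bf (g x) (r^-1 *: x) (r^-1 *: x).
    by rewrite inner_nu /nu row_mxKl; exact: bf_D.
  exact: etrans E3 (etrans E2 (aux _ E1)).
move=> v.
have O := max_orthogonal v.
have E1 : inner (f a) (v *m jac f a) nu = bf (g x) (W v) (r^-1 *: x).
  by rewrite inner_nu lsubmx_jac; exact: bf_D.
have E2 : bf (g x) (W v) (r^-1 *: x) = r^-1 * bf (g x) x (W v).
  by rewrite bfZr; congr (_ * _); exact: bfC (metric_sym (mg x)).
have aux (s : R) : s = 0 -> r^-1 * s = 0 by move=> ->; rewrite mulr0.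
exact: etrans E1 (etrans E2 (aux _ O)).
Qed.

Lemma orthonormal_exists : exists Q : 'M[R]_n, orthonormal_basis f a Q.
Proof.
pose J := jac f a; pose G := metric (f a) (to (f a) (f a)).
have GE u v : bf (J *m G *m J^T) u v = bf G (u *m J) (v *m J).
  by rewrite /bf trmx_mul !mulmxA.
have zl : lsubmx (to (f a) (f a)) = to q q by rewrite /to /= row_mxKl.
have G_block : G = block_mx (metric q (to q q)) 0 0 1%:M by rewrite /G /metric /= zl.
have sG : G^T = G.
  by rewrite G_block tr_block_mx !trmx0 trmx1 (metric_sym (metric_atN rN (dom_base rN q))).
have sJ : (J *m G *m J^T)^T = J *m G *m J^T by rewrite !trmx_mul trmxK sG mulmxA.
have pJ v : v != 0 -> 0 < bf (J *m G *m J^T) v v.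
  move=> v0; rewrite GE G_block; apply: block_posdef.
    by move=> u; exact: (metric_posN rN (dom_base rN q)).
  by rewrite mulmx_free_eq0.
have [Q QE] := orthonormal_rows sJ pJ (leqnn n).
exists Q => i j.
have := congr1 (fun B : 'M[R]_n => B i j) QE; rewrite [1%:M i j]mxE => <-.
by rewrite -[LHS]GE bf_row.
Qed.

Lemma orthonormal_W (Q : 'M[R]_n) : orthonormal_basis f a Q ->
  n%:R - 1 <= \sum_i bf (g x) (W (row i Q)) (W (row i Q)).
Proof.
move=> oQ; apply: (@orthonormal_trace R n (g x) n _ (fun i => T (row i Q))).
  by move=> v; exact: (gE_psd rN sE sEi EK).
by move=> i j; rewrite -oQ; symmetry; exact: inner_jac.
Qed.

Lemma n1_gt0 : 0 < n%:R - 1 :> R.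
Proof. by rewrite subr_gt0 ltr1n. Qed.

Lemma r_gt0 : 0 < r.
Proof.
rewrite lt_neqAle sqrtr_ge0 andbT eq_sym; apply/negP => /eqP r0.
have x_eq0 : x = 0.
  apply/eqP; apply: contraT => xn0.
  have := pg 0 xn0; rewrite bf0_x r0 expr0n /=; lra.
have [Q oQ] := orthonormal_exists.
have := orthonormal_W oQ; rewrite leNgt => /negP; apply.
apply: le_lt_trans n1_gt0; apply: sumr_le0 => i _.
have MH := max_hessian (row i Q).
have Z1 : bf (g x) (A (row i Q) (row i Q)) x = 0 by rewrite [X in bf _ _ X]x_eq0 bf0r.
have He := hessE mg lineg x (W (row i Q)).
have Z2 : bf (g 0) x (Chr g x (W (row i Q)) (W (row i Q))) = 0 by rewrite [X in bf _ X _]x_eq0 bf0l.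
have G0 : bf (g 0) (W (row i Q)) (W (row i Q)) = bf (g x) (W (row i Q)) (W (row i Q)).
  by rewrite x_eq0.
have aux (s h w w' c : R) : s <= - h -> s = 0 -> h = w - c -> c = 0 -> w = w' -> w' <= 0.
  by move=> sh s0 hE c0 <-; move: sh; rewrite s0 hE c0 subr0 oppr_ge0.
exact: aux MH Z1 He Z2 G0.
Qed.

Lemma max_curvature :
  kappa * (n%:R - 1) * (expR (kappa * r) + (expR (kappa * r))^-1)
    <= n%:R * `|H| * (expR (kappa * r) - (expR (kappa * r))^-1).
Proof.
have r0 := r_gt0.
have [Q oQ] := orthonormal_exists.
rewrite -(Hf (nu_normal (lt0r_neq0 r0)) oQ).
have kr : 0 < kappa * r by exact: mulr_gt0.
set e := expR (kappa * r).
have e1 : 1 < e by rewrite /e expR_gt1.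
have C0 : 0 < kappa * (e + e^-1).
  by rewrite mulr_gt0 // addr_gt0 ?invr_gt0 // (lt_trans ltr01).
have S0 : 0 <= e - e^-1.
  by rewrite subr_ge0 (@le_trans _ _ 1) ?(ltW e1) // invf_le1 ?(ltW e1) // (lt_trans ltr01).
have K (v : 'rV[R]_n) : kappa * (e + e^-1) * bf (g x) (W v) (W v) <=
    - second_fundamental_form f a nu v v * (e - e^-1).
  have h1 := hess_lower rN sE sEi EK EiK expE kappa_gt0 Ncurv r0 bf0_x (max_orthogonal v).
  have h2 := max_hessian v.
  have h3 := sff_nu v.
  have ri0 : 0 < r^-1 by rewrite invr_gt0.
  have aux (s d h w : R) : kappa * r * (e + e^-1) * w <= h * (e - e^-1) -> d <= - h ->
      s = r^-1 * d -> kappa * (e + e^-1) * w <= - s * (e - e^-1).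
    move=> a1 a2 ->; rewrite -(ler_pM2l r0) !mulrA mulrN mulVKf ?gt_eqF //.
    rewrite [r * kappa]mulrC; apply: le_trans a1 _.
    by apply: ler_wpM2r => //; rewrite lerNr.
  exact: aux h1 h2 h3.
have sumK : kappa * (e + e^-1) * \sum_i bf (g x) (W (row i Q)) (W (row i Q)) <=
    - (\sum_i second_fundamental_form f a nu (row i Q) (row i Q)) * (e - e^-1).
  rewrite -sumrN mulr_sumr mulr_suml; apply: ler_sum => i _; exact: K.
apply: (@le_trans _ _ (kappa * (e + e^-1) * \sum_i bf (g x) (W (row i Q)) (W (row i Q)))).
  by rewrite mulrAC ler_pM2l //; exact: orthonormal_W.
apply: le_trans sumK _; apply: ler_wpM2r => //.
by rewrite -normrN; exact: ler_norm.
Qed.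

End Hypersurface.

(** * The estimate of the extrinsic radius *)

Section HyperbolicCotangent.
Context {R : realType}.
Implicit Types x y c : R.

Lemma cothE x : 0 < x -> coth x = 1 + 2 / (expR x ^+ 2 - 1).
Proof.
move=> x0; rewrite /coth expRN.
have e1 : 1 < expR x by rewrite expR_gt1.
have e0 : expR x != 0 by rewrite gt_eqF // expR_gt0.
have d0 : expR x ^+ 2 - 1 != 0 by rewrite gt_eqF // subr_gt0 exprn_egt1.
move: (expR x) e1 e0 d0 => e e1 e0 d0.
by field; rewrite e0 d0.
Qed.

Lemma coth_gt1 x : 0 < x -> 1 < coth x.
Proof.
move=> x0; rewrite cothE // ltrDl divr_gt0 // subr_gt0 exprn_egt1 //.
by rewrite expR_gt1.
Qed.

Lemma coth_lt x y : 0 < x -> x < y -> coth y < coth x.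
Proof.
move=> x0 xy; have y0 := lt_trans x0 xy.
have p z : 0 < z -> 0 < expR z ^+ 2 - 1 by move=> z0; rewrite subr_gt0 exprn_egt1 // expR_gt1.
rewrite !cothE // ltrD2l ltr_pM2l // ltf_pV2 ?posrE ?p // ltrD2r.
by rewrite ltr_pXn2r ?nnegrE ?expR_ge0 // ltr_expR.
Qed.

Lemma coth_onto c : 1 < c -> exists2 y, 0 < y & coth y = c.
Proof.
move=> c1; have d0 : 0 < c - 1 by rewrite subr_gt0.
have q1 : 1 < (c + 1) / (c - 1) by rewrite ltr_pdivlMr // mul1r; lra.
have q0 := lt_trans ltr01 q1.
have y0 : 0 < 2^-1 * ln ((c + 1) / (c - 1)) by rewrite mulr_gt0 // ln_gt0.
exists (2^-1 * ln ((c + 1) / (c - 1))) => //.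
rewrite cothE // -expRM_natl mulrA divff ?pnatr_eq0 // mul1r lnK ?posrE //.
have n0 : c - 1 != 0 by rewrite gt_eqF.
have -> : (c + 1) / (c - 1) - 1 = 2 / (c - 1) by field.
by rewrite invf_div mulrCA divff ?pnatr_eq0 // mulr1 addrC subrK.
Qed.

Lemma arccoth_le c y : 0 < y -> coth y <= c -> (arccoth c <= y%:E)%E.
Proof.
move=> y0 yc; have c1 := lt_le_trans (coth_gt1 y0) yc.
rewrite /arccoth (gt_eqF c1) lee_fin.
have [z z0 zc] := coth_onto c1.
have [] := @xgetPex _ 0 [set y : R | 0 < y /\ coth y = c].
  by exists z.
move: (xget _ _) => w w0 wc; rewrite leNgt; apply/negP => /(coth_lt y0).
by rewrite wc ltNge yc.
Qed.

End HyperbolicCotangent.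

Section Estimate.
Context {R : realType} {n : nat} {N : riem R n} {M : mfd R n}.
Hypothesis hn : (2 <= n)%N.
Hypothesis rN : is_riemannian N.
Variable xo : N.
Hypothesis pole : is_pole xo.
Variable kappa : R.
Hypothesis kappa_gt0 : 0 < kappa.
Hypothesis Ncurv : radial_sectional_le xo (- kappa ^+ 2).

Lemma radius_continuous (E : @euclid R n -> N) (Ei : N -> @euclid R n) :
  smooth Ei -> continuous (radius E Ei : N -> R).
Proof.
move=> [cEi _] m; apply: (@continuous_comp _ _ _ (fun m => bf (gE E 0) (Ei m) (Ei m)) (@Num.sqrt R));
  last exact: sqrt_continuous.
apply: (@continuous_comp _ _ _ Ei (fun x : 'rV[R]_n => bf (gE E 0) x x)); first exact: cEi.
apply: smooth_continuous; apply: smooth_at_bf; [exact: msmooth_cst|exact: vsmooth_id|exact: vsmooth_id].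
Qed.

Lemma cmc_radius_bound (f : M -> prod_riem N (line R)) (H : R) :
  closed_cmc_hypersurface f H ->
  exists r, [/\ 0 < r, coth (kappa * r) <= n%:R / ((n%:R - 1) * kappa) * `|H|
                & r <= extrinsic_radius xo (fst @` range f)].
Proof.
move=> [[mM cM [m0 _]] [sf immf] Hf].
have [E expE [sE [Ei [EK EiK] sEi]]] := pole.
have gM := manifold_charts mM.
have cr : {within [set: M], continuous (radius E Ei \o proj1 f)}.
  apply: continuous_subspaceT => m; apply: continuous_comp; last exact: radius_continuous.
  by have [c1 _] := proj1_smooth sf; exact: c1.
have [|a _ amax] := compact_EVT_max _ cM cr; first by exists m0.
have am m : radius E Ei (proj1 f m) <= radius E Ei (proj1 f a) by apply: amax; rewrite in_setT.
have r0 := r_gt0 hn rN sE sEi EK EiK expE gM sf (immf a) am.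
have K := max_curvature hn rN sE sEi EK EiK expE kappa_gt0 Ncurv gM sf (immf a) (Hf a) am.
exists (radius E Ei (proj1 f a)); split => //.
  have kr : 0 < kappa * radius E Ei (proj1 f a) by exact: mulr_gt0.
  have n1 : 0 < (n%:R - 1) * kappa by rewrite mulr_gt0 // subr_gt0 ltr1n.
  have s0 : 0 < expR (kappa * radius E Ei (proj1 f a)) - expR (- (kappa * radius E Ei (proj1 f a))).
    by rewrite subr_gt0 ltr_expR gt0_cp.
  have aux (C S h l : R) : 0 < S -> kappa * (n%:R - 1) * C <= l * h * S ->
      C / S <= l / ((n%:R - 1) * kappa) * h.
    move=> S0 C_le; rewrite ler_pdivrMr //.
    have -> : l / ((n%:R - 1) * kappa) * h * S = (l * h * S) / ((n%:R - 1) * kappa) by ring.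
    by rewrite ler_pdivlMr // mulrC [_ * kappa]mulrC.
  by rewrite /coth; apply: aux => //; rewrite expRN; exact: K.
apply: ub_le_sup.
  exists (radius E Ei (proj1 f a)) => _ [_ [_ [m _ <-] <-] <-].
  rewrite (rdist_radius rN sE sEi EK EiK expE); exact: am.
exists (proj1 f a); last exact: (rdist_radius rN sE sEi EK EiK expE).
by exists (f a) => //; exists a.
Qed.

End Estimate.

Theorem theorem1p3 (R : realType) (n : nat) (hn : (2 <= n)%N)
    (N : riem R n) (xo : N) (kappa : R)
    (Ncomplete : complete_riem N) (xo_pole : is_pole xo)
    (kappa_gt0 : 0 < kappa)
    (Ncurv : radial_sectional_le xo (- kappa ^+ 2)) :
  (forall (M : mfd R n) (f : M -> prod_riem N (line R)) (H : R),
     closed_cmc_hypersurface f H ->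
     (n%:R - 1) * kappa / n%:R <= `|H| /\
     ((kappa^-1)%:E * arccoth (n%:R / ((n%:R - 1) * kappa) * `|H|)
        <= (extrinsic_radius xo (fst @` range f))%:E)%E) /\
  (forall (M : nat -> mfd R n) (f : forall i, M i -> prod_riem N (line R))
          (H : nat -> R),
     (forall i, closed_cmc_hypersurface (f i) (H i)) ->
     `|H i| @[i --> \oo] --> (n%:R - 1) * kappa / n%:R ->
     extrinsic_radius xo (fst @` range (f i)) @[i --> \oo] --> +oo).
Proof.
have [rN _] := Ncomplete.
have n1 : 0 < (n%:R - 1) * kappa by rewrite mulr_gt0 // subr_gt0 ltr1n.
have n0 : 0 < n%:R :> R by rewrite ltr0n (leq_trans _ hn).
have c_lt (c h : R) : (c < n%:R / ((n%:R - 1) * kappa) * h) =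
    ((n%:R - 1) * kappa / n%:R * c < h).
  by rewrite -ltr_pdivrMl ?divr_gt0 // invf_div.
have lt_c (c h : R) : (n%:R / ((n%:R - 1) * kappa) * h < c) =
    (h < (n%:R - 1) * kappa / n%:R * c).
  by rewrite -ltr_pdivlMl ?divr_gt0 // invf_div.
split=> [M f H cmc|M f H cmc limH].
  have [r [r0 Hr rR]] := cmc_radius_bound hn rN xo_pole kappa_gt0 Ncurv cmc.
  have kr : 0 < kappa * r by exact: mulr_gt0.
  split.
    by have := lt_le_trans (coth_gt1 kr) Hr; rewrite c_lt mulr1 => /ltW.
  apply: (@le_trans _ _ ((kappa^-1)%:E * (kappa * r)%:E)%E).
    by apply: lee_wpmul2l; [rewrite lee_fin invr_ge0 ltW|exact: arccoth_le].
  by rewrite -EFinM mulKf ?gt_eqF // lee_fin.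
apply/cvgryPge => A; pose B := Num.max A 1.
have B0 : 0 < B by rewrite lt_max ltr01 orbT.
have kB : 0 < kappa * B by exact: mulr_gt0.
have lim_lt : (n%:R - 1) * kappa / n%:R < (n%:R - 1) * kappa / n%:R * coth (kappa * B).
  by rewrite ltr_pMr ?divr_gt0 //; exact: coth_gt1.
apply: filterS (cvgr_lt _ limH _ lim_lt) => i Hi.
have [r [r0 Hr rR]] := cmc_radius_bound hn rN xo_pole kappa_gt0 Ncurv (cmc i).
apply: le_trans rR; apply: (@le_trans _ _ B); first by rewrite le_max lexx.
rewrite leNgt; apply/negP => rB.
have krB : kappa * r < kappa * B by rewrite ltr_pM2l.
have := lt_le_trans (coth_lt (mulr_gt0 kappa_gt0 r0) krB) Hr.
by rewrite c_lt ltNge (ltW Hi).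
Qed.
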